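(* Let $d\ge 1$, $0<\gamma\le 1$, and let $\mathcal{N}=(N_{p,q})_{(p,q)\in\mathbb{N}^2}\in(0,+\infty)^{\mathbb{N}^2}$ be a sequence which is non-decreasing with respect to the two indexes and such that the diagonal sequence $\mathcal{M}=(N_{p,p})_{p\in\mathbb{N}}$ is a logarithmically convex quasi-analytic sequence. Let $\rho:\mathbb{R}^d\to(0,+\infty)$ be a positive contraction mapping such that there exist constants $m>0$, $R>0$ with $$\forall x\in\mathbb{R}^d,\quad 0<m\le\rho(x)\le R\langle x\rangle.$$ Let $\omega$ be a measurable subset of $\mathbb{R}^d$. If $\omega$ is $\gamma$-thick with respect to $\rho$, then there exist positive constants $K=K(d,\rho)\ge 1$, $K'=K'(d,\rho,\gamma)\ge 1$, $r=r(d,\rho)\ge 1$ (depending on the dimension $d$, on the density $\rho$, and, for the second one, on $\gamma$) such that for all $0<\varepsilon\le N_{0,0}^2$, $$\forall f\in GS_{\mathcal{N},\rho},\quad \|f\|^2_{L^2(\mathbb{R}^d)}\le C_\varepsilon\|f\|^2_{L^2(\omega)}+\varepsilon\|f\|^2_{GS_{\mathcal{N},\rho}},$$ where $$C_\varepsilon=K'\Big(\frac{2d}{\gamma}\,\Gamma_{\mathcal{M}}\big(2n_{t_0,\mathcal{M},r}\big)\Big)^{4n_{t_0,\mathcal{M},r}},\qquad t_0=\frac{\varepsilon^{1/2}}{K N_{d,d}}.$$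
   Context: $\mathbb{N}$ is the set of non-negative integers, $\langle x\rangle=(1+\|x\|^2)^{1/2}$ with $\|\cdot\|$ the Euclidean norm, $|A|$ is Lebesgue measure of $A$, and $B(x,L)$ is the Euclidean ball centered at $x$ with radius $L$. Thickness: $\omega$ is $\gamma$-thick with respect to $\rho:\mathbb{R}^d\to(0,+\infty)$ if $|\omega\cap B(x,\rho(x))|\ge\gamma|B(x,\rho(x))|$ for all $x\in\mathbb{R}^d$. A positive function $\rho$ is a contraction mapping if there is $0\le L<1$ with $|\rho(x)-\rho(y)|\le L\|x-y\|$ for all $x,y\in\mathbb{R}^d$. $\mathcal{N}$ is non-decreasing with respect to the two indexes if $N_{p,q}\le N_{p',q'}$ whenever $p\le p'$ and $q\le q'$. Space: $GS_{\mathcal{N},\rho}$ is the set of $f\in\mathcal{C}^\infty(\mathbb{R}^d)$ such that $$\|f\|_{GS_{\mathcal{N},\rho}}:=\sup_{k\in\mathbb{N},\,\beta\in\mathbb{N}^d}\frac{\|\rho(x)^k\partial_x^\beta f\|_{L^2(\mathbb{R}^d)}}{N_{k,|\beta|}}<+\infty.$$ A sequence $\mathcal{M}=(M_p)_{p\in\mathbb{N}}$ of positive reals is logarithmically convex if $M_p^2\le M_{p+1}M_{p-1}$ for all $p\ge1$. For $U\subset\mathbb{R}^d$ open, $\mathcal{C}_{\mathcal{M}}(U)=\{f\in\mathcal{C}^\infty(U,\mathbb{C}):\ \forall\beta\in\mathbb{N}^d,\ \|\partial_x^\beta f\|_{L^\infty(U)}\le M_{|\beta|}\}$. A logarithmically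 convex sequence $\mathcal{M}$ is quasi-analytic if the only function in $\mathcal{C}_{\mathcal{M}}((0,1))$ vanishing to infinite order at a point of $(0,1)$ is zero; by the Denjoy–Carleman theorem this is equivalent to $\sum_{p\ge1}M_{p-1}/M_p=+\infty$. Bang degree: for $0<t\le1$, $r>0$, $$n_{t,\mathcal{M},r}=\sup\Big\{N\in\mathbb{N}:\ \sum_{-\log t<n\le N}\frac{M_{n-1}}{M_n}<r\Big\},$$ the sum being $0$ when $N=0$ (more generally when empty); it is finite if $\mathcal{M}$ is quasi-analytic. For $p\ge1$: $\gamma_{\mathcal{M}}(p)=\sup_{1\le j\le p}j\Big(\frac{M_{j+1}M_{j-1}}{M_j^2}-1\Big)$ and $\Gamma_{\mathcal{M}}(p)=4e^{4+4\gamma_{\mathcal{M}}(p)}$. If $n_{t_0,\mathcal{M},r}=0$, the power defining $C_\varepsilon$ is read as $1$. *)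

(* Defs.v *)
From HB Require Import structures.
From mathcomp Require Import all_boot all_order all_algebra.
From mathcomp Require Import complex.
From mathcomp Require Import all_classical all_reals all_analysis.

Set Implicit Arguments.
Unset Strict Implicit.
Unset Printing Implicit Defensive.

Import Order.TTheory GRing.Theory Num.Theory.
Import numFieldNormedType.Exports.

Local Open Scope classical_set_scope.
Local Open Scope ring_scope.

Section row_measurable.
Context {R : realType}.

(* The product sigma-algebra on R^n; it coincides with the Borel one. *)
Section instance.
Variable n : nat.
Let coor (i : 'I_n) (x : 'rV[R]_n) : measurableTypeR R := x 0 i.

Let row_set0 : g_sigma_preimage coor set0.
Proof. exact: sigma_algebra0. Qed.

Let row_setC A : g_sigma_preimage coor A -> g_sigma_preimage coor (~` A).
Proof. exact: sigma_algebraC. Qed.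

Let row_bigcup (F : (set 'rV[R]_n)^nat) :
  (forall i, g_sigma_preimage coor (F i)) ->
  g_sigma_preimage coor (\bigcup_i (F i)).
Proof. exact: sigma_algebra_bigcup. Qed.

HB.instance Definition _ := @isMeasurable.Build default_measure_display
  'rV[R]_n (g_sigma_preimage coor) row_set0 row_setC row_bigcup.

Lemma measurable_coor (i : 'I_n) : measurable_fun [set: 'rV[R]_n] (coor i).
Proof.
move=> _ Y mY; rewrite setTI; apply: sub_sigma_algebra => /=.
rewrite -bigcup_seq/=; exists i => /=; first by rewrite mem_index_enum.
by exists Y => //; rewrite setTI.
Qed.

Lemma measurable_fun_row d (T : measurableType d) (f : T -> 'rV[R]_n) :
  (forall i, measurable_fun [set: T] (coor i \o f)) ->
  measurable_fun [set: T] f.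
Proof.
move=> mf _ A mA; rewrite setTI.
suff : g_sigma_preimage coor `<=` [set A | measurable (f @^-1` A)] by exact.
apply: smallest_sub.
  split => [|B /= mB|F /= mF].
  - by rewrite /= preimage_set0.
  - by rewrite setTD preimage_setC; exact: measurableC.
  - by rewrite preimage_bigcup; exact: bigcup_measurable.
rewrite -bigcup_seq/=; apply: bigcup_sub => i _ _ [B mB <-] /=.
by rewrite setTI -comp_preimage -[X in measurable X]setTI; exact: mf.
Qed.

End instance.

Variable n : nat.

Definition row_cons (p : measurableTypeR R * 'rV[R]_n) : 'rV[R]_n.+1 :=
  row_mx (p.1)%:M p.2.

Definition row_uncons (x : 'rV[R]_n.+1) : measurableTypeR R * 'rV[R]_n :=
  (x 0 ord0, @rsubmx _ 1 1 n x).

Lemma row_consK : cancel row_cons row_uncons.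
Proof.
move=> [a y]; rewrite /row_cons /row_uncons row_mxKr; congr pair.
have -> : ord0 = lshift n (ord0 : 'I_1) by exact: val_inj.
by apply: etrans (row_mxEl (a%:M : 'M[R]_1) y 0 0) _; rewrite mxE eqxx.
Qed.

Lemma measurable_row_cons : measurable_fun setT row_cons.
Proof.
apply: measurable_fun_row => i.
case: (split_ordP (i : 'I_(1 + n))) => j ->.
- rewrite (_ : _ \o _ = fst) //; apply/funext => -[a y] /=.
  by apply: etrans (row_mxEl (a%:M : 'M[R]_1) y 0 j) _; rewrite mxE ord1 eqxx.
- rewrite (_ : _ \o _ = (fun x : 'rV[R]_n => x 0 j : measurableTypeR R) \o snd).
    by apply: measurableT_comp => //; exact: measurable_coor.
  by apply/funext => -[a y]; exact: row_mxEr (a%:M : 'M[R]_1) y 0 j.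
Qed.

Lemma measurable_row_uncons : measurable_fun setT row_uncons.
Proof.
apply: measurable_fun_pair; first exact: measurable_coor.
apply: measurable_fun_row => i.
rewrite (_ : _ \o _ = fun x : 'rV[R]_n.+1 => x 0 (rshift 1 i)).
  exact: measurable_coor.
by apply/funext => x /=; rewrite mxE.
Qed.

End row_measurable.

Lemma product_sigma_finite d1 d2 (T1 : measurableType d1)
    (T2 : measurableType d2) (R : realType)
    (m1 : {sigma_finite_measure set T1 -> \bar R})
    (m2 : {sigma_finite_measure set T2 -> \bar R}) :
  sigma_finite setT (m1 \x m2)%E.
Proof.
have /sigma_finiteP[F [TF ndF Foo]] := sigma_finiteT m1.
have /sigma_finiteP[G [TG ndG Goo]] := sigma_finiteT m2.
exists (fun n => F n `*` G n).
  rewrite -setXTT TF TG predeqE => -[x y]; split.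
    move=> [/= [n _ Fnx] [k _ Gky]]; exists (maxn n k) => //; split.
    - by move: x Fnx; exact/subsetPset/ndF/leq_maxl.
    - by move: y Gky; exact/subsetPset/ndG/leq_maxr.
  by move=> [n _ []/= ? ?]; split; exists n.
move=> k; have [? ?] := Foo k; have [? ?] := Goo k.
split; first exact: measurableX.
by rewrite product_measure1E// lte_mul_pinfty// ge0_fin_numE.
Qed.

Section lebesgue.
Context {R : realType}.

(* Borel-Lebesgue measure on R^n, as an iterated product measure. *)
Fixpoint borel_lebesgue (n : nat) : set 'rV[R]_n -> \bar R :=
  match n with
  | 0 => \d_(0 : 'rV[R]_0)
  | n'.+1 =>
    pushforward (lebesgue_measure \x @borel_lebesgue n')%E (@row_cons R n')
  end.

Lemma borel_lebesgue_sigma_finite_measure n :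
  {mu : {sigma_finite_measure set 'rV[R]_n -> \bar R} |
    mu = @borel_lebesgue n :> (set 'rV[R]_n -> \bar R)}.
Proof.
elim: n => [|n [mu muE]]; first by exists \d_(0 : 'rV[R]_0).
pose nu : {measure set 'rV[R]_n.+1 -> \bar R} :=
  @measure_function_pushforward__canonical__measure_function_Measure _ _ _ _ _
    (lebesgue_measure \x mu)%E _ (@measurable_row_cons R n).
have nu_sfin : sigma_finite setT nu.
  have [F FT Foo] := product_sigma_finite (@lebesgue_measure R) mu.
  exists (fun k => @row_uncons R n @^-1` F k).
    by rewrite -preimage_bigcup -FT preimage_setT.
  move=> k; split.
    rewrite -[X in measurable X]setTI.
    by apply: measurable_row_uncons => //; exact: (Foo k).1.
  rewrite /nu /= /pushforward -comp_preimage.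
  rewrite (_ : _ \o _ = idfun) ?preimage_id; first exact: (Foo k).2.
  by apply/funext => p; exact: row_consK.
pose sig := @isSigmaFinite.Build _ _ _ nu nu_sfin.
pose sfin := @isSFinite.Build _ _ _ nu (sfinite_measure_sigma_finite nu_sfin).
pose m : {sigma_finite_measure set 'rV[R]_n.+1 -> \bar R} :=
  HB.pack (nu : set _ -> \bar R) (Measure.class nu) sig sfin.
by exists m; rewrite /= -muE.
Qed.

Let borel_lebesgue0 n : @borel_lebesgue n set0 = 0%E.
Proof. by have [mu <-] := borel_lebesgue_sigma_finite_measure n. Qed.

Let borel_lebesgue_ge0 n A : (0 <= @borel_lebesgue n A)%E.
Proof. by have [mu <-] := borel_lebesgue_sigma_finite_measure n. Qed.

Let borel_lebesgue_sigma_additive n : semi_sigma_additive (@borel_lebesgue n).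
Proof.
have [mu <-] := borel_lebesgue_sigma_finite_measure n.
exact: measure_semi_sigma_additive.
Qed.

Let borel_lebesgue_sigma_finite n : sigma_finite setT (@borel_lebesgue n).
Proof.
have [mu <-] := borel_lebesgue_sigma_finite_measure n; exact: sigma_finiteT.
Qed.

HB.instance Definition _ n := isMeasure.Build _ _ _ (@borel_lebesgue n)
  (borel_lebesgue0 n) (@borel_lebesgue_ge0 n)
  (@borel_lebesgue_sigma_additive n).

HB.instance Definition _ n := Measure_isSigmaFinite.Build _ _ _
  (@borel_lebesgue n) (@borel_lebesgue_sigma_finite n).

Definition lebesgue_type (n : nat) :=
  caratheodory_type ((@borel_lebesgue n)^*)%mu.

(* The Lebesgue measure on R^n is the completion of the previous one, defined
   on the sigma-algebra of Lebesgue measurable sets. *)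
Definition lebesgue (n : nat) : set (lebesgue_type n) -> \bar R :=
  @completed_measure_extension _ 'rV[R]_n R (@borel_lebesgue n).

HB.instance Definition _ n := Measure.on (@lebesgue n).

Let lebesgue_sigma_finite n : sigma_finite setT (@lebesgue n).
Proof.
exact/completed_measure_extension_sigma_finite/borel_lebesgue_sigma_finite.
Qed.

HB.instance Definition _ n := @Measure_isSigmaFinite.Build _ _ _
  (@lebesgue n) (@lebesgue_sigma_finite n).

Definition lebesgue_measurable (n : nat) (A : set 'rV[R]_n) : Prop :=
  measurable (A : set (lebesgue_type n)).

(* Norm of the restriction of g to A in L^p(A). *)
Definition Lp_norm (n : nat) (p : \bar R) (A : set 'rV[R]_n)
    (g : 'rV[R]_n -> R[i]) : \bar R :=
  'N[@lebesgue n]_p[(fun x => (Normc.normc (g x))%:E) \_ A]%E.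

End lebesgue.

Section euclidean.
Context {R : realType} {d : nat}.
Implicit Types (x y : 'rV[R]_d) (rho : 'rV[R]_d -> R).

(* The norm of 'rV[R]_d provided by the library is the sup norm. *)
Definition euclidean_norm x : R := Num.sqrt (\sum_(i < d) x 0 i ^+ 2).

Definition japanese_bracket x : R := Num.sqrt (1 + euclidean_norm x ^+ 2).

Definition euclidean_ball x (L : R) : set 'rV[R]_d :=
  [set y | euclidean_norm (y - x) < L].

Definition thick (gamma : R) rho (omega : set 'rV[R]_d) : Prop :=
  forall x, (gamma%:E * @lebesgue R d (euclidean_ball x (rho x)) <=
    @lebesgue R d (omega `&` euclidean_ball x (rho x)))%E.

Definition contraction_map rho : Prop :=
  exists L : R, 0 <= L < 1 /\
    forall x y, `|rho x - rho y| <= L * euclidean_norm (x - y).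

End euclidean.

Section smooth_functions.
Context {R : realType} {d : nat}.
Implicit Types (u : 'rV[R]_d -> R) (f : 'rV[R]_d -> R[i]) (U : set 'rV[R]_d).

Definition basis_vec (i : 'I_d) : 'rV[R]_d := delta_mx 0 i.

Definition partial (i : 'I_d) u : 'rV[R]_d -> R := 'D_(basis_vec i) u.

(* u is C^oo on the open set U: all its iterated partial derivatives, in any
   order, exist and are continuous on U. *)
Definition real_smooth U u : Prop :=
  forall (s : seq 'I_d) x, U x ->
    {for x, continuous (foldr partial u s)} /\
    forall i, derivable (foldr partial u s) x (basis_vec i).

Definition real_partial_multi (beta : 'I_d -> nat) u : 'rV[R]_d -> R :=
  foldr (fun i v => iter (beta i) (partial i) v) u (enum 'I_d).

Definition smooth U f : Prop :=
  real_smooth U (fun x => complex.Re (f x)) /\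
  real_smooth U (fun x => complex.Im (f x)).

Definition partial_multi (beta : 'I_d -> nat) f : 'rV[R]_d -> R[i] :=
  fun x => Complex (real_partial_multi beta (fun y => complex.Re (f y)) x)
                   (real_partial_multi beta (fun y => complex.Im (f y)) x).

Definition mlength (beta : 'I_d -> nat) : nat := (\sum_(i < d) beta i)%N.

Definition weighted_partial (rho : 'rV[R]_d -> R) (k : nat)
    (beta : 'I_d -> nat) f : 'rV[R]_d -> R[i] :=
  fun x => (rho x ^+ k)%:C%C * partial_multi beta f x.

Definition GS_norm (N : nat -> nat -> R) (rho : 'rV[R]_d -> R) f : \bar R :=
  ereal_sup (range (fun kb : nat * ('I_d -> nat) =>
    (Lp_norm 2%:E setT (weighted_partial rho kb.1 kb.2 f)
     * (N kb.1 (mlength kb.2))^-1%:E)%E)).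

Definition GS (N : nat -> nat -> R) (rho : 'rV[R]_d -> R) f : Prop :=
  smooth setT f /\ (GS_norm N rho f < +oo)%E.

Definition class_CM (M : nat -> R) U f : Prop :=
  smooth U f /\ forall beta : 'I_d -> nat,
    (Lp_norm +oo%E U (partial_multi beta f) <= (M (mlength beta))%:E)%E.

End smooth_functions.

Section sequences.
Context {R : realType}.
Implicit Types (M : nat -> R) (N : nat -> nat -> R).

Definition nondecreasing2 N : Prop :=
  forall p q p' q', (p <= p')%N -> (q <= q')%N -> N p q <= N p' q'.

Definition log_convex M : Prop :=
  forall p, (1 <= p)%N -> M p ^+ 2 <= M p.+1 * M p.-1.

(* The interval (0,1), as a subset of R^1. *)
Definition unit_interval : set 'rV[R]_1 := [set x | 0 < x 0 0 < 1].

Definition quasi_analytic M : Prop :=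
  forall f : 'rV[R]_1 -> R[i], class_CM M unit_interval f ->
    (exists2 x0, unit_interval x0 &
      forall beta : 'I_1 -> nat, partial_multi beta f x0 = 0) ->
    forall x, unit_interval x -> f x = 0.

Definition bang_set (t : R) M (r : R) : set nat :=
  [set n | \sum_(1 <= k < n.+1 | - ln t < k%:R) M k.-1 / M k < r].

(* The supremum of bang_set t M r, which contains 0 when r > 0; junk value 0
   when this set is unbounded. *)
Definition bang_degree (t : R) M (r : R) : nat :=
  xget 0%N [set n | bang_set t M r n /\
                    forall m, bang_set t M r m -> (m <= n)%N].

Definition gamma_seq M (p : nat) : R :=
  sup [set j%:R * (M j.+1 * M j.-1 / M j ^+ 2 - 1) |
       j in [set j : nat | (1 <= j <= p)%N]].

Definition Gamma_seq M (p : nat) : R := 4 * expR (4 + 4 * gamma_seq M p).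

(* gamma0 is the thickness parameter and n the Bang degree; the power is 1
   when n = 0. *)
Definition C_const (d : nat) (gamma0 K' : R) M (n : nat) : R :=
  K' * ((2 * d%:R / gamma0) * Gamma_seq M (2 * n)%N) ^+ (4 * n)%N.

End sequences.

(* Main.v *)
Require Import Defs.
From mathcomp Require Import all_boot all_order all_algebra.
From mathcomp Require Import complex.
From mathcomp Require Import all_classical all_reals all_analysis measurable_realfun.
From mathcomp Require Import ring lra zify.

(**
The proof is a localization of Bang's quantitative form of quasi-analyticity.
It suffices to treat a real function u: the real and the imaginary part of f
satisfy the same bounds, and each is allowed half of the error eps.

Cover space by the balls B(x, rho x). As rho is a contraction, it is
comparable to rho x on the slightly larger ball B(x, lam * rho x), and
averaging over these balls is bounded on integrals (averaging); this continuous
bounded overlap property replaces a covering. Let F be the sum of the squares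
of the weighted derivatives rho^|s| D_s u / M_|s| over all words s of
coordinates, with weights (2 d)^-|s| which make the integral of F at most twice
the square of the norm of f (word_energy). Let x be a point. Either rho^d u^2 at
x is at most a small multiple of the integral of F over B(x, lam * rho x), and
after averaging such points contribute to the error term; or all derivatives of
u on this ball are controlled by |u x|. In the second case local_bound shows
that u x ^+ 2 is at most a constant times the mean of u ^+ 2 on the part of
omega inside B(x, rho x), and averaging turns this into the integral over omega
(global_bound).

The local estimate reduces to one variable. Sobolev's inequality on a cube turns
the integral bounds into pointwise bounds for the derivatives (word_sup). If the
estimate failed, then |u| would be much smaller than |u x| on a set E of points
of omega which is a definite fraction of the ball; by the scaling of Lebesgue
measure alone, some segment starting at x meets E in many well separated points
(pigeonhole_scales). On that segment u is a function g whose derivatives are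
bounded by a logarithmically convex sequence, and remez_segment bounds g 0 by
the small values of g. Indeed Rolle's theorem applied to g minus its
interpolating polynomial produces, for each order k <= n, a point where the
derivative of order k is small, and Bang's descent (bang_bound) propagates this
smallness back to 0 as soon as the sum of the ratios M k / M k.+1 along the
descent is large compared to the length of the segment. The Bang degree is the
order at which this happens. The loss of d derivatives in Sobolev's inequality
is absorbed by the constant K.

Finally the Bang degree has to be finite, that is, the sum of the ratios has to
diverge. If it converged, then convolving a ramp with the uniform densities on
the intervals [0, 2 M k / M k.+1] would give a nonzero function of the class
which vanishes on a half-line, contradicting quasi-analyticity
(denjoy_carleman).
*)

Set Implicit Arguments.
Unset Strict Implicit.
Unset Printing Implicit Defensive.

Import Order.TTheory GRing.Theory Num.Theory.
Import numFieldNormedType.Exports.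

Local Open Scope classical_set_scope.
Local Open Scope ring_scope.

(** * Rolle chains and Lagrange interpolation *)

Lemma is_derive_continuous (R : realType) (f : R -> R) (df x : R) :
  is_derive x 1 f df -> {for x, continuous f}.
Proof.
by move=> h; apply/differentiable_continuous/derivable1_diffP; exact: ex_derive.
Qed.

Lemma rolle_step (R : realType) (f df : R -> R) (n : nat) (x : nat -> R) :
  (forall t : R, is_derive t 1 f (df t)) ->
  (forall i, (i < n)%N -> x i < x i.+1) ->
  (forall i, (i <= n)%N -> f (x i) = 0) ->
  exists z : nat -> R, forall i, (i < n)%N ->
    [/\ x i < z i, z i < x i.+1 & df (z i) = 0].
Proof.
move=> fdf x_lt fx0.
suff /choice[z zP] : forall i, exists z, (i < n)%N ->
    [/\ x i < z, z < x i.+1 & df z = 0] by exists z.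
move=> i; have [ilt|] := boolP (i < n)%N; last by exists 0.
have [||| c cab dc] := Rolle (x_lt i ilt) (f := f).
- by move=> t _; exact: ex_derive.
- apply: continuous_subspaceT => t; exact: is_derive_continuous (fdf t).
- by rewrite !fx0// ltnW.
exists c => _; move: cab; rewrite in_itv/= => /andP[? ?]; split => //.
by rewrite -(@derive_val _ _ _ _ _ _ _ (fdf c)) (@derive_val _ _ _ _ _ _ _ dc).
Qed.

(** Rolle's theorem is applied to g 0, g 1, ... in turn. Keeping each time the
leftmost of the zeros found gives one zero per order, and these zeros move to
the right as the order grows: Bang's argument visits them from right to left. *)
Lemma rolle_chain (R : realType) (n : nat) (g : nat -> R -> R) (x : nat -> R) :
  (forall k (t : R), is_derive t 1 (g k) (g k.+1 t)) ->
  (forall i, (i < n)%N -> x i < x i.+1) ->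
  (forall i, (i <= n)%N -> g 0 (x i) = 0) ->
  exists y : nat -> R,
    [/\ y 0 = x 0, forall k, (k < n)%N -> y k <= y k.+1,
        forall k, (k <= n)%N -> y k <= x n &
        forall k, (k <= n)%N -> g k (y k) = 0].
Proof.
elim: n g x => [|n IH] g x dg x_lt gx0.
  by exists (fun=> x 0); split => // -[]// _; exact: gx0.
have [z zP] := rolle_step (dg 0) x_lt gx0.
have [||y [y0 y_le y_n gy]] := IH (fun k => g k.+1) z.
- move=> i ilt; have [_ ? _] := zP i (ltnW ilt).
  by have [? _ _] := zP i.+1 ilt; lra.
- by move=> i ile; have [] := zP i ile.
have [xz0 _ _] := zP 0 isT; have [_ zxn _] := zP n (ltnSn n).
exists (fun k => if k is k'.+1 then y k' else x 0); split => //.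
- by case=> [|k] klt; [rewrite y0 ltW|exact: y_le].
- case=> [_|k kle]; last by rewrite (le_trans (y_n _ kle))// ltW.
  by apply: (le_trans _ (ltW zxn)); rewrite (le_trans (ltW xz0))// -y0; exact: y_n.
- by case=> [_|k kle]; [exact: gx0|exact: gy].
Qed.

Lemma ffactS_rec (n k : nat) : (n.+1 ^_ k.+1 = n ^_ k.+1 + k.+1 * n ^_ k)%N.
Proof.
rewrite ffactSS ffactnSr [(k.+1 * _)%N]mulnC -mulnDr mulnC.
have [kn|nk] := leqP k n; last by rewrite ffact_small.
by congr (_ * _)%N; lia.
Qed.

(** By Leibniz' rule each derivative removes one factor, the remaining ones being
at most 1 in absolute value; n ^_ k counts the ways to remove k factors. *)
Lemma derivn_prod_bound (R : realType) (s : seq R) (k : nat) (t : R) :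
  0 <= t <= 1 -> all (fun a : R => 0 <= a <= 1) s ->
  `|(\prod_(a <- s) ('X - a%:P))^`(k).[t]| <= (size s ^_ k)%:R.
Proof.
move=> /andP[t0 t1]; elim: s k => [|a s IH] k /=.
  rewrite big_nil => _; case: k => [|k]; first by rewrite derivn0 hornerE normr1.
  by rewrite derivn_poly0 ?horner0 ?normr0// size_poly1.
move=> /andP[/andP[a0 a1] sP]; rewrite big_cons.
set p := \prod_(_ <- _) _.
have pE j : (('X - a%:P) * p)^`(j.+1) =
    ('X - a%:P) * p^`(j.+1) + j.+1%:R *: p^`(j).
  elim: j => [|j IHj].
    by rewrite !derivn1 derivM derivXsubC mul1r derivn0 scale1r addrC.
  rewrite derivnS IHj derivD derivM derivXsubC mul1r derivZ -!derivnS.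
  rewrite -[j.+2%:R]natr1 scalerDl scale1r addrAC addrC.
  by congr (_ + _); exact: addrC.
have ta : `|t - a| <= 1 by rewrite ler_norml; lra.
case: k => [|k].
  rewrite derivn0 hornerM normrM !hornerE.
  have := IH 0%N sP; rewrite derivn0 ffactn0 => h.
  by rewrite -[leRHS]mulr1 ler_pM.
rewrite pE hornerD hornerM hornerZ !hornerE (le_trans (ler_normD _ _))//.
rewrite ffactS_rec natrD lerD//.
  by rewrite normrM -[leRHS]mul1r ler_pM//; exact: IH.
rewrite normrM natrM (ger0_norm (ler0n _ _))//.
by rewrite ler_wpM2l// IH.
Qed.

(** On either side of x j the nodes are at distance at least sigma, 2 sigma,
3 sigma, and so on: hence the two factorials. *)
Lemma lower_bound_nodal (R : realType) (n : nat) (x : nat -> R) (sigma : R) (j : nat) :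
  0 < sigma -> (j <= n)%N ->
  (forall i k, (i <= k <= n)%N -> sigma * (k - i)%:R <= x k - x i) ->
  sigma ^+ n * (j`! * (n - j)`!)%:R <=
    \prod_(i < n.+1 | i != j :> nat) `|x j - x i|.
Proof.
move=> s0 jn xs.
have -> : \prod_(i < n.+1 | i != j :> nat) `|x j - x i| =
  (\prod_(0 <= i < j) `|x j - x i|) * \prod_(j.+1 <= i < n.+1) `|x j - x i|.
  rewrite -(big_mkord (fun i => i != j) (fun i => `|x j - x i|)).
  rewrite (big_cat_nat (n := j)) ?leqW//=; congr (_ * _).
    by apply: congr_big_nat => // i; lia.
  by rewrite big_ltn_cond// eqxx/=; apply: congr_big_nat => // i; lia.
have -> : sigma ^+ n * (j`! * (n - j)`!)%:R =
  (sigma ^+ j * j`!%:R) * (sigma ^+ (n - j) * (n - j)`!%:R) :> R.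
  by rewrite natrM -{1}(subnKC jn) exprD; ring.
apply: ler_pM.
- by rewrite mulr_ge0// exprn_ge0// ltW.
- by rewrite mulr_ge0// exprn_ge0// ltW.
- have -> : sigma ^+ j * j`!%:R = \prod_(0 <= i < j) (sigma * (j - i)%:R).
    rewrite big_split/= big_const_nat subn0 iter_mulr_1 -natr_prod; congr (_ * _%:R).
    by rewrite big_mkord -ffact_prod ffactnn.
  rewrite !big_nat; apply: ler_prod => i /andP[_ ij].
  apply/andP; split; first by rewrite mulr_ge0// ltW.
  by apply: le_trans (ler_norm _); apply: xs; lia.
- have -> : sigma ^+ (n - j) * (n - j)`!%:R =
     \prod_(j.+1 <= i < n.+1) (sigma * (i - j)%:R).
    rewrite big_split/= big_const_nat subSS iter_mulr_1 -natr_prod; congr (_ * _%:R).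
    rewrite fact_prod -[j.+1]/(1 + j)%N big_addn subSn//.
    by apply: eq_bigr => i _; rewrite addnK.
  rewrite !big_nat; apply: ler_prod => i /andP[ji ij].
  apply/andP; split; first by rewrite mulr_ge0// ltW.
  by rewrite distrC; apply: le_trans (ler_norm _); apply: xs; lia.
Qed.

Lemma sum_inv_fact (R : realType) (n : nat) :
  \sum_(j < n.+1) ((j`! * (n - j)`!)%:R)^-1 = 2 ^+ n / n`!%:R :> R.
Proof.
have -> : 2 ^+ n = \sum_(j < n.+1) 'C(n, j)%:R :> R.
  by rewrite -natrX (expnDn 1 1) natr_sum; apply: eq_bigr => i _; rewrite !exp1n !muln1.
rewrite mulr_suml; apply: eq_bigr => j _.
have h := bin_fact (ltn_ord j : (j <= n)%N).
rewrite -[in RHS]h [in RHS]natrM invfM mulrA divff ?mul1r//.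
by rewrite pnatr_eq0 -lt0n bin_gt0 -ltnS.
Qed.

(** Lagrange's formula. The reciprocals of the nodal products sum up to a multiple
of a sum of binomial coefficients, which is the origin of 2 ^+ n / n`!. *)
Lemma interpolation (R : realType) (n : nat) (x f : nat -> R) (sigma e : R) :
  0 < sigma ->
  (forall i, (i <= n)%N -> 0 <= x i <= 1) ->
  (forall i k, (i <= k <= n)%N -> sigma * (k - i)%:R <= x k - x i) ->
  (forall i, (i <= n)%N -> `|f i| <= e) ->
  exists P : {poly R}, [/\ (size P <= n.+1)%N,
    forall i, (i <= n)%N -> P.[x i] = f i &
    forall k (t : R), 0 <= t <= 1 ->
      `|P^`(k).[t]| <= e * (n ^_ k)%:R * (2 ^+ n / (sigma ^+ n * n`!%:R))].
Proof.
move=> s0 x01 xs fe.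
pose w j := \prod_(i < n.+1 | i != j :> nat) ('X - (x i)%:P) : {poly R}.
pose wj (j : nat) := \prod_(i < n.+1 | i != j :> nat) (x j - x i).
have wwj j : (w j).[x j] = wj j.
  by rewrite /w horner_prod; apply: eq_bigr => i _; rewrite !hornerE.
have fact_pos j : 0 < (j`! * (n - j)`!)%:R :> R by rewrite ltr0n muln_gt0 !fact_gt0.
have wj_ge (j : nat) : (j <= n)%N -> sigma ^+ n * (j`! * (n - j)`!)%:R <= `|wj j|.
  by move=> jn; rewrite /wj normr_prod; exact: lower_bound_nodal.
have wj0 (j : nat) : (j <= n)%N -> 0 < `|wj j|.
  by move=> jn; apply: lt_le_trans (wj_ge _ jn); rewrite mulr_gt0// exprn_gt0.
have wE (j : nat) : w j = \prod_(a <- [seq x i | i <- iota 0 n.+1 & i != j]) ('X - a%:P).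
  by rewrite big_map big_filter /w -(big_mkord (fun i => i != j) (fun i => 'X - (x i)%:P)).
have sz (j : nat) : (j <= n)%N -> size [seq x i | i <- iota 0 n.+1 & i != j] = n.
  move=> jn; rewrite size_map -rem_filter ?iota_uniq// size_rem ?size_iota//.
  by rewrite mem_iota.
have s01 (j : nat) : all (fun a : R => 0 <= a <= 1) [seq x i | i <- iota 0 n.+1 & i != j].
  rewrite all_map; apply/allP => i; rewrite mem_filter mem_iota => /andP[_ ilt].
  exact: x01.
exists (\sum_(j < n.+1) (f j / wj j) *: w j); split.
- apply: (leq_trans (size_sum _ _ _)); apply/bigmax_leqP => j _.
  apply: (leq_trans (size_scale_leq _ _)).
  by rewrite wE size_prod_XsubC sz// -ltnS.
- move=> i iN; rewrite horner_sum (bigD1 (Ordinal (iN : (i < n.+1)%N)))//= big1.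
    by rewrite addr0 hornerZ wwj divfK// -normr_gt0 wj0.
  move=> j ji; rewrite hornerZ /w horner_prod (bigD1 (Ordinal (iN : (i < n.+1)%N)))/=.
    by rewrite hornerXsubC subrr mul0r mulr0.
  by apply: contra ji => /eqP ij; apply/eqP/val_inj.
- move=> k t t01; rewrite linear_sum horner_sum.
  apply: (le_trans (ler_norm_sum _ _ _)).
  have -> : e * (n ^_ k)%:R * (2 ^+ n / (sigma ^+ n * n`!%:R)) =
      \sum_(j < n.+1) e * (n ^_ k)%:R * ((sigma ^+ n)^-1 * (j`! * (n - j)`!)%:R^-1).
    by rewrite -!mulr_sumr sum_inv_fact invfM; ring.
  apply: ler_sum => j _.
  have jn : (j <= n)%N by rewrite -ltnS.
  rewrite linearZ/= hornerZ normrM normrM normfV mulrAC; apply: ler_pM => //.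
  - apply: ler_pM => //; first exact: fe.
    by rewrite wE -[n in leRHS](sz j)// derivn_prod_bound.
  - by rewrite -invfM lef_pV2 ?wj_ge// posrE ?wj0// mulr_gt0 ?exprn_gt0.
Qed.

Lemma le_head (R : realType) (y : nat -> R) (n : nat) :
  (forall k, (k < n)%N -> y k <= y k.+1) ->
  forall k, (k <= n)%N -> y 0 <= y k.
Proof.
move=> yle; elim=> [//|k IH] kn.
exact: le_trans (IH (ltnW kn)) (yle _ kn).
Qed.

(** The remainder of Lagrange interpolation: subtract from g 0 its interpolant and
the multiple of the nodal polynomial that makes the difference vanish at 0 as
well; among n + 2 zeros Rolle's theorem finds a zero of the derivative of order
n + 1. *)
Lemma interpolation_error (R : realType) (n : nat) (g : nat -> R -> R)
    (x : nat -> R) (sigma e C : R) :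
  (forall k (t : R), is_derive t 1 (g k) (g k.+1 t)) ->
  (forall t : R, 0 <= t <= 1 -> `|g n.+1 t| <= C) ->
  0 < sigma -> 0 < x 0 ->
  (forall i, (i <= n)%N -> 0 <= x i <= 1) ->
  (forall i k, (i <= k <= n)%N -> sigma * (k - i)%:R <= x k - x i) ->
  (forall i, (i <= n)%N -> `|g 0 (x i)| <= e) ->
  `|g 0 0| <= e * (2 ^+ n / (sigma ^+ n * n`!%:R)) + C / n.+1`!%:R.
Proof.
move=> dg gC s0 x0 x01 xs gx.
have [P [szP Px PB]] := interpolation (f := fun i => g 0%N (x i)) s0 x01 xs gx.
have P0 : `|P.[0]| <= e * (2 ^+ n / (sigma ^+ n * n`!%:R)).
  have := PB 0%N 0; rewrite derivn0 ffactn0 mulr1; apply; lra.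
pose W := \prod_(a <- [seq x i | i <- iota 0 n.+1]) ('X - a%:P).
have szW : size W = n.+2 by rewrite size_prod_XsubC size_map size_iota.
have W1 : `|W.[0]| <= 1.
  have := @derivn_prod_bound R [seq x i | i <- iota 0 n.+1] 0 0.
  rewrite derivn0 ffactn0; apply; first lra.
  by rewrite all_map; apply/allP => i; rewrite mem_iota => /andP[_ ?]; exact: x01.
have x_inc i k : (i <= k <= n)%N -> x i <= x k.
  move=> ikn; rewrite -subr_ge0; apply: le_trans (xs i k ikn).
  by rewrite mulr_ge0// ltW.
have W00 : W.[0] != 0.
  rewrite -[_ == 0]/(root W 0) root_prod_XsubC; apply/mapP => -[k klt xk].
  move: klt; rewrite mem_iota => /andP[_ klt]; have := x_inc 0%N k.
  by rewrite /= -ltnS => /(_ klt); rewrite -xk leNgt x0.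
have Wx i : (i <= n)%N -> W.[x i] = 0.
  by move=> ile; apply/rootP; rewrite root_prod_XsubC map_f// mem_iota.
have Wn : W^`(n.+1) = n.+1`!%:R%:P.
  have Wm : W \is monic by exact: monic_prod_XsubC.
  rewrite -[W](subrK ('X^(n.+1))) linearD [_ (W - _)]derivn_poly0 ?add0r.
    by rewrite [LHS]derivnXn ffactnn subnn expr0 -polyC1 -polyCMn.
  apply/leq_sizeP => j; rewrite leq_eqVlt => /predU1P[<-|nj].
    have := monicP Wm; rewrite /lead_coef szW/= coefB coefXn eqxx => ->.
    by rewrite subrr.
  by rewrite coefB coefXn (gtn_eqF nj) nth_default ?subr0// szW.
pose c := (g 0%N 0 - P.[0]) / W.[0].
pose Q := P + c *: W.
pose h k t := g k t - Q^`(k).[t].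
have dh k (t : R) : is_derive t 1 (h k) (h k.+1 t).
  by rewrite /h derivnS; apply: is_deriveB.
pose y i := if i is i'.+1 then x i' else 0.
have [|i|z [z0 zle zn hz]] := rolle_chain dh (n := n.+1) (x := y).
- case=> [|i]//= ilt; rewrite -subr_gt0; apply: lt_le_trans (xs i i.+1 _) => //.
    by rewrite subSnn mulr1.
  by rewrite leqnSn.
- rewrite /h derivn0 /Q hornerD hornerZ; case: i => [_|i ile] /=.
    by rewrite /c divfK//; ring.
  by rewrite Wx// mulr0 addr0 Px// subrr.
have zn1 : 0 <= z n.+1 <= 1.
  rewrite (le_trans (zn _ (leqnn _)) _); last by have /andP[] := x01 n (leqnn n).
  by rewrite andbT; have := le_head zle (leqnn n.+1); rewrite z0.
have := hz n.+1 (leqnn _); rewrite /h /Q derivnD derivnZ hornerD hornerZ Wn.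
rewrite derivn_poly0// horner0 add0r hornerC => /eqP; rewrite subr_eq0 => /eqP gz.
have fpos : 0 < n.+1`!%:R :> R by rewrite ltr0n fact_gt0.
have cC : `|c| <= C / n.+1`!%:R.
  rewrite ler_pdivlMr// -[X in _ * X]gtr0_norm// -normrM -gz; exact: gC.
have -> : g 0%N 0 = P.[0] + c * W.[0] by rewrite /c divfK// addrC subrK.
rewrite (le_trans (ler_normD _ _))// lerD// normrM -[leRHS]mulr1.
by rewrite ler_pM.
Qed.

Lemma is_derive_ext (R : realType) (f g : R -> R) (t a b : R) :
  is_derive t 1 f a -> f =1 g -> a = b -> is_derive t 1 g b.
Proof. by move=> fa /funext <- <-. Qed.

(** * Bang's descent *)

Lemma is_derive_expR_affine (R : realType) (c m x C t : R) :
  is_derive t 1 (fun s => expR (c + m * (x - s)) * C)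
     (- (m * expR (c + m * (x - t)) * C)).
Proof.
have h : is_derive t 1 (fun s : R => c + m * (x - s)) (- m).
  apply: is_derive_ext (is_deriveD (is_derive_cst (c + m * x) t 1)
    (is_deriveZ (- m) (is_derive_id t 1))) _ _ => [s|].
    by rewrite -[LHS]/(c + m * x + - m * s); ring.
  by rewrite /GRing.scale/=; ring.
have h2 := is_derive1_comp (g := fun s => c + m * (x - s)) (is_derive_expR _) h.
apply: is_derive_ext (is_deriveZ C h2) _ _ => [s|].
  exact: mulrC.
by rewrite /GRing.scale/=; ring.
Qed.

Lemma le_of_derive_left (R : realType) (f F df dF : R -> R) (a b : R) :
  (forall t : R, is_derive t 1 f (df t)) ->
  (forall t : R, is_derive t 1 F (dF t)) ->
  a <= b -> f b <= F b -> (forall t, a <= t <= b -> dF t <= df t) ->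
  f a <= F a.
Proof.
move=> hf hF ab fFb dle.
have hD (t : R) : is_derive t 1 (F - f) (dF t - df t) by exact: is_deriveB.
have [|c + E] := MVT_segment (f := F - f) (df := fun t => dF t - df t) ab (fun x _ => hD x).
  by apply: continuous_subspaceT => t; exact: is_derive_continuous (hD t).
rewrite in_itv/= => cab.
have : (dF c - df c) * (b - a) <= 0.
  by rewrite mulr_le0_ge0 ?subr_ge0// subr_le0 dle.
rewrite -E !fctE; lra.
Qed.

(** The level p measures how flat g is near x: raising p by one gains a factor e in
every order at least k. For the orders j >= p nothing more is asked than the
bound M j which holds everywhere. *)
Definition derivs_below (R : realType) (g : nat -> R -> R) (M : nat -> R) (p x : R) (k : nat) :=
  forall j, (k <= j)%N -> `|g j x| <= expR (j%:R - p) * M j.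

Lemma ratio_mono (R : realType) (M : nat -> R) (i j : nat) :
  (forall k, 0 < M k) -> log_convex M -> (i <= j)%N ->
  M i.+1 / M i <= M j.+1 / M j.
Proof.
move=> M0 lc; elim: j => [|j IH]; first by rewrite leqn0 => /eqP ->.
rewrite leq_eqVlt => /predU1P[->//|ij]; apply: le_trans (IH ij) _.
rewrite ler_pdivrMr// mulrAC ler_pdivlMr// -expr2.
exact: (lc j.+1).
Qed.

(** Moving to the left costs levels in proportion to the distance, at the rate
expR 1 * (M q.+1 / M q). For the orders above q the bound M j is enough; below,
the bound for the order j.+1 is integrated to give the one for the order j,
which works because M j.+1 / M j <= M q.+1 / M q. *)
Lemma bang_step (R : realType) (g : nat -> R -> R) (M : nat -> R) (p x x' : R) (k q : nat) :
  (forall k (t : R), is_derive t 1 (g k) (g k.+1 t)) ->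
  (forall k, 0 < M k) -> log_convex M ->
  (forall j (t : R), 0 <= t <= 1 -> `|g j t| <= M j) ->
  p <= q.+1%:R -> 0 <= x' -> x' <= x -> x <= 1 ->
  derivs_below g M p x k ->
  derivs_below g M (p - expR 1 * (M q.+1 / M q) * (x - x')) x' k.
Proof.
move=> dg M0 lc gM pq x'0 x'x x1 Sx.
pose m := expR 1 * (M q.+1 / M q).
have m0 : 0 <= m by rewrite mulr_ge0 ?expR_ge0// divr_ge0 ?ltW.
have high j (y : R) : (q < j)%N -> 0 <= y <= x -> `|g j y| <= expR (j%:R - p + m * (x - y)) * M j.
  move=> qj /andP[y0 yx]; apply: le_trans (gM j y _) _; first lra.
  rewrite -[leLHS]mul1r ler_pM2r//; apply: le_trans (expR_ge1Dx _).
  have : q.+1%:R <= j%:R :> R by rewrite ler_nat.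
  have : 0 <= m * (x - y) by rewrite mulr_ge0// subr_ge0.
  lra.
suff main i j (y : R) : (q.+1 <= i + j)%N -> (k <= j)%N -> 0 <= y <= x ->
    `|g j y| <= expR (j%:R - p + m * (x - y)) * M j.
  move=> j kj; have := main q.+1 j x' (leq_addr _ _) kj.
  by rewrite x'0 x'x opprB addrA addrAC => /(_ isT); rewrite addrC addrA [_ + j%:R]addrC.
elim: i j y => [|i IH] j y qij kj y0x; first exact: high.
have [qj|jq] := ltnP q j; first exact: high.
have {}IH (t : R) : y <= t <= x -> `|g j.+1 t| <= m * expR (j%:R - p + m * (x - t)) * M j.
  move=> /andP[yt tx]; apply: le_trans (IH j.+1 t _ _ _) _.
  - by rewrite addnS.
  - exact: leqW.
  - by rewrite tx andbT; case/andP: y0x => /le_trans ->.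
  rewrite -natr1 (_ : _ + 1 - p + _ = 1 + (j%:R - p + m * (x - t))); last by ring.
  rewrite expRD /m -mulrA -[leRHS]mulrA -[leRHS]mulrA ler_wpM2l ?expR_ge0//.
  rewrite [leRHS]mulrCA ler_wpM2l ?expR_ge0// -ler_pdivrMr//.
  exact: ratio_mono.
have yx : y <= x by case/andP: y0x.
have dF t := is_derive_expR_affine (j%:R - p) m x (M j) t.
have Fx : `|g j x| <= expR (j%:R - p + m * (x - x)) * M j.
  by rewrite subrr mulr0 addr0; exact: Sx.
rewrite ler_norml; apply/andP; split.
- rewrite lerNl.
  apply: (le_of_derive_left (f := - g j) (fun t => is_deriveN (dg j t)) dF yx).
    by apply: le_trans Fx; rewrite -normrN ler_norm.
  move=> t ytx; rewrite lerN2; exact: le_trans (ler_norm _) (IH t ytx).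
- apply: (le_of_derive_left (dg j) dF yx).
    by apply: le_trans Fx; rewrite ler_norm.
  move=> t ytx; rewrite lerNl; apply: le_trans (IH t ytx).
  by rewrite -normrN ler_norm.
Qed.

(** The level left at x when starting at the level q in b q and paying the rate
m i between b i and b i.+1. If that interval has length (m i)^-1 it costs one
level, so that the level at b i is i. *)
Fixpoint level (R : realType) (m b : nat -> R) (q : nat) (x : R) : R :=
  if q is q'.+1 then
    if b q' <= x then q%:R - m q' * (b q - x) else level m b q' x
  else 0.

Lemma level_ge (R : realType) (m b : nat -> R) (N q0 q : nat) (x : R) :
  (forall i, 0 < m i) -> (forall i, (i < N)%N -> b i.+1 = b i + (m i)^-1) ->
  (q0 <= q)%N -> (q <= N)%N -> b q0 <= x -> x <= b q -> q0%:R <= level m b q x.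
Proof.
move=> m0 bS; elim: q => [|q IH]; first by rewrite leqn0 => /eqP ->.
move=> q0q qN bx xb /=; case: ifPn => [bqx|].
  move: q0q; rewrite leq_eqVlt => /predU1P[q0E|q0q].
    have -> : x = b q.+1 by apply/eqP; rewrite eq_le xb -q0E bx.
    by rewrite subrr mulr0 subr0 q0E.
  have : m q * (b q.+1 - x) <= m q * (m q)^-1.
    by rewrite ler_pM2l// bS//; lra.
  rewrite divff ?gt_eqF// -natr1.
  have : q0%:R <= q%:R :> R by rewrite ler_nat.
  lra.
rewrite -ltNge => xbq; move: q0q; rewrite leq_eqVlt => /predU1P[q0E|q0q].
  by move: bx xbq; rewrite q0E bS// => ? ?; have := m0 q; rewrite -invr_gt0; lra.
by apply: IH => //; [exact: ltnW|exact: ltW].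
Qed.

Lemma level_le (R : realType) (m b : nat -> R) (q : nat) (x : R) :
  (forall i, 0 < m i) -> x <= b q -> level m b q x <= q%:R.
Proof.
move=> m0; elim: q => [//|q IH] xb /=; case: ifPn => [_|].
  by rewrite gerBl mulr_ge0 ?subr_ge0// ltW.
by rewrite -ltNge => /ltW/IH/le_trans -> //; rewrite ler_nat.
Qed.

(** The breakpoints between x' and x are crossed one at a time with bang_step;
below b 0 the level is 0 and the bound M j is enough. *)
Lemma level_descent (R : realType) (g : nat -> R -> R) (M b : nat -> R) (N k q : nat) (x x' : R) :
  (forall k (t : R), is_derive t 1 (g k) (g k.+1 t)) ->
  (forall k, 0 < M k) -> log_convex M ->
  (forall j (t : R), 0 <= t <= 1 -> `|g j t| <= M j) ->
  let m i := expR 1 * (M i.+1 / M i) in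
  (forall i, (i < N)%N -> b i.+1 = b i + (m i)^-1) ->
  (q <= N)%N -> x <= b q -> 0 <= x' -> x' <= x -> x <= 1 ->
  derivs_below g M (level m b q x) x k ->
  derivs_below g M (level m b q x') x' k.
Proof.
move=> dg M0 lc gM m bS; have m0 i : 0 < m i by rewrite mulr_gt0 ?expR_gt0 ?divr_gt0.
elim: q x => [|q IH] x qN xb x'0 x'x x1.
  move=> _ j _ /=; apply: le_trans (gM j x' _) _; first lra.
  rewrite -[leLHS]mul1r ler_pM2r//; apply: le_trans (expR_ge1Dx _).
  by rewrite subr0 lerDl.
have bSq := bS q qN.
have lvlb : level m b q (b q) = q%:R.
  apply/eqP; rewrite eq_le level_le//= (level_ge m0 bS)//; exact: ltnW.
have [bx'|x'b] := leP (b q) x'.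
  have bx := le_trans bx' x'x; rewrite /= bx bx' => Sx.
  have := bang_step (q := q) dg M0 lc gM _ x'0 x'x x1 Sx; rewrite -/(m q).
  have -> : q.+1%:R - m q * (b q.+1 - x) - m q * (x - x') = q.+1%:R - m q * (b q.+1 - x').
    by ring.
  by apply; rewrite gerBl mulr_ge0 ?subr_ge0// ltW.
rewrite /= (lt_geF x'b); case: ifPn => [bx Sx|]; last first.
  rewrite -ltNge => /ltW xbq Sx; apply: (IH x) => //; exact: ltnW.
apply: (IH (b q)) => //; [exact: ltnW|exact: ltW|exact: le_trans bx x1|].
rewrite lvlb.
have := bang_step (q := q) dg M0 lc gM _ _ bx x1 Sx; rewrite -/(m q).
have -> : q.+1%:R - m q * (b q.+1 - x) - m q * (x - b q) = q%:R.
  rewrite bSq -natr1 (_ : _ - _ - _ = q%:R + 1 - m q * (m q)^-1); last by ring.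
  by rewrite divff ?gt_eqF// addrK.
apply; last by apply: ltW; exact: le_lt_trans x'b.
by rewrite gerBl mulr_ge0 ?subr_ge0// ltW.
Qed.

(** Travel to the left from y n to 0. Between y k and y k.-1 only the derivatives of
order at least k are known to be below the current level; on reaching y k.-1 the
order k.-1 joins them, since g k.-1 is small there. The whole path has length at
most 1, and by the hypothesis on the sum it cannot use up the levels between
n.+1 and k1. *)
Lemma bang_bound (R : realType) (g : nat -> R -> R) (M y : nat -> R) (n k1 : nat) :
  (forall k (t : R), is_derive t 1 (g k) (g k.+1 t)) ->
  (forall k, 0 < M k) -> log_convex M ->
  (forall j (t : R), 0 <= t <= 1 -> `|g j t| <= M j) ->
  0 <= y 0 -> (forall k, (k < n)%N -> y k <= y k.+1) -> y n <= 1 ->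
  (forall k, (k <= n)%N -> `|g k (y k)| <= expR (k%:R - n.+1%:R) * M k) ->
  (k1 <= n.+1)%N -> expR 1 <= \sum_(k1 <= i < n.+1) M i / M i.+1 ->
  `|g 0 0| <= expR (- k1%:R) * M 0.
Proof.
move=> dg M0 lc gM y0 yle yn1 gy k1n sumge.
pose m i := expR 1 * (M i.+1 / M i).
have m0 i : 0 < m i by rewrite mulr_gt0 ?expR_gt0 ?divr_gt0.
pose b q := y n - \sum_(q <= i < n.+1) (m i)^-1.
have bS i : (i < n.+1)%N -> b i.+1 = b i + (m i)^-1.
  by move=> ilt; rewrite /b [in RHS]big_ltn//; ring.
have bN : b n.+1 = y n by rewrite /b big_geq ?subr0.
have yge := le_head yle.
have y1 k : (k <= n)%N -> y k <= y n.
  move=> kn; have := @le_head R (fun i => y (k + i)%N) (n - k)%N _ (n - k)%N (leqnn _).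
  rewrite addn0 subnKC//; apply=> i ilt; rewrite addnS; apply: yle; lia.
have y01 k : (k <= n)%N -> 0 <= y k <= 1.
  by move=> kn; rewrite (le_trans y0 (yge _ kn)) (le_trans (y1 _ kn)).
(* the order k joins the orders above k, as no level exceeds n.+1 *)
have cross p k : (k <= n)%N -> p <= n.+1%:R ->
    derivs_below g M p (y k) k.+1 -> derivs_below g M p (y k) k.
  move=> kn pn Sk j; rewrite leq_eqVlt => /predU1P[<-|]; last exact: Sk.
  by apply: le_trans (gy _ kn) _; rewrite ler_pM2r// ler_expR lerD2l lerN2.
have top k : (k <= n)%N -> level m b n.+1 (y k) <= n.+1%:R.
  by move=> kn; apply: level_le => //; rewrite bN y1.
have main i : (i <= n)%N ->
    derivs_below g M (level m b n.+1 (y (n - i)%N)) (y (n - i)%N) (n - i).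
  elim: i => [_|i IH ilt].
    rewrite subn0; apply: cross => //; first exact: top.
    move=> j nj; apply: le_trans (gM j _ (y01 _ (leqnn _))) _.
    rewrite -[leLHS]mul1r ler_pM2r//; apply: le_trans (expR_ge1Dx _).
    by rewrite lerDl subr_ge0 (le_trans (top _ (leqnn _)))// ler_nat.
  have nE : (n - i)%N = (n - i.+1).+1 by rewrite subnSK.
  apply: cross; [exact: leq_subr|exact/top/leq_subr|].
  rewrite -nE; apply: (level_descent dg M0 lc gM bS (x := y (n - i)%N)) => //.
  - by rewrite bN y1// leq_subr.
  - by have /andP[] := y01 _ (leq_subr i.+1 n).
  - by rewrite nE; apply: yle; rewrite -nE leq_subr.
  - by have /andP[] := y01 _ (leq_subr i n).
  - exact: IH (ltnW ilt).
have := main n (leqnn _); rewrite subnn => S0.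
have := level_descent dg M0 lc gM bS (leqnn _) _ (lexx 0) y0 _ S0.
rewrite bN y1// => /(_ isT).
have -> : y 0%N <= 1 by have /andP[] := y01 0%N isT.
move=> /(_ isT 0%N (leqnn _)); rewrite sub0r => /le_trans; apply.
rewrite ler_pM2r// ler_expR lerN2; apply: (level_ge m0 bS) => //.
  rewrite /b subr_le0; apply: le_trans yn1 _.
  rewrite (eq_bigr (fun i => (expR 1)^-1 * (M i / M i.+1))).
    by rewrite -mulr_sumr ler_pdivlMl ?expR_gt0// mulr1.
  by move=> i _; rewrite /m [LHS]invfM invf_div.
by rewrite bN; exact: le_trans y0 (yge _ _).
Qed.

(** * A Remez inequality on a segment *)

Lemma exp_ge_term (R : realType) (x : R) (j : nat) :
  0 <= x -> x ^+ j / j`!%:R <= expR x.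
Proof.
case: j => [|j] x0.
  by rewrite expr0 fact0 divr1; apply: le_trans (expR_ge1Dx _); rewrite lerDl.
by apply: le_trans (expR_ge1Dxn j x0); rewrite lerDr.
Qed.

Lemma bin_le_exp2 (n k : nat) : ('C(n, k) <= 2 ^ n)%N.
Proof.
have [kn|nk] := leqP k n; last by rewrite bin_small.
rewrite (expnDn 1 1) (bigD1 (Ordinal (kn : (k < n.+1)%N)))//= !exp1n !muln1.
exact: leq_addr.
Qed.

(** Let tau be the absolute value of g 0 at 0. If M m / m`! is small compared to tau
for some m <= n, then g 0 is close to its interpolant at m nodes, whose value at
0 is controlled by e. Otherwise all the M m are at least tau / 2 * m`!. Then g 0
minus its interpolant at all nodes has a Rolle chain y, at which the derivatives
of g 0 and of the interpolant agree. They cannot all be as small as bang_bound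
wants, because g 0 at 0 is too large; so some derivative of the interpolant,
hence e, is large. *)
Lemma remez_segment (R : realType) (g : nat -> R -> R) (M x : nat -> R)
    (n k1 : nat) (theta e : R) :
  (forall k (t : R), is_derive t 1 (g k) (g k.+1 t)) ->
  (forall k, 0 < M k) -> log_convex M ->
  (forall j (t : R), 0 <= t <= 1 -> `|g j t| <= M j) ->
  (0 < n)%N -> (k1 <= n.+1)%N ->
  expR 1 <= \sum_(k1 <= i < n.+1) M i / M i.+1 ->
  expR (- k1%:R) * M 0 < `|g 0 0| ->
  0 < theta <= 1 ->
  0 < x 0 -> (forall i, (i <= n)%N -> x i <= 1) ->
  (forall i k, (i <= k <= n)%N -> theta / n%:R * (k - i)%:R <= x k - x i) ->
  (forall i, (i <= n)%N -> `|g 0 (x i)| <= e) ->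
  `|g 0 0| <= 2 * expR 1 * (4 * expR 2 / theta) ^+ n * e.
Proof.
move=> dg M0 lc gM n0 k1n sumge g0 /andP[th0 th1] x0 x1 xs gx.
pose tau : R := `|g 0%N 0|; have tau0 : 0 <= tau by rewrite normr_ge0.
rewrite -/tau in g0 *; set Z := _ ^+ n; have e0 : 0 <= e by exact: le_trans (gx 0%N isT).
have nR : 0 < n%:R :> R by rewrite ltr0n.
have s0 : 0 < theta / n%:R by rewrite divr_gt0.
have x01 i : (i <= n)%N -> 0 <= x i <= 1.
  move=> ile; rewrite x1// andbT (le_trans (ltW x0))// -subr_ge0.
  by apply: le_trans (xs 0%N i _) => //; rewrite mulr_ge0// ltW.
have E1 : 1 <= expR 1 :> R by apply: le_trans (expR_ge1Dx _); lra.
have Z0 : 0 <= Z by rewrite exprn_ge0// divr_ge0 ?mulr_ge0 ?expR_ge0// ltW.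
have EE : expR 2 = expR 1 * expR 1 :> R by rewrite -expRD.
have expn : expR n%:R = expR 1 ^+ n :> R by rewrite -expRM_natl mulr1.
have sigE j : (theta / n%:R) ^- j = theta ^- j * n%:R ^+ j :> R.
  by rewrite expr_div_n invf_div mulrC.
have [[m mn Mm]|big] : (exists2 m, (m < n)%N & M m.+1 / m.+1`!%:R <= tau / 2) \/
    (forall m, (m <= n)%N -> tau / 2 * m`!%:R <= M m).
  have [[m [mn Mm]]|H] := pselect (exists m, (m < n)%N /\ M m.+1 / m.+1`!%:R <= tau / 2).
    by left; exists m.
  right; case=> [_|m mn].
    rewrite fact0 mulr1; apply: (@le_trans _ _ tau); last by apply: gM; rewrite lexx ler01.
    lra.
  rewrite leNgt; apply/negP => lt; apply: H; exists m; split=> //.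
  by rewrite ler_pdivrMr ?ltW// ltr0n fact_gt0.
- have := @interpolation_error R m g x (theta / n%:R) e (M m.+1) dg (gM m.+1) s0 x0.
  have le_mn i : (i <= m)%N -> (i <= n)%N by move=> /leq_trans; apply; exact: ltnW.
  move=> /(_ (fun i h => x01 i (le_mn i h))).
  have xs' i k : (i <= k <= m)%N -> theta / n%:R * (k - i)%:R <= x k - x i.
    by move=> /andP[ik km]; apply: xs; rewrite ik le_mn.
  move=> /(_ xs' (fun i h => gx i (le_mn i h))); rewrite -/tau => ie.
  have : tau / 2 <= e * (2 ^+ m / ((theta / n%:R) ^+ m * m`!%:R)) by lra.
  set Q := 2 ^+ m / _ => tauQ.
  suff QZ : Q <= Z.
    have : e * Q <= e * Z by rewrite ler_wpM2l.
    have : 0 <= e * Z * (expR 1 - 1) by rewrite mulr_ge0 ?subr_ge0// mulr_ge0.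
    lra.
  have A1 : 2 ^+ m / ((theta / n%:R) ^+ m * m`!%:R) <= (2 / theta) ^+ n * expR n%:R.
    rewrite invfM sigE.
    rewrite [leLHS](_ : _ = (2 / theta) ^+ m * (n%:R ^+ m / m`!%:R)); last first.
      by rewrite expr_div_n; ring.
    apply: ler_pM => //.
    + by rewrite exprn_ge0// divr_ge0// ltW.
    + apply: ler_weXn2l; last exact: ltnW.
      by rewrite ler_pdivlMr// mul1r; lra.
    + exact: exp_ge_term.
  apply: (le_trans A1); rewrite expn -exprMn.
  rewrite lerXn2r ?nnegrE ?mulr_ge0 ?divr_ge0 ?expR_ge0 ?invr_ge0 ?(ltW th0)//.
  by rewrite mulrAC ler_pM2r ?invr_gt0// EE; nra.
have [P [szP Px PB]] := interpolation (f := fun i => g 0%N (x i)) s0 x01 xs gx.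
pose h k t := g k t - P^`(k).[t].
have dh k (t : R) : is_derive t 1 (h k) (h k.+1 t).
  by rewrite /h derivnS; apply: is_deriveB.
have [|i ile|y [yE0 yle yn hy]] := rolle_chain dh (n := n) (x := x).
- move=> i ilt; rewrite -subr_gt0; apply: lt_le_trans (xs i i.+1 _).
    by rewrite subSnn mulr1.
  by rewrite leqnSn.
- by rewrite /h derivn0 Px// subrr.
have gP k : (k <= n)%N -> g k (y k) = P^`(k).[y k].
  by move=> kn; apply/eqP; rewrite -subr_eq0; apply/eqP/hy.
have yge := le_head yle.
have [[k kn gk]|H] : (exists2 k, (k <= n)%N &
     expR (k%:R - n.+1%:R) * M k < `|g k (y k)|) \/
    (forall k, (k <= n)%N -> `|g k (y k)| <= expR (k%:R - n.+1%:R) * M k).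
  have [[k [kn gk]]|H] := pselect (exists k, (k <= n)%N /\
     expR (k%:R - n.+1%:R) * M k < `|g k (y k)|); first by left; exists k.
  by right=> k kn; rewrite leNgt; apply/negP => ?; apply: H; exists k.
- have y01 : 0 <= y k <= 1.
    rewrite (le_trans (ltW x0)) ?(le_trans (yn k kn)) ?x1//.
    by rewrite -yE0 yge.
  have := PB k _ y01; rewrite -gP// => /(lt_le_trans gk).
  have := big k kn => Mk hk.
  have {}hk : expR (k%:R - n.+1%:R) * (tau / 2 * k`!%:R) <
     e * (n ^_ k)%:R * (2 ^+ n / ((theta / n%:R) ^+ n * n`!%:R)).
    by apply: le_lt_trans hk; rewrite ler_pM2l ?expR_gt0.
  have kf : 0 < k`!%:R :> R by rewrite ltr0n fact_gt0.
  have nf : 0 < n`!%:R :> R by rewrite ltr0n fact_gt0.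
  rewrite -bin_ffact natrM invfM sigE in hk.
  have {}hk : expR (k%:R - n.+1%:R) * (tau / 2) <
     e * (2 ^+ n * (2 ^+ n * (theta ^- n * (n%:R ^+ n / n`!%:R)))).
    rewrite -(ltr_pM2r kf) -mulrA; apply: (lt_le_trans hk).
    rewrite -!mulrA ler_wpM2l// -natrX mulrC -!mulrA.
    rewrite [leRHS](_ : _ = (2 ^ n)%:R * (2 ^+ n * theta ^- n * n%:R ^+ n / n`!%:R * k`!%:R)); last by rewrite natrX; ring.
    rewrite [leLHS](_ : _ = 'C(n, k)%:R * (2 ^+ n * theta ^- n * n%:R ^+ n / n`!%:R * k`!%:R)); last by rewrite natrX; ring.
    rewrite ler_wpM2r ?ler_nat ?bin_le_exp2//.
    by rewrite !mulr_ge0 ?invr_ge0 ?exprn_ge0// ltW.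
  have eN : expR (- n.+1%:R) <= expR (k%:R - n.+1%:R) :> R.
    by rewrite ler_expR lerDr.
  have {}hk : expR (- n.+1%:R) * (tau / 2) <=
     e * (2 ^+ n * (2 ^+ n * (theta ^- n * expR 1 ^+ n))).
    apply: (@le_trans _ _ (expR (k%:R - n.+1%:R) * (tau / 2))).
      by rewrite ler_wpM2r// divr_ge0.
    apply: (le_trans (ltW hk)); rewrite -expn.
    rewrite !ler_wpM2l ?exprn_ge0 ?invr_ge0 ?exprn_ge0 ?(ltW th0)//.
    exact: exp_ge_term.
  have E : expR (- n.+1%:R) = (expR 1 * expR 1 ^+ n)^-1 :> R.
    by rewrite expRN -exprS -expRM_natl mulr1.
  rewrite E ler_pdivrMl ?mulr_gt0 ?exprn_gt0 ?expR_gt0// in hk.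
  have -> : 2 * expR 1 * Z * e =
     2 * (expR 1 * expR 1 ^+ n * (e * (2 ^+ n * (2 ^+ n * (theta ^- n * expR 1 ^+ n))))).
    have -> : Z = 2 ^+ n * 2 ^+ n * expR 1 ^+ n * expR 1 ^+ n * theta ^- n.
      by rewrite /Z -!exprMn -exprVn -exprMn EE; congr (_ ^+ _); ring.
    by ring.
  by lra.
have := bang_bound dg M0 lc gM (le_trans (ltW x0) _) yle (le_trans (yn n _) (x1 n _)) H k1n sumge.
by rewrite yE0 lexx leqnn => /(_ isT isT isT); rewrite leNgt g0.
Qed.

(** * Directional derivatives and words of partial derivatives *)

(** Being a derivative along a direction is stated on whole lines, so that calculus
in one variable applies to the restrictions of w. *)
Definition line_deriv (R : realType) (V : normedModType R) (w : V -> R) (v : V) (a : V -> R) :=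
  forall (x : V) (t : R), is_derive t 1 (fun s : R => w (x + s *: v)) (a (x + t *: v)).

Lemma derivable_line_deriv (R : realType) (V : normedModType R) (w : V -> R) (v : V) :
  (forall x, derivable w x v) -> line_deriv w v ('D_v w).
Proof.
move=> dw x t.
have E : (fun h : R => h^-1 *: (w (h *: v + (x + t *: v)) - w (x + t *: v))) =
    (fun h : R => h^-1 *: (w (x + (h *: (1 : R) + t) *: v) - w (x + t *: v))).
  apply/funext => h; congr (_ *: (w _ - _)).
  by rewrite [h%:A]mulr1 scalerDl addrCA.
apply: DeriveDef.
  by have := dw (x + t *: v); rewrite /derivable/= E.
by rewrite /derive/= -E.
Qed.

Lemma line_derivZ (R : realType) (V : normedModType R) (w : V -> R) (v : V) (a : V -> R) (c : R) :
  line_deriv w v a -> line_deriv w (c *: v) (fun x => c * a x).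
Proof.
move=> wa x t.
have h : is_derive t 1 (fun s : R => c * s) c.
  by apply: is_derive_ext (is_deriveZ c (is_derive_id t 1)) _ _ => //; rewrite /GRing.scale/= mulr1.
apply: is_derive_ext (is_derive1_comp (wa x (c * t)) h) _ _ => [s|].
  by rewrite /= scalerA mulrC.
by rewrite scalerA mulrC [t * c]mulrC.
Qed.

Lemma line_deriv0 (R : realType) (V : normedModType R) (w : V -> R) :
  line_deriv w 0 (fun=> 0).
Proof.
move=> x t; apply: is_derive_ext (is_derive_cst (w x) t 1) _ _ => // s.
by rewrite scaler0 addr0.
Qed.

Lemma mvt_line (R : realType) (V : normedModType R) (w : V -> R) (v : V) (a : V -> R)
    (x : V) (h : R) :
  line_deriv w v a ->
  exists2 c : R, `|c| <= `|h| & w (x + h *: v) - w x = h * a (x + c *: v).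
Proof.
move=> wa; pose f (s : R) := w (x + s *: v).
have df (s : R) : is_derive s 1 f (a (x + s *: v)) by exact: wa.
have cf (a1 b1 : R) : {within `[a1, b1], continuous f}.
  by apply: continuous_subspaceT => s; exact: is_derive_continuous (df s).
have f0 : f 0 = w x by rewrite /f scale0r addr0.
have [h0|h0] := leP 0 h.
  have [c] := MVT_segment h0 (fun x _ => df x) (cf _ _).
  rewrite in_itv/= => /andP[c0 ch]; rewrite f0 subr0 mulrC => E.
  by exists c => //; rewrite !ger0_norm.
have [c] := MVT_segment (ltW h0) (fun x _ => df x) (cf _ _).
rewrite in_itv/= => /andP[c0 ch]; rewrite f0 sub0r => E.
exists c; first by rewrite !ler0_norm ?lerN2// ltW.
by rewrite -[w (x + h *: v)]/(f h) -opprB E; ring.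
Qed.

(** The increment of w along v + v' is the increment along v followed by the one
along v'; the mean value theorem is applied to both, and the continuity of a and
a' brings the intermediate points back to the base point. *)
Lemma line_derivD (R : realType) (V : normedModType R) (w : V -> R) (v v' : V) (a a' : V -> R) :
  continuous a -> continuous a' ->
  line_deriv w v a -> line_deriv w v' a' ->
  line_deriv w (v + v') (fun x => a x + a' x).
Proof.
move=> ca ca' wa wa' x t; set y := x + t *: (v + v').
pose q (h : R) := h^-1 *: (w (x + (h *: (1 : R) + t) *: (v + v')) - w y).
suff qcvg : q @ 0^' --> a y + a' y.
  by apply: DeriveDef; [apply: cvgP qcvg|exact: cvg_lim qcvg].
apply/cvgrPdist_lt => e e0.
have e20 : 0 < e / 2 by rewrite divr_gt0.
have /cvgrPdist_lt/(_ _ e20)/nbhs_ballP[r r0 ra] := ca y.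
have /cvgrPdist_lt/(_ _ e20)/nbhs_ballP[r' r'0 ra'] := ca' y.
pose m : R := `|v| + `|v'| + 1.
have m0 : 0 < m by rewrite ltr_wpDl// addr_ge0.
near=> h.
have h0 : h != 0 by near: h; exact: nbhs_dnbhs_neq.
have hr : `|h| < Num.min r r' / m.
  near: h; apply: dnbhs0_lt; by rewrite divr_gt0// lt_min r0 r'0.
rewrite ltr_pdivlMr// lt_min in hr; case/andP: hr => hr hr'.
have [c ch E] := mvt_line y h wa.
have [c' ch' E'] := mvt_line (y + h *: v) h wa'.
have -> : q h = a (y + c *: v) + a' (y + h *: v + c' *: v').
  rewrite /q (_ : x + _ = y + h *: v + h *: v'); last first.
    rewrite [h%:A]mulr1 [in LHS]scalerDl [h *: _ + _]addrC addrA -/y.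
    by rewrite -[RHS]addrA -scalerDr.
  have -> : w (y + h *: v + h *: v') - w y = h * (a (y + c *: v) + a' (y + h *: v + c' *: v')).
    by rewrite mulrDr -E -E'; ring.
  exact: mulKf.
rewrite (_ : _ - _ = (a y - a (y + c *: v)) + (a' y - a' (y + h *: v + c' *: v'))); last by ring.
apply: le_lt_trans (ler_normD _ _) _.
rewrite [e in _ < e]splitr; apply: ltrD.
  apply: ra; rewrite -ball_normE /= opprD addNKr normrN normrZ.
  apply: le_lt_trans hr; apply: ler_pM => //.
  by rewrite /m -addrA lerDl addr_ge0.
apply: ra'; rewrite -ball_normE /= -[y + _ + _]addrA opprD addNKr normrN.
apply: le_lt_trans (ler_normD _ _) _; rewrite !normrZ.
apply: le_lt_trans hr'; rewrite /m !mulrDr.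
have := ler_wpM2r (normr_ge0 v') ch'.
have := normr_ge0 h; rewrite mulr1; lra.
Unshelve. all: by end_near. Qed.

(** Schwarz' theorem: the second difference of w on a small parallelogram is the
square of its size times c at a nearby point, and also times c' at another. *)
Lemma line_deriv_swap (R : realType) (V : normedModType R) (w : V -> R) (v v' : V)
    (a b c c' : V -> R) :
  line_deriv w v a -> line_deriv w v' b ->
  line_deriv a v' c -> line_deriv b v c' ->
  continuous c -> continuous c' -> c = c'.
Proof.
move=> wa wb ac bc' cc cc'; apply/funext => x.
apply/eqP; rewrite -subr_eq0 -normr_le0; apply/ler_addgt0Pr => e e0; rewrite add0r.
have e20 : 0 < e / 2 by rewrite divr_gt0.
have /cvgrPdist_lt/(_ _ e20)/nbhs_ballP[r r0 rc] := cc x.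
have /cvgrPdist_lt/(_ _ e20)/nbhs_ballP[r' r'0 rc'] := cc' x.
pose m : R := `|v| + `|v'| + 1.
have m0 : 0 < m by rewrite ltr_wpDl// addr_ge0.
pose h := Num.min r r' / m / 2.
have h0 : 0 < h by rewrite !divr_gt0// lt_min r0 r'0.
have hm : h * m < Num.min r r'.
  rewrite /h mulrAC divfK ?gt_eqF// ltr_pdivrMr// mulr_natr mulr2n ltrDl.
  by rewrite lt_min r0 r'0.
have second (u u' : V) (f g : V -> R) : line_deriv w u f -> line_deriv f u' g ->
    exists k k', [/\ `|k| <= `|h|, `|k'| <= `|h| &
      w (x + h *: u + h *: u') - w (x + h *: u) - (w (x + h *: u') - w x) =
      h * (h * g (x + k *: u + k' *: u'))].
  move=> wf fg.
  have dphi : line_deriv (fun z => w (z + h *: u') - w z) u (fun z => f (z + h *: u') - f z).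
    move=> z t; apply: is_derive_ext (is_deriveB (wf (z + h *: u') t) (wf z t)) _ _ => [s|].
      by rewrite /= addrAC.
    by rewrite addrAC.
  have [k kh E] := mvt_line x h dphi.
  have [k' kh' E'] := mvt_line (x + k *: u) h fg.
  by exists k, k'; split=> //; rewrite E E'.
have [k1 [k2 [k1h k2h E1]]] := second _ _ _ _ wa ac.
have [k3 [k4 [k3h k4h E2]]] := second _ _ _ _ wb bc'.
have cE : c (x + k1 *: v + k2 *: v') = c' (x + k3 *: v' + k4 *: v).
  have E : h * (h * c (x + k1 *: v + k2 *: v')) = h * (h * c' (x + k3 *: v' + k4 *: v)).
    by rewrite -E1 -E2 [x + h *: v + _]addrAC; ring.
  have hn0 : h != 0 by rewrite gt_eqF.
  exact: (mulfI hn0 (mulfI hn0 E)).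
have close (u u' : V) (k k' rr : R) : `|k| <= `|h| -> `|k'| <= `|h| ->
    `|u| + `|u'| + 1 = m -> h * m < rr -> ball x rr (x + k *: u + k' *: u').
  move=> kh kh' mE hr; rewrite -ball_normE /= -[x + _ + _]addrA opprD addNKr normrN.
  apply: le_lt_trans (ler_normD _ _) _; rewrite !normrZ; apply: le_lt_trans hr.
  rewrite -mE !mulrDr mulr1.
  have := ler_wpM2r (normr_ge0 u) kh; have := ler_wpM2r (normr_ge0 u') kh'.
  by rewrite (gtr0_norm h0); lra.
move: hm; rewrite lt_min => /andP[hr hr'].
have := rc _ (close v v' k1 k2 r k1h k2h erefl hr).
have mE : `|v'| + `|v| + 1 = m by rewrite /m [X in X + _]addrC.
have := rc' _ (close v' v k3 k4 r' k3h k4h mE hr').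
rewrite cE => A B; rewrite [e]splitr.
have -> : c x - c' x = (c x - c' (x + k3 *: v' + k4 *: v)) - (c' x - c' (x + k3 *: v' + k4 *: v)).
  by ring.
by apply: le_trans (ler_normB _ _) _; rewrite lerD// ltW.
Qed.

Section smooth_words.
Variables (R : realType) (d : nat) (u : 'rV[R]_d -> R).
Hypothesis su : real_smooth setT u.

Let D (s : seq 'I_d) := foldr partial u s.

Lemma smooth_continuous s : continuous (D s).
Proof. by move=> x; exact: (su s (x := x) I).1. Qed.

Lemma smooth_line_deriv s i : line_deriv (D s) (basis_vec i) (D (i :: s)).
Proof. by apply: derivable_line_deriv => x; exact: (su s (x := x) I).2. Qed.

Lemma smooth_swap i j s : D (i :: j :: s) = D (j :: i :: s).
Proof.
apply: line_deriv_swap (smooth_line_deriv s j) (smooth_line_deriv s i)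
  (smooth_line_deriv _ i) (smooth_line_deriv _ j) _ _; exact: smooth_continuous.
Qed.

Lemma smooth_perm s s' : perm_eq s s' -> D s = D s'.
Proof.
have rem_head i t : i \in t -> D t = D (i :: rem i t).
  elim: t => [//|j t IH]; rewrite inE /=; have [->//|ij] := eqVneq j i.
  by move=> /= /IH ->; exact: (smooth_swap j i).
elim: s s' => [|i s IH] s'.
  by rewrite perm_sym => /perm_nilP ->.
move=> ps; have is' : i \in s' by rewrite -(perm_mem ps) mem_head.
rewrite (rem_head i s' is') /= -/(D s) (IH (rem i s'))//.
by rewrite -(perm_cons i) (perm_trans ps)// perm_to_rem.
Qed.

(** The seminorms of the problem are indexed by multi-indices and the derivatives
along a line by words; both agree because the partial derivatives commute. *)
Lemma smooth_multi (s : seq 'I_d) :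
  real_partial_multi (fun i => count_mem i s) u = D s.
Proof.
pose word (b : 'I_d -> nat) (r : seq 'I_d) := flatten [seq nseq (b i) i | i <- r].
have E b r : foldr (fun i v => iter (b i) (partial i) v) u r = D (word b r).
  elim: r => //= i r ->; rewrite /D /word/= foldr_cat.
  by elim: (b i) => //= n ->.
rewrite /real_partial_multi E; apply: smooth_perm; apply/allP => i _ /=.
rewrite /word count_flatten -map_comp sumnE big_map big_enum/=.
rewrite (bigD1 i)//= count_nseq /= eqxx mul1n big1 ?addn0// => j ji.
by rewrite count_nseq /= (negbTE ji) mul0n.
Qed.

Lemma mlength_count (s : seq 'I_d) : mlength (fun i => count_mem i s) = size s.
Proof.
rewrite /mlength; elim: s => [|i s IH] /=; first by rewrite big1.
by rewrite big_split/= IH (bigD1 i)//= eqxx big1 ?addn0// => j; rewrite eq_sym => /negbTE ->.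
Qed.

(** The derivative of order k along v of the partial derivative attached to s. *)
Fixpoint line_word (v : 'rV[R]_d) (k : nat) (s : seq 'I_d) (x : 'rV[R]_d) : R :=
  if k is k'.+1 then \sum_(i < d) v 0 i * line_word v k' (i :: s) x else D s x.

Lemma line_word_deriv v k s : line_deriv (line_word v k s) v (line_word v k.+1 s).
Proof.
elim: k s => [|k IH] s; last first.
  move=> x t /=.
  have h := is_derive_sum (fun i => is_deriveZ (v 0 i) (IH (i :: s) x t)).
  apply: is_derive_ext h _ _ => [y|//].
  by rewrite fct_sumE.
rewrite /=.
suff H (r : seq 'I_d) : line_deriv (D s) (\sum_(i <- r) v 0 i *: basis_vec i)
    (fun x => \sum_(i <- r) v 0 i * D (i :: s) x).
  have -> : v = \sum_(i < d) v 0 i *: basis_vec i by rewrite {1}(row_sum_delta v).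
  move=> x t; have := H (index_enum _) x t.
  by rewrite -(row_sum_delta v).
elim: r => [|i r IH].
  rewrite big_nil (_ : (fun x => _) = fun=> 0); first exact: line_deriv0.
  by apply/funext => x; rewrite big_nil.
have ct j : continuous (fun x => v 0 j * D (j :: s) x).
  by move=> x; apply: continuousM; [exact: cst_continuous|exact: smooth_continuous].
rewrite big_cons (_ : (fun x => _) = fun x => v 0 i * D (i :: s) x + \sum_(i <- r) v 0 i * D (i :: s) x); last first.
  by apply/funext => x; rewrite big_cons.
apply: line_derivD => //.
- elim: r {IH} => [|j r IHr] x.
    rewrite (_ : (fun x => _) = fun=> 0); first exact: cst_continuous.
    by apply/funext => y; rewrite big_nil.
  rewrite (_ : (fun x => _) = fun x => v 0 j * D (j :: s) x + \sum_(i <- r) v 0 i * D (i :: s) x).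
    exact: (cvgD (ct j x) (IHr x)).
  by apply/funext => y; rewrite big_cons.
- by apply: line_derivZ; exact: smooth_line_deriv.
Qed.

Lemma line_word_bound (v : 'rV[R]_d) k s x (r C : R) :
  (forall i, `|v 0 i| <= r) ->
  (forall s', size s' = (k + size s)%N -> `|D s' x| <= C) ->
  `|line_word v k s x| <= (d%:R * r) ^+ k * C.
Proof.
move=> vr; elim: k s => [|k IH] s DC /=; first by rewrite expr0 mul1r DC.
apply: le_trans (ler_norm_sum _ _ _) _.
apply: (@le_trans _ _ (\sum_(i < d) r * ((d%:R * r) ^+ k * C))).
  apply: ler_sum => i _; rewrite normrM; apply: ler_pM => //.
  by apply: IH => s' ss'; apply: DC; rewrite ss' /= addnS.
by rewrite sumr_const card_ord -[_ *+ d]mulr_natl exprS !mulrA.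
Qed.

End smooth_words.

(** * Measures of cubes, balls and dilations *)

(** An open set is the union of the countably many boxes with rational centers and
sizes 1 / k that it contains; this relates the product sigma-algebra to the
topology. *)
Lemma open_measurable_row (R : realType) (n : nat) (A : set 'rV[R]_n) :
  open A -> measurable A.
Proof.
move=> oA.
pose box (q : 'rV[rat]_n * nat) : set 'rV[R]_n :=
  [set y | forall i, `|ratr (q.1 0 i) - y 0 i| < q.2.+1%:R^-1].
have mbox q : measurable (box q).
  have -> : box q = \bigcap_(i in [set: 'I_n])
     ((fun y : 'rV[R]_n => y 0 i) @^-1` (ball (ratr (q.1 0 i) : R) q.2.+1%:R^-1)).
    apply/seteqP; split => y /=; first by move=> by_ i _; exact: by_.
    by move=> by_ i; exact: by_.
  apply: fin_bigcap_measurable => [|i _]; first exact: finite_finset.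
  rewrite -[X in measurable X]setTI; apply: (measurable_coor i) => //.
  exact: measurable_ball.
pose B q := if `[< box q `<=` A >] then box q else set0.
have -> : A = \bigcup_q B q.
  apply/seteqP; split=> [x Ax|x [q _]]; last first.
    by rewrite /B; case: asboolP => // + bq; apply.
  have /nbhs_ballP[r r0 rA] : nbhs x A by apply: open_nbhs_nbhs.
  have [k kr] : exists k : nat, k.+1%:R^-1 < r / 2.
    have r20 : 0 < r / 2 by rewrite divr_gt0.
    by have [N _ /(_ N (leqnn _))] := near_infty_natSinv_lt (PosNum r20); exists N.
  have /choice[q qP] : forall i, exists q : rat, `|ratr q - x 0 i| < k.+1%:R^-1.
    move=> i; have [|q] := @rat_in_itvoo R (x 0 i - k.+1%:R^-1) (x 0 i + k.+1%:R^-1).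
      by rewrite ltrBlDr -addrA ltrDl addr_gt0// invr_gt0.
    by rewrite in_itv/= => /andP[q1 q2]; exists q; rewrite ltr_distl q1.
  exists (\row_i q i, k) => //; rewrite /B; case: asboolP => [_ i|[]].
    by rewrite mxE; exact: qP.
  move=> y /= yq; apply: rA; split=> // i j; rewrite ord1.
  have := yq j; have := qP j; rewrite mxE -ball_normE/= => A1 A2.
  rewrite (_ : x 0 j - y 0 j = - (ratr (q j) - x 0 j) + (ratr (q j) - y 0 j)); last by ring.
  apply: le_lt_trans (ler_normD _ _) _; rewrite normrN [r]splitr.
  by apply: ltrD; [exact: lt_trans A1 kr|exact: lt_trans A2 kr].
apply: countable_bigcupT_measurable => // q.
by rewrite /B; case: ifP.
Qed.

Lemma continuous_measurable_row (R : realType) (n : nat) (f : 'rV[R]_n -> R) :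
  continuous f -> measurable_fun setT (f : 'rV[R]_n -> measurableTypeR R).
Proof.
move=> /continuousP cf; apply: (measurability _ (RGenOpens.measurableE R)).
move=> _ [_ [a [b ->] <-]]; rewrite setTI; apply: open_measurable_row.
exact/cf/interval_open.
Qed.

Lemma borel_lebesgue_tonelli (R : realType) (n : nat) (f : 'rV[R]_n.+1 -> \bar R) :
  measurable_fun setT f -> (forall x, 0 <= f x)%E ->
  (\int[@borel_lebesgue R n.+1]_x f x =
   \int[@lebesgue_measure R]_a \int[@borel_lebesgue R n]_y f (row_cons (a, y)))%E.
Proof.
move=> mf f0.
pose nu := @measure_function_pushforward__canonical__measure_function_Measure _ _ _ _ _
    (@lebesgue_measure R \x @borel_lebesgue R n)%E _ (@measurable_row_cons R n).
rewrite (@eq_measure_integral _ _ _ _ nu)//.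
rewrite ge0_integral_pushforward//.
have mfr : measurable_fun setT (f \o @row_cons R n).
  by apply: measurableT_comp => //; exact: measurable_row_cons.
rewrite preimage_setT (fubini_tonelli1 (f \o @row_cons R n) mfr)//.
  by move=> z; exact: f0.
exact: measurable_row_cons.
Qed.

Lemma borel_lebesgueS (R : realType) (n : nat) (X : set 'rV[R]_n.+1) (A : set R) (B : set 'rV[R]_n) :
  (@row_cons R n) @^-1` X = A `*` B ->
  measurable (A : set (measurableTypeR R)) -> measurable B ->
  (@borel_lebesgue R n.+1 X = lebesgue_measure A * borel_lebesgue B)%E.
Proof.
move=> XE mA mB; rewrite -product_measure1E//= /pushforward.
by congr (product_measure1 _ _ _).
Qed.

Lemma row_cons0 (R : realType) (n : nat) (a : R) (y : 'rV[R]_n) : row_cons (a, y) 0 ord0 = a.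
Proof. by have /(congr1 fst) := @row_consK R n (a, y). Qed.

Lemma row_consS (R : realType) (n : nat) (a : R) (y : 'rV[R]_n) (i : 'I_n) :
  row_cons (a, y) 0 (lift ord0 i) = y 0 i.
Proof.
have -> : lift ord0 i = rshift 1 i by exact: val_inj.
exact: row_mxEr.
Qed.

Lemma row_cons_surj (R : realType) (n : nat) (x : 'rV[R]_n.+1) :
  exists a y, x = row_cons (a, y).
Proof.
exists (x 0 ord0), (\row_i x 0 (lift ord0 i)); apply/rowP => i.
by case: (unliftP ord0 i) => [j|] ->; rewrite ?row_consS ?row_cons0 ?mxE.
Qed.

Lemma row_cons_affine (R : realType) (n : nat) (a b s : R) (x y : 'rV[R]_n) :
  row_cons (a, x) + s *: row_cons (b, y) = row_cons (a + s * b, x + s *: y).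
Proof.
apply/rowP => i; rewrite mxE [X in _ + X]mxE.
by case: (unliftP ord0 i) => [j|] ->; rewrite ?row_consS ?row_cons0 ?mxE.
Qed.

Definition cube (R : realType) (n : nat) (x : 'rV[R]_n) (h : R) : set 'rV[R]_n :=
  [set y | forall i, x 0 i <= y 0 i <= x 0 i + h].

Lemma cube_row_cons (R : realType) (n : nat) (a : R) (x : 'rV[R]_n) (h : R) :
  (@row_cons R n) @^-1` (cube (row_cons (a, x)) h) = `[a, a + h]%classic `*` cube x h.
Proof.
apply/seteqP; split=> -[b y] /=.
  move=> H; split; first by have := H ord0; rewrite !row_cons0 in_itv.
  by move=> i; have := H (lift ord0 i); rewrite !row_consS.
rewrite in_itv/= => -[ab xy] i.
by case: (unliftP ord0 i) => [j|] ->; rewrite ?row_consS ?row_cons0.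
Qed.

Lemma measurable_cube (R : realType) (n : nat) (x : 'rV[R]_n) (h : R) : measurable (cube x h).
Proof.
have -> : cube x h = \bigcap_(i in [set: 'I_n])
   ((fun y : 'rV[R]_n => y 0 i) @^-1` (`[x 0 i, x 0 i + h]%classic)).
  apply/seteqP; split => y /=; first by move=> by_ i _; rewrite /= in_itv; exact: by_.
  by move=> by_ i; have := by_ i I; rewrite /= in_itv.
apply: fin_bigcap_measurable => [|i _]; first exact: finite_finset.
by rewrite -[X in measurable X]setTI; apply: (measurable_coor i).
Qed.

Lemma borel_lebesgue_cube (R : realType) (n : nat) (x : 'rV[R]_n) (h : R) :
  0 <= h -> borel_lebesgue (cube x h) = (h ^+ n)%:E.
Proof.
move=> h0; elim: n x => [|n IH] x.
  rewrite /= diracE mem_set ?expr0//=.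
  by case.
have [a [y ->]] := row_cons_surj x.
rewrite (borel_lebesgueS (cube_row_cons a y h))//; last exact: measurable_cube.
rewrite IH lebesgue_measure_itv /= lte_fin ltrDl.
case: ltP => [h0'|]; first by rewrite -EFinB -EFinM addrAC subrr add0r exprS.
by move=> h0'; rewrite mul0e (_ : h = 0) ?expr0n//; apply/eqP; rewrite eq_le h0 h0'.
Qed.

Lemma lebesgue_affine (R : realType) (c s : R) (A : set (measurableTypeR R)) :
  0 < s -> measurable A ->
  lebesgue_measure A = (s%:E * lebesgue_measure ((fun y : R => (c + s * y)%R) @^-1` A))%E.
Proof.
move=> s0.
have mT : measurable_fun setT ((fun y : R => c + s * y) : measurableTypeR R -> measurableTypeR R).
  apply: measurable_funD => //; apply: measurable_funM => //.
pose nu := @measure_function_pushforward__canonical__measure_function_Measure _ _ _ _ _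
    (@lebesgue_measure R) _ mT.
pose snu := mscale (NngNum (ltW s0)) nu.
move=> mA; rewrite (@lebesgue_measure_unique _ snu)//.
move=> _ [[a b] ab <-].
rewrite [RHS](_ : _ = (s%:E * lebesgue_measure ((fun y : R => (c + s * y)%R) @^-1` `]a, b]%classic))%E)//.
have -> : (fun y => c + s * y) @^-1` `]a, b]%classic = `](a - c) / s, (b - c) / s]%classic.
  apply/seteqP; split => y /=; rewrite !in_itv/= ltr_pdivrMr// ler_pdivlMr//; lra.
rewrite !lebesgue_measure_itv /= !lte_fin ltr_pM2r ?invr_gt0// ltrD2r.
case: ifP => // _; last by rewrite mule0.
rewrite -!EFinB -EFinM; congr _%:E; field; lra.
Qed.

Lemma measurable_affine_row (R : realType) (n : nat) (c : 'rV[R]_n) (s : R) :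
  measurable_fun setT (fun y : 'rV[R]_n => c + s *: y).
Proof.
apply: measurable_fun_row => i.
rewrite (_ : _ \o _ = (fun y : 'rV[R]_n => c 0 i + s * y 0 i)).
  apply: measurable_funD => //; apply: measurable_funM => //; exact: measurable_coor.
by apply/funext => y /=; rewrite !mxE.
Qed.

(** By induction on the dimension: the scaled measure is a product measure, and
product measures are determined by rectangles. *)
Lemma borel_lebesgue_affine (R : realType) (n : nat) (c : 'rV[R]_n) (s : R) (A : set 'rV[R]_n) :
  0 < s -> measurable A ->
  borel_lebesgue A = ((s ^+ n)%:E * borel_lebesgue ((fun y : 'rV[R]_n => (c + s *: y)%R) @^-1` A))%E.
Proof.
move=> s0; elim: n c A => [|n IH] c A mA.
  by rewrite expr0 mul1e; congr borel_lebesgue; apply/seteqP; split => y /=;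
     rewrite !(thinmx0 (_ + _)) (thinmx0 y).
have [c0 [c' cE]] := row_cons_surj c.
pose T1 (y : measurableTypeR R) : measurableTypeR R := c0 + s * y.
pose T2 (y : 'rV[R]_n) := c' + s *: y.
pose T (p : measurableTypeR R * 'rV[R]_n) := (T1 p.1, T2 p.2).
have mT1 : measurable_fun setT T1.
  by apply: measurable_funD => //; apply: measurable_funM.
have mT2 : measurable_fun setT T2 by exact: measurable_affine_row.
have mT : measurable_fun setT T.
  by apply: measurable_fun_pair; apply: measurableT_comp.
pose nu := @measure_function_pushforward__canonical__measure_function_Measure _ _ _ _ _
    (@lebesgue_measure R \x @borel_lebesgue R n)%E _ mT.
pose snu := mscale (NngNum (exprn_ge0 n.+1 (ltW s0))) nu.
have H := @product_measure_unique _ _ _ _ _ (@lebesgue_measure R) (@borel_lebesgue R n) snu.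
have mrA : measurable (@row_cons R n @^-1` A).
  by rewrite -[X in measurable X]setTI; apply: measurable_row_cons.
rewrite -[LHS]/((lebesgue_measure \x @borel_lebesgue R n)%E (@row_cons R n @^-1` A)).
rewrite H//; last first.
  move=> A1 B1 mA1 mB1.
  rewrite [LHS](_ : _ = ((s ^+ n.+1)%:E * (lebesgue_measure \x @borel_lebesgue R n)%E
     ((T1 @^-1` A1) `*` (T2 @^-1` B1)))%E)//.
  rewrite product_measure1E; last 2 first.
    by rewrite -[X in measurable X]setTI; apply: mT1.
    by rewrite -[X in measurable X]setTI; apply: mT2.
  transitivity ((s%:E * lebesgue_measure (T1 @^-1` A1)) *
      ((s ^+ n)%:E * borel_lebesgue (T2 @^-1` B1)))%E.
    by rewrite exprS EFinM -!muleA; congr (_ * _)%E; exact: muleCA.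
  by congr (_ * _)%E; [exact/esym/lebesgue_affine|exact/esym/IH].
rewrite [LHS](_ : _ = ((s ^+ n.+1)%:E * (lebesgue_measure \x @borel_lebesgue R n)%E
     (T @^-1` (@row_cons R n @^-1` A)))%E)//.
congr (_ * _)%E; rewrite /= /pushforward; congr (product_measure1 _ _ _).
by apply/seteqP; split => -[a y] /=; rewrite cE row_cons_affine.
Qed.

Section euclid.
Context (R : realType) (d : nat).
Implicit Types x y : 'rV[R]_d.

Lemma enorm_ge0 x : 0 <= euclidean_norm x. Proof. exact: sqrtr_ge0. Qed.

Lemma enorm_sqr x : euclidean_norm x ^+ 2 = \sum_(i < d) x 0 i ^+ 2.
Proof. by rewrite sqr_sqrtr// sumr_ge0// => i _; exact: sqr_ge0. Qed.

Lemma enormZ (s : R) x : euclidean_norm (s *: x) = `|s| * euclidean_norm x.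
Proof.
rewrite /euclidean_norm -sqrtr_sqr -sqrtrM ?sqr_ge0//; congr Num.sqrt.
by rewrite mulr_sumr; apply: eq_bigr => i _; rewrite mxE exprMn.
Qed.

Lemma enormN x : euclidean_norm (- x) = euclidean_norm x.
Proof. by rewrite -scaleN1r enormZ normrN1 mul1r. Qed.

Lemma enorm_coor x (i : 'I_d) : `|x 0 i| <= euclidean_norm x.
Proof.
rewrite -sqrtr_sqr ler_wsqrtr// (bigD1 i)//= lerDl sumr_ge0// => j _.
exact: sqr_ge0.
Qed.

Lemma enorm_le_sum x (h : R) : 0 <= h -> (forall i, `|x 0 i| <= h) -> euclidean_norm x <= d%:R * h.
Proof.
move=> h0 xh; rewrite -(ger0_norm (mulr_ge0 (ler0n R d) h0)) -sqrtr_sqr ler_wsqrtr//.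
apply: (@le_trans _ _ (\sum_(i < d) h ^+ 2)).
  by apply: ler_sum => i _; rewrite -[x 0 i ^+ 2]real_normK ?num_real// lerXn2r ?nnegrE.
rewrite sumr_const card_ord -[_ *+ d]mulr_natl [leRHS]exprMn ler_wpM2r ?sqr_ge0//.
by rewrite -natrX ler_nat; case: (d) => // n; rewrite leq_pmulr.
Qed.

Lemma enorm_dot x y : \sum_(i < d) x 0 i * y 0 i <= euclidean_norm x * euclidean_norm y.
Proof.
set a := euclidean_norm x; set b := euclidean_norm y.
have a0 : 0 <= a by exact: enorm_ge0.
have b0 : 0 <= b by exact: enorm_ge0.
have [bz|bn0] := eqVneq b 0.
  rewrite bz mulr0 big1// => i _; have := enorm_coor y i.
  by rewrite -/b bz normr_le0 => /eqP ->; rewrite mulr0.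
have [az|an0] := eqVneq a 0.
  rewrite az mul0r big1// => i _; have := enorm_coor x i.
  by rewrite -/a az normr_le0 => /eqP ->; rewrite mul0r.
have a1 : 0 < a by rewrite lt_neqAle eq_sym an0.
have b1 : 0 < b by rewrite lt_neqAle eq_sym bn0.
have : \sum_(i < d) 2 * (a * b) * (x 0 i * y 0 i) <=
   \sum_(i < d) (b ^+ 2 * x 0 i ^+ 2 + a ^+ 2 * y 0 i ^+ 2).
  by apply: ler_sum => i _; have := sqr_ge0 (b * x 0 i - a * y 0 i); rewrite -subr_ge0; congr (_ <= _); ring.
rewrite -mulr_sumr big_split/= -!mulr_sumr -!enorm_sqr -/a -/b.
have ab : 0 < 2 * (a * b) by rewrite !mulr_gt0.
move=> H; rewrite -(ler_pM2l ab); apply: (le_trans H).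
by rewrite le_eqVlt; apply/orP; left; apply/eqP; ring.
Qed.

Lemma enormD x y : euclidean_norm (x + y) <= euclidean_norm x + euclidean_norm y.
Proof.
rewrite -(ger0_norm (addr_ge0 (enorm_ge0 x) (enorm_ge0 y))) -sqrtr_sqr.
rewrite {1}/euclidean_norm ler_wsqrtr// sqrrD !enorm_sqr.
rewrite (eq_bigr (fun i => x 0 i ^+ 2 + (x 0 i * y 0 i) *+ 2 + y 0 i ^+ 2)); last first.
  by move=> i _; rewrite mxE sqrrD.
rewrite 2!big_split lerD2r lerD2l.
under eq_bigr do rewrite -mulr_natl.
rewrite /= -mulr_sumr -[leRHS]mulr_natl ler_pM2l//; exact: enorm_dot.
Qed.

Lemma enorm_continuous : continuous (@euclidean_norm R d).
Proof.
move=> x; apply/(@cvgrPdist_lt _ _ _ (nbhs x)) => e e0.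
have e1 : 0 < e / d.+1%:R by rewrite divr_gt0.
apply/nbhs_ballP; exists (e / d.+1%:R) => //= y [_ xy].
apply: (@le_lt_trans _ _ (euclidean_norm (x - y))).
  have := enormD (x - y) y; have := enormD (y - x) x; rewrite !subrK.
  by rewrite -opprB enormN ler_norml; lra.
apply: (@le_lt_trans _ _ (d%:R * (e / d.+1%:R))).
  apply: enorm_le_sum; first exact: ltW.
  by move=> i; rewrite !mxE; apply/ltW; have := xy 0 i.
by rewrite mulrCA gtr_pMr// ltr_pdivrMr// mul1r ltr_nat.
Qed.

Lemma measurable_eball x (r : R) : measurable (euclidean_ball x r).
Proof.
apply: open_measurable_row.
have -> : euclidean_ball x r = (fun y => euclidean_norm (y - x)) @^-1` [set z | z < r] by [].
apply: open_comp; last exact: open_lt.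
move=> y _; apply: continuous_comp; last exact: enorm_continuous.
by apply: continuousB; [exact: cvg_id|exact: cst_continuous].
Qed.

Lemma eball_affine x (r : R) : 0 < r ->
  borel_lebesgue (euclidean_ball x r) = ((r ^+ d)%:E * borel_lebesgue (euclidean_ball (0 : 'rV[R]_d) 1))%E.
Proof.
move=> r0; rewrite (borel_lebesgue_affine x r0); last exact: measurable_eball.
congr (_ * borel_lebesgue _)%E; apply/seteqP; split => y /=.
  by rewrite /euclidean_ball/= addrAC subrr add0r subr0 enormZ gtr0_norm// gtr_pMr.
by rewrite /euclidean_ball/= addrAC subrr add0r subr0 enormZ gtr0_norm// gtr_pMr.
Qed.

(** The unit ball lies between two cubes. *)
Lemma eball_volume : exists v : R, 0 < v /\
  borel_lebesgue (euclidean_ball (0 : 'rV[R]_d) 1) = v%:E.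
Proof.
have ball_fin : (borel_lebesgue (euclidean_ball (0 : 'rV[R]_d) 1) <= (2 ^+ d)%:E)%E.
  rewrite -(@borel_lebesgue_cube R d (const_mx (-1)) 2)//.
  apply: le_measure; rewrite ?inE; [exact: measurable_eball|exact: measurable_cube|].
  move=> y; rewrite /euclidean_ball/= subr0 => y1 i; rewrite mxE.
  have := le_lt_trans (enorm_coor y i) y1; rewrite ltr_norml; lra.
have ball_pos : ((d.+1%:R^-1 ^+ d)%:E <= borel_lebesgue (euclidean_ball (0 : 'rV[R]_d) 1))%E.
  rewrite -(@borel_lebesgue_cube R d (const_mx 0) d.+1%:R^-1)//.
  apply: le_measure; rewrite ?inE; [exact: measurable_cube|exact: measurable_eball|].
  move=> y yc; rewrite /euclidean_ball/= subr0.
  apply: (@le_lt_trans _ _ (d%:R * d.+1%:R^-1)); last first.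
    by rewrite ltr_pdivrMr// mul1r ltr_nat.
  apply: enorm_le_sum; first by rewrite invr_ge0.
  by move=> i; have := yc i; rewrite mxE add0r => /andP[y0 y1]; rewrite ger0_norm.
have vfin : borel_lebesgue (euclidean_ball (0 : 'rV[R]_d) 1) \is a fin_num.
  by rewrite ge0_fin_numE//; exact: le_lt_trans ball_fin (ltry _).
exists (fine (borel_lebesgue (euclidean_ball (0 : 'rV[R]_d) 1))); rewrite fineK//; split=> //.
by rewrite -lte_fin fineK//; apply: lt_le_trans ball_pos; rewrite lte_fin exprn_gt0// invr_gt0.
Qed.

End euclid.

(** * Segments which meet a large set often *)

Lemma bernoulli_ineq (R : realType) (s : R) (n : nat) : 0 <= s <= 1 -> 1 - n%:R * (1 - s) <= s ^+ n.
Proof.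
move=> /andP[s0 s1]; elim: n => [|n IH]; first by rewrite mul0r subr0 expr0.
rewrite exprS -natr1.
have n0 : 0 <= n%:R :> R by [].
have : s * (1 - n%:R * (1 - s)) <= s * s ^+ n by rewrite ler_wpM2l.
have : 0 <= n%:R * ((1 - s) * (1 - s)) by rewrite mulr_ge0// mulr_ge0 ?subr_ge0.
lra.
Qed.

(** The dilation of center x and ratio s maps the ball onto a smaller one, and E
loses at most the shell between them, of relative measure
1 - s ^+ d <= d * (1 - s). Pulling back by a dilation increases measures. *)
Lemma dilation_measure (R : realType) (d : nat) (x : 'rV[R]_d) (r v s e : R) (E : set 'rV[R]_d) :
  0 < r -> 0 < v -> borel_lebesgue (euclidean_ball (0 : 'rV[R]_d) 1) = v%:E ->
  measurable E -> E `<=` euclidean_ball x r -> 0 < s <= 1 ->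
  ((e * (r ^+ d * v))%:E <= borel_lebesgue E)%E ->
  (((e - d%:R * (1 - s)) * (r ^+ d * v))%:E <=
    borel_lebesgue (euclidean_ball x r `&` [set y | E (x + s *: (y - x))%R]))%E.
Proof.
move=> r0 v0 vE mE EB /andP[s0 s1] eE.
pose B := euclidean_ball x r; pose Bs := euclidean_ball x (s * r).
have mB : measurable B by exact: measurable_eball.
have mBs : measurable Bs by exact: measurable_eball.
have BV : borel_lebesgue B = (r ^+ d * v)%:E by rewrite eball_affine// vE EFinM.
have BsV : borel_lebesgue Bs = (s ^+ d * (r ^+ d * v))%:E.
  by rewrite eball_affine ?mulr_gt0// vE -EFinM exprMn mulrA.
have BsB : Bs `<=` B.
  by move=> y; rewrite /Bs /B /euclidean_ball/= => /lt_le_trans; apply; rewrite ler_piMl// ltW.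
have mEB : measurable (E `&` Bs) by exact: measurableI.
(* the map of center x and ratio s carries B onto Bs *)
have -> : B `&` [set y | E (x + s *: (y - x))%R] =
    (fun y => (x - s *: x) + s *: y) @^-1` (E `&` Bs).
  have TE y : x - s *: x + s *: y = x + s *: (y - x).
    by rewrite scalerBr -addrA; congr (_ + _); rewrite addrC.
  apply/seteqP; split => y /=; rewrite TE.
    move=> [By Ey]; split=> //; move: By.
    by rewrite /B /Bs /euclidean_ball/= addrAC subrr add0r enormZ gtr0_norm// ltr_pM2l.
  move=> [Ey]; rewrite /Bs /B /euclidean_ball/= addrAC subrr add0r enormZ gtr0_norm//.
  by rewrite ltr_pM2l.
have Efin : (borel_lebesgue E < +oo)%E.
  by apply: le_lt_trans (ltry (r ^+ d * v)); rewrite -BV le_measure ?inE.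
have EsumE : (borel_lebesgue E = borel_lebesgue (E `\` Bs) + borel_lebesgue (E `&` Bs))%E.
  by rewrite -measureDI.
have low : (((e - d%:R * (1 - s)) * (r ^+ d * v))%:E <= borel_lebesgue (E `&` Bs))%E.
  have DB : (borel_lebesgue (E `\` Bs) <= (r ^+ d * v - s ^+ d * (r ^+ d * v))%:E)%E.
    have <- : borel_lebesgue (B `\` Bs) = (r ^+ d * v - s ^+ d * (r ^+ d * v))%:E.
      by rewrite EFinB -BV -BsV [LHS]measureD ?setIidr// [ltLHS]BV ltry.
    rewrite le_measure ?inE//; [exact: measurableD|exact: measurableD|].
    by move=> y [Ey nB]; split=> //; exact: EB.
  have fE1 : borel_lebesgue (E `\` Bs) \is a fin_num.
    by rewrite ge0_fin_numE//; apply: le_lt_trans DB (ltry _).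
  have fE2 : borel_lebesgue (E `&` Bs) \is a fin_num.
    rewrite ge0_fin_numE//; apply: le_lt_trans Efin.
    by rewrite le_measure ?inE//; exact: subIsetl.
  move: eE DB; rewrite EsumE -(fineK fE1) -(fineK fE2) -EFinD !lee_fin.
  have s01 : 0 <= s <= 1 by rewrite ltW.
  have V0 : 0 <= r ^+ d * v by rewrite mulr_ge0 ?exprn_ge0// ltW.
  have := ler_wpM2r V0 (bernoulli_ineq d s01).
  rewrite !mulrBl mul1r; lra.
apply: (le_trans low).
rewrite (borel_lebesgue_affine (x - s *: x) s0 mEB) -[leRHS]mul1e.
by rewrite lee_wpmul2r// lee_fin exprn_ile1// ltW.
Qed.

(** Take L ratios in steps of sigma below 1. The preimages of E under these dilations
each fill at least the fraction e / 2 of the ball, so some point y belongs to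
L * e / 2 of them on average: the segment from x to y meets E at that many
points. This does the work of integrating in polar coordinates. *)
Lemma pigeonhole_scales (R : realType) (d n : nat) (x : 'rV[R]_d) (r v e sigma : R) (L : nat) (E : set 'rV[R]_d) :
  0 < r -> 0 < v -> borel_lebesgue (euclidean_ball (0 : 'rV[R]_d) 1) = v%:E ->
  measurable E -> E `<=` euclidean_ball x r ->
  0 < e -> ((e * (r ^+ d * v))%:E <= borel_lebesgue E)%E ->
  0 < sigma -> d%:R * (L%:R * sigma) <= e / 2 -> L%:R * sigma < 1 ->
  n%:R < L%:R * (e / 2) ->
  exists (y : 'rV[R]_d) (p : nat -> R), [/\ euclidean_ball x r y,
    forall i, (i <= n)%N -> 0 < p i <= 1,
    forall i k, (i <= k <= n)%N -> sigma * (k - i)%:R <= p k - p i &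
    forall i, (i <= n)%N -> E (x + p i *: (y - x))].
Proof.
move=> r0 v0 vE mE EB e0 eE sig0 dL L1 nL.
pose B := euclidean_ball x r.
pose s (i : nat) : R := 1 - L%:R * sigma + i%:R * sigma.
have s01 (i : nat) : (i <= L)%N -> 0 < s i <= 1.
  move=> iL; have : i%:R * sigma <= L%:R * sigma by rewrite ler_pM2r// ler_nat.
  have : 0 <= i%:R * sigma by rewrite mulr_ge0// ltW.
  by rewrite /s => ? ?; apply/andP; split; lra.
pose A (i : nat) := B `&` [set y | E (x + s i *: (y - x))].
have mB : measurable B by exact: measurable_eball.
have mA (i : nat) : measurable (A i).
  apply: measurableI => //.
  have -> : [set y | E (x + s i *: (y - x))] = (fun y => (x - s i *: x) + s i *: y) @^-1` E.
    apply/seteqP; split => y /=; rewrite scalerBr -addrA; congr E; congr (_ + _); by rewrite addrC.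
  by rewrite -[X in measurable X]setTI; apply: measurable_affine_row.
have V0 : 0 < r ^+ d * v by rewrite mulr_gt0// exprn_gt0.
have BV : borel_lebesgue B = (r ^+ d * v)%:E by rewrite eball_affine// vE EFinM.
have Age (i : nat) : (i < L)%N -> ((e / 2 * (r ^+ d * v))%:E <= borel_lebesgue (A i))%E.
  move=> iL; apply: le_trans (dilation_measure r0 v0 vE mE EB (s01 i (ltnW iL)) eE).
  rewrite lee_fin ler_pM2r// /s.
  have : d%:R * (1 - (1 - L%:R * sigma + i%:R * sigma)) <= d%:R * (L%:R * sigma).
    rewrite ler_wpM2l//; have : 0 <= i%:R * sigma by rewrite mulr_ge0// ltW.
    lra.
  lra.
pose cnt y := \sum_(i < L) (\1_(A i) y : R).
have [y By cy] : exists2 y, B y & n%:R < cnt y.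
  apply: contrapT => H.
  have cn y : B y -> cnt y <= n%:R.
    by move=> By; rewrite leNgt; apply/negP => ?; apply: H; exists y.
  have : (\int[@borel_lebesgue R d]_(y in B) (cnt y)%:E <= \int[@borel_lebesgue R d]_(y in B) (n%:R)%:E)%E.
    apply: ge0_le_integral => //.
    - by move=> y _; rewrite lee_fin sumr_ge0.
    - apply/measurable_EFinP; apply: measurable_sum => i; exact: measurable_indic.
  rewrite [X in (_ <= X)%E](_ : _ = (n%:R * (r ^+ d * v))%:E); last by rewrite integral_cst// EFinM -BV.
  under eq_integral do rewrite /cnt -sumEFin.
  rewrite ge0_integral_sum//; last by move=> i; apply/measurable_EFinP; exact: measurable_indic.
  have : ((L%:R * (e / 2 * (r ^+ d * v)))%:E <= \sum_(i < L) \int[@borel_lebesgue R d]_(y in B) (\1_(A i) y)%:E)%E.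
    rewrite (_ : (_ * _)%:E = \sum_(i < L) (e / 2 * (r ^+ d * v))%:E)%E; last first.
      by rewrite sumEFin sumr_const card_ord mulr_natl.
    apply: lee_sum => i _; rewrite integral_indic// setIidl; last exact: subIsetl.
    exact: Age.
  move=> /le_trans h /h; rewrite lee_fin leNgt => /negP; apply.
  by rewrite [ltRHS]mulrA (ltr_pM2r V0).
pose I := [seq i <- iota 0 L | `[< A i y >]].
have Isz : (n < size I)%N.
  rewrite -(ltr_nat R); apply: lt_le_trans cy _.
  rewrite /cnt -(big_mkord xpredT (fun i => \1_(A i) y : R)) size_filter -sum1_count natr_sum.
  rewrite /index_iota subn0 [leRHS]big_mkcond/=; apply: ler_sum => i _.
  by rewrite indicE; case: asboolP => h; rewrite ?(mem_set h) ?(memNset h).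
have Iall (i : nat) : (i <= n)%N -> (nth 0 I i < L)%N /\ A (nth 0%N I i) y.
  move=> ile; have : nth 0%N I i \in I by rewrite mem_nth// (leq_ltn_trans ile).
  by rewrite mem_filter mem_iota => /andP[/asboolP ? /andP[_ ?]].
have Is : sorted ltn I by apply: sorted_filter; [exact: ltn_trans|exact: iota_ltn_sorted].
exists y, (fun i => s (nth 0%N I i)); split => //.
- by move=> i /Iall[/ltnW ? _]; exact: s01.
- move=> i k /andP[ik kn]; rewrite /s.
  have ki : (nth 0 I i + (k - i) <= nth 0 I k)%N.
    move: kn; rewrite -{1 3}(subnKC ik); elim: (k - i)%N => [|j IH] kn.
      by rewrite !addn0.
    rewrite addnS in kn; rewrite !addnS; apply: leq_ltn_trans (IH (ltnW kn)) _.
    apply: (sorted_ltn_nth ltn_trans 0%N Is) => //; rewrite inE.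
      by apply: leq_ltn_trans Isz; exact: ltnW.
    exact: leq_ltn_trans Isz.
  have le_ik : (nth 0 I i <= nth 0 I k)%N by apply: leq_trans ki; exact: leq_addr.
  rewrite opprD addrACA subrr add0r -mulrBl -natrB// mulrC ler_pM2r// ler_nat leq_subRL.
    exact: ki.
  exact: le_ik.
- by move=> i /Iall[_ []].
Qed.

(** * Sobolev's inequality on a cube *)

Lemma contD (R : realType) (T : topologicalType) (f g : T -> R) :
  continuous f -> continuous g -> continuous (fun x => f x + g x).
Proof. by move=> cf cg x; apply: cvgD; [exact: cf|exact: cg]. Qed.

Lemma contB (R : realType) (T : topologicalType) (f g : T -> R) :
  continuous f -> continuous g -> continuous (fun x => f x - g x).
Proof. by move=> cf cg x; apply: cvgB; [exact: cf|exact: cg]. Qed.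

Lemma contM (R : realType) (T : topologicalType) (f g : T -> R) :
  continuous f -> continuous g -> continuous (fun x => f x * g x).
Proof. by move=> cf cg x; apply: cvgM; [exact: cf|exact: cg]. Qed.

(** Integrate the derivative of (b - t) * g t ^+ 2 with b = a + h: the boundary
term at b vanishes. *)
Lemma sobolev_segment (R : realType) (g g1 : R -> R) (a h : R) :
  0 < h -> continuous g -> continuous g1 ->
  (forall t : R, is_derive t 1 g (h^-1 * g1 t)) ->
  ((g a ^+ 2)%:E <= (2 / h)%:E *
     \int[lebesgue_measure]_(t in `[a, (a + h)%R]) (g t ^+ 2 + g1 t ^+ 2)%:E)%E.
Proof.
move=> h0 cg cg1 dg.
pose b := a + h; have ab : a < b by rewrite ltrDl.
pose phi (t : R) := g t ^+ 2 - 2 * ((b - t) / h) * (g t * g1 t).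
pose Phi (t : R) := - ((b - t) * g t ^+ 2).
have dPhi (t : R) : is_derive t 1 Phi (phi t).
  have d1 : is_derive t 1 (fun s : R => b - s) (- 1).
    apply: is_derive_ext (is_deriveB (is_derive_cst b t 1) (is_derive_id t 1)) _ _ => //.
    by rewrite sub0r.
  apply: is_derive_ext (is_deriveN (is_deriveM d1 (is_deriveM (dg t) (dg t)))) _ _ => [s|].
    by rewrite /Phi expr2.
  by rewrite /phi /GRing.scale/= -[(g * g) t]/(g t * g t); field; lra.
have sq_cont (f : R -> R) : continuous f -> continuous (fun t => f t ^+ 2).
  by move=> cf; exact: contM.
have cphi : continuous phi.
  apply: contB; first exact: sq_cont.
  apply: contM; last exact: contM.
  apply: contM; first exact: cst_continuous.
  apply: contM; last exact: cst_continuous.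
  by apply: contB; [exact: cst_continuous|move=> t; exact: cvg_id].
have csq : continuous (fun t => g t ^+ 2 + g1 t ^+ 2).
  by apply: contD; exact: sq_cont.
have FTC : (\int[lebesgue_measure]_(t in `[a, b]) (phi t)%:E = (h * g a ^+ 2)%:E)%E.
  rewrite (continuous_FTC2 (F := Phi) ab).
  - by rewrite /Phi subrr mul0r oppr0 -EFinB sub0r opprK /b addrAC subrr add0r.
  - exact: continuous_subspaceT.
  - split.
    + by move=> t _; exact: ex_derive.
    + by apply: cvg_at_right_filter; exact: is_derive_continuous (dPhi a).
    + by apply: cvg_at_left_filter; exact: is_derive_continuous (dPhi b).
  - by move=> t _; rewrite derive1E; exact: derive_val.
have le_phi (t : R) : t \in `[a, b] -> phi t <= 2 * (g t ^+ 2 + g1 t ^+ 2).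
  rewrite in_itv/= => /andP[ta tb].
  have c0 : 0 <= (b - t) / h by rewrite divr_ge0// ?subr_ge0// ltW.
  have c1 : (b - t) / h <= 1 by rewrite ler_pdivrMr// mul1r /b; lra.
  rewrite /phi; move: c0 c1; move: (_ / h) => c c0 c1.
  have := sqr_ge0 (g t + g1 t); have := sqr_ge0 (g t - g1 t); rewrite !expr2 => A B.
  have := ler_wpM2l c0 B; rewrite mulr0.
  have : 0 <= (1 - c) * (g t * g t + g1 t * g1 t).
    by rewrite mulr_ge0 ?subr_ge0// addr_ge0// -expr2 sqr_ge0.
  have := sqr_ge0 (g t); have := sqr_ge0 (g1 t); rewrite !expr2; nra.
have : ((h * g a ^+ 2)%:E <=
    2%:E * \int[lebesgue_measure]_(t in `[a, b]) (g t ^+ 2 + g1 t ^+ 2)%:E)%E.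
  rewrite -FTC -ge0_integralZl//; last first.
  - by move=> t _; rewrite lee_fin addr_ge0// sqr_ge0.
  - by apply/measurable_EFinP; apply: measurable_funTS; exact: continuous_measurable_fun.
  under [leRHS]eq_integral do rewrite -EFinM.
  apply: le_integral => //.
  - apply: continuous_compact_integrable; first exact: segment_compact.
    exact: continuous_subspaceT.
  - apply: continuous_compact_integrable; first exact: segment_compact.
    by apply: continuous_subspaceT; apply: contM => //; exact: cst_continuous.
  - by move=> t; rewrite inE/= => tab; rewrite lee_fin; exact: le_phi.
have hV : 0 < h^-1 by rewrite invr_gt0.
move=> H; rewrite [(g a ^+ 2)%R](_ : _ = h^-1 * (h * g a ^+ 2)); last by rewrite mulKf// gt_eqF.
rewrite EFinM (_ : (2 / h)%:E = (h^-1)%:E * 2%:E)%E; last by rewrite -EFinM mulrC.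
by rewrite -[leRHS]muleA lee_pmul2l// lte_fin.
Qed.

Lemma nonexpansive_continuous (R : numFieldType) (T U : pseudoMetricType R) (f : T -> U) :
  (forall x y (e : R), ball x e y -> ball (f x) e (f y)) -> continuous f.
Proof.
move=> fe x A /nbhs_ballP[e e0 eA]; apply/nbhs_ballP; exists e => // y xy.
exact/eA/fe.
Qed.

Lemma row_cons_contr (R : realType) (n : nat) (a : R) : continuous (fun y : 'rV[R]_n => row_cons (a, y)).
Proof.
apply: nonexpansive_continuous => x y e [e0 xy]; split=> // i j; rewrite ord1.
case: (unliftP ord0 j) => [k|] ->; rewrite ?row_cons0 ?row_consS; last exact: ballxx.
exact: xy.
Qed.

Lemma row_cons_contl (R : realType) (n : nat) (y : 'rV[R]_n) : continuous (fun a : R => row_cons (a, y)).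
Proof.
apply: nonexpansive_continuous => a b e ab.
have e0 : 0 < e by apply: le_lt_trans ab; exact: normr_ge0.
split=> // i j; rewrite ord1.
by case: (unliftP ord0 j) => [k|] ->; rewrite ?row_cons0 ?row_consS//; exact: ballxx.
Qed.

(** The sum of w l ^+ 2 over the words l of n bits. In its use the bits of l tell
with respect to which variables a function is differentiated. *)
Fixpoint sumsq (R : realType) (T : Type) (n : nat) (w : seq bool -> T -> R) (x : T) : R :=
  if n is n'.+1 then sumsq n' (fun l => w (false :: l)) x + sumsq n' (fun l => w (true :: l)) x
  else w [::] x ^+ 2.

Lemma sumsq_ge0 (R : realType) (T : Type) (n : nat) (w : seq bool -> T -> R) (x : T) :
  0 <= sumsq n w x.
Proof. by elim: n w => [|n IH] w /=; [exact: sqr_ge0|exact: addr_ge0]. Qed.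

Lemma sumsq_continuous (R : realType) (T : topologicalType) (n : nat) (w : seq bool -> T -> R) :
  (forall l, continuous (w l)) -> continuous (sumsq n w).
Proof.
elim: n w => [|n IH] w cw /=; first by apply: contM; exact: cw.
by apply: contD; apply: IH => l; exact: cw.
Qed.

Lemma sumsq_comp (R : realType) (T U : Type) (n : nat) (w : seq bool -> T -> R) (f : U -> T) (x : U) :
  sumsq n (fun l y => w l (f y)) x = sumsq n w (f x).
Proof. elim: n w => //= n IH w.
by congr (_ + _); [exact: (IH (fun l => w (false :: l)))|exact: (IH (fun l => w (true :: l)))]. Qed.

(** Bounding a value by an integral takes one derivative in each variable only:
apply sobolev_segment in the first variable, and induct on the others. The factor
h^-1 makes the derivatives homogeneous with the function. *)
Lemma sobolev_cube (R : realType) (n : nat) (w : seq bool -> 'rV[R]_n -> R) (h : R) (x : 'rV[R]_n) :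
  0 < h -> (forall l, continuous (w l)) ->
  (forall l (i : 'I_n), size l = n -> nth false l i = false ->
     line_deriv (w l) (basis_vec i) (fun y => h^-1 * w (set_nth false l i true) y)) ->
  ((w (nseq n false) x ^+ 2)%:E <=
   ((2 / h) ^+ n)%:E * \int[@borel_lebesgue R n]_(y in cube x h) (sumsq n w y)%:E)%E.
Proof.
move=> h0; elim: n w x => [|n IH] w x cw dw.
  rewrite expr0 mul1e [X in (_ <= X)%E](_ : _ =
     (\int[\d_(0%R : 'rV[R]_0)]_(y in cube x h) (w [::] y ^+ 2)%:E)%E)//.
  rewrite integral_dirac//; last 2 first.
  - exact: measurable_cube.
  - by apply/measurable_EFinP; apply: measurable_funTS;
      apply: continuous_measurable_row; apply: contM; exact: cw.
  by rewrite diracE mem_set ?mul1e ?(thinmx0 x)//= => -[].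
have [a [x' ->]] := row_cons_surj x.
pose F b (s : R) l y := w (b :: l) (row_cons (s, y)).
have IHF b s : ((F b s (nseq n false) x' ^+ 2)%:E <=
   ((2 / h) ^+ n)%:E * \int[@borel_lebesgue R n]_(y in cube x' h) (sumsq n (F b s) y)%:E)%E.
  apply: IH.
    move=> l y; apply: continuous_comp; [exact: row_cons_contr|exact: cw].
  move=> l i sl li y t.
  have E u : row_cons (s, y + u *: basis_vec i) = row_cons (s, y) + u *: basis_vec (lift ord0 i).
    apply/rowP => j; rewrite [in RHS]mxE [X in _ = _ + X]mxE.
    case: (unliftP ord0 j) => [k|] ->; rewrite ?row_cons0 ?row_consS !mxE/=.
      by rewrite (inj_eq (@lift_inj _ ord0)).
    by rewrite mulr0 addr0.
  have := dw (b :: l) (lift ord0 i) _ li (row_cons (s, y)) t.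
  rewrite /= sl => /(_ erefl) H; apply: is_derive_ext H _ _ => [u|]; by rewrite /F E.
pose f z := (sumsq n.+1 w z)%:E; pose C := cube (row_cons (a, x')) h.
have f0 z : (0 <= f z)%E by rewrite lee_fin; exact: sumsq_ge0.
have mC : measurable C by exact: measurable_cube.
have mf : measurable_fun setT f.
  by apply/measurable_EFinP; apply: continuous_measurable_row; exact: sumsq_continuous.
have mfC : measurable_fun setT (f \_ C) by apply/(measurable_restrictT _ mC); exact: measurable_funTS.
have fC0 z : (0 <= (f \_ C) z)%E by apply: erestrict_ge0 => y _; exact: f0.
pose J s := (\int[@borel_lebesgue R n]_y (f \_ C) (row_cons (s, y)))%E.
have mJ : measurable_fun setT (J : measurableTypeR R -> \bar R).
  apply: (@measurable_fun_fubini_tonelli_F _ _ (measurableTypeR R) _ R (@borel_lebesgue R n) ((f \_ C) \o @row_cons R n)).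
    by apply: measurableT_comp => //; exact: measurable_row_cons.
  by move=> z; exact: fC0.
have J0 s : (0 <= J s)%E by apply: integral_ge0 => y _; exact: fC0.
have JE s : s \in `[a, a + h] -> J s = (\int[@borel_lebesgue R n]_(y in cube x' h) f (row_cons (s, y)))%E.
  move=> sah; rewrite /J [RHS]integral_mkcond; apply: eq_integral => y _.
  rewrite /patch; have := congr1 (fun A => A (s, y)) (cube_row_cons a x' h) => /= EQ.
  have -> : (row_cons (s, y) \in C) = (y \in cube x' h) => //.
  apply/idP/idP; rewrite !inE /C.
    by rewrite EQ => -[].
  by move=> yc; rewrite EQ.
pose g s := F false s (nseq n false) x'; pose g1 s := F true s (nseq n false) x'.
have cF b l : continuous (fun s => F b s l x').
  by move=> s; apply: continuous_comp; [exact: row_cons_contl|exact: cw].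
have dg (t : R) : is_derive t 1 g (h^-1 * g1 t).
  have E0 u : row_cons (0, x') + u *: basis_vec ord0 = row_cons (u, x').
    apply/rowP => j; rewrite [LHS]mxE [X in _ + X]mxE.
    case: (unliftP ord0 j) => [k|] ->; rewrite ?row_cons0 ?row_consS !mxE/=.
      by rewrite mulr0 addr0.
    by rewrite mulr1 add0r.
  have := dw (nseq n.+1 false) ord0 (size_nseq _ _) erefl (row_cons (0, x')) t.
  by move=> H; apply: is_derive_ext H _ _ => [u|]; rewrite /g /g1 /F E0.
have H1 := sobolev_segment a h0 (cF false (nseq n false)) (cF true (nseq n false)) dg.
apply: (le_trans H1).
have hV : 0 <= 2 / h by rewrite divr_ge0// ltW.
have K0 : 0 <= (2 / h) ^+ n by rewrite exprn_ge0.
rewrite exprS [(2 / h * _ ^+ n)%:E]EFinM -[leRHS]muleA lee_wpmul2l ?lee_fin//.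
apply: (@le_trans _ _ (\int[lebesgue_measure]_(s in `[a, (a + h)%R]) (((2 / h) ^+ n)%:E * J s)%E)%E).
  apply: ge0_le_integral => //.
  - by move=> s _; rewrite lee_fin addr_ge0// sqr_ge0.
  - apply/measurable_EFinP; apply: measurable_funTS; apply: continuous_measurable_fun.
    by apply: contD; apply: contM; exact: cF.
  - by apply: measurable_funeM; exact: measurable_funTS.
  move=> s sah; rewrite JE ?inE//.
  have fE y : f (row_cons (s, y)) = ((sumsq n (F false s) y)%:E + (sumsq n (F true s) y)%:E)%E.
    by rewrite /f /= EFinD -!sumsq_comp.
  under eq_integral do rewrite fE.
  have mF b : measurable_fun (cube x' h) (fun y => (sumsq n (F b s) y)%:E).
    apply/measurable_EFinP; apply: measurable_funTS; apply: continuous_measurable_row.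
    apply: sumsq_continuous => l y; apply: continuous_comp; [exact: row_cons_contr|exact: cw].
  rewrite ge0_integralD//; last 3 first.
  - exact: measurable_cube.
  - by move=> y _; rewrite lee_fin sumsq_ge0.
  - by move=> y _; rewrite lee_fin sumsq_ge0.
  by rewrite muleDr// ?EFinD ?leeD ?IHF// ge0_adde_def// inE integral_ge0// => y _; rewrite lee_fin sumsq_ge0.
rewrite ge0_integralZl//; last exact: measurable_funTS.
rewrite lee_wpmul2l ?lee_fin//.
rewrite [leRHS]integral_mkcond borel_lebesgue_tonelli//.
by apply: ge0_subset_integral.
Qed.

(** * From Lebesgue to Borel measurable sets *)

Lemma borel_lebesgue_measurable (R : realType) (n : nat) (A : set 'rV[R]_n) :
  measurable A -> lebesgue_measurable A.
Proof. by move=> mA; exact: caratheodory_measurable_mu_ext. Qed.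

Lemma lebesgueE (R : realType) (n : nat) (A : set 'rV[R]_n) :
  measurable A -> lebesgue A = borel_lebesgue A.
Proof. by move=> mA; exact: measurable_mu_extE. Qed.

Lemma measurable_fun_borel (R : realType) (n : nat) d' (T : measurableType d') (f : 'rV[R]_n -> T) :
  measurable_fun setT f -> measurable_fun setT (f : lebesgue_type n -> T).
Proof.
move=> mf _ A mA; rewrite setTI; apply: borel_lebesgue_measurable.
by rewrite -[X in measurable X]setTI; exact: mf.
Qed.

(** The identity is measurable from the completed sigma-algebra to the Borel one, and
it pushes the former measure to the latter. *)
Lemma integral_lebesgueE (R : realType) (n : nat) (D : set 'rV[R]_n) (f : 'rV[R]_n -> \bar R) :
  measurable D -> measurable_fun setT f -> (forall x, 0 <= f x)%E ->
  (\int[@lebesgue R n]_(x in D) f x = \int[@borel_lebesgue R n]_(x in D) f x)%E.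
Proof.
move=> mD mf f0.
have mid : measurable_fun setT (id : lebesgue_type n -> 'rV[R]_n).
  exact: measurable_fun_borel.
pose nu := @measure_function_pushforward__canonical__measure_function_Measure _ _ _ _ _
    (@lebesgue R n) _ mid.
rewrite [RHS](@eq_measure_integral _ _ _ _ nu); last first.
  by move=> A mA _; exact: (esym (lebesgueE mA)).
rewrite ge0_integral_pushforward//; exact: measurable_funTS.
Qed.

(** Remove from D a countable intersection of Borel sets which cover D minus omega
with almost the same measure. *)
Lemma borel_subset (R : realType) (n : nat) (omega D : set 'rV[R]_n) :
  lebesgue_measurable omega -> measurable D -> (borel_lebesgue D < +oo)%E ->
  exists W : set 'rV[R]_n, [/\ measurable W, W `<=` omega `&` D &
    (lebesgue (omega `&` D) <= borel_lebesgue W)%E].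
Proof.
move=> mo mD Dfin.
have mDL : lebesgue_measurable D by exact: borel_lebesgue_measurable.
have mX : lebesgue_measurable (D `\` omega) by exact: measurableD.
pose X := D `\` omega.
have Xfin : (lebesgue X < +oo)%E.
  by apply: le_lt_trans Dfin; rewrite -lebesgueE// le_measure ?inE//; exact: subDsetl.
have Xfn : lebesgue X \is a fin_num by rewrite ge0_fin_numE.
have /choice[G GP] : forall k : nat, exists G : set 'rV[R]_n,
    [/\ measurable G, X `<=` G & (borel_lebesgue G <= lebesgue X + (k.+1%:R^-1)%:E)%E].
  move=> k.
  have : (lebesgue X < lebesgue X + (k.+1%:R^-1)%:E)%E by rewrite lteDl// lte_fin invr_gt0.
  rewrite {1}/lebesgue /completed_measure_extension /mu_ext => /ereal_inf_lt[_ [A [mA XA] <-] AX].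
  exists (\bigcup_k A k); split => //; first exact: bigcup_measurable.
  apply: le_trans (ltW AX).
  by apply: measure_sigma_subadditive => //; exact: bigcup_measurable.
have mG : measurable (\bigcap_k G k) by apply: bigcap_measurable => // k _; case: (GP k).
exists (D `\` \bigcap_k G k); split.
- exact: measurableD.
- move=> x [Dx nGx]; split=> //; apply: contrapT => nox; apply: nGx => k _.
  by have [_ + _] := GP k; apply.
have EG : (borel_lebesgue (D `&` \bigcap_k G k) <= lebesgue X)%E.
  apply/lee_addgt0Pr => e e0.
  have [k _ /(_ k (leqnn _)) ke] := near_infty_natSinv_lt (PosNum e0).
  have [mGk _ Gk] := GP k.
  apply: le_trans (le_trans Gk _); last by rewrite leeD2l// lee_fin ltW.
  rewrite le_measure ?inE//; first exact: measurableI.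
  by move=> x [_ /(_ k I)].
have DE : (lebesgue D = lebesgue (D `&` omega) + lebesgue X)%E.
  by rewrite addeC; exact: (measureDI (@lebesgue R n) mDL mo).
rewrite measureD// setIC.
have : (lebesgue D - lebesgue X <= borel_lebesgue D - borel_lebesgue (D `&` \bigcap_k G k))%E.
  by rewrite lebesgueE// leeB.
by rewrite DE addeK.
Qed.

(** The Borel subsets found inside the balls of integer radii around 0 are put
together; each of them has full measure in the part of omega in its ball. *)
Lemma borel_kernel (R : realType) (n : nat) (omega : set 'rV[R]_n) :
  lebesgue_measurable omega ->
  exists W : set 'rV[R]_n, [/\ measurable W, W `<=` omega &
    forall x r, 0 < r -> (lebesgue (omega `&` euclidean_ball x r) <= borel_lebesgue (W `&` euclidean_ball x r))%E].
Proof.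
move=> mo; have [v [v0 vE]] := eball_volume R n.
have mball := @measurable_eball R n.
have /choice[W WP] : forall k : nat, exists W : set 'rV[R]_n, [/\ measurable W,
    W `<=` omega `&` euclidean_ball 0 k.+1%:R &
    (lebesgue (omega `&` euclidean_ball 0 k.+1%:R) <= borel_lebesgue W)%E].
  move=> k; apply: borel_subset => //.
  by rewrite eball_affine// vE -EFinM ltry.
exists (\bigcup_k W k); split.
- by apply: bigcup_measurable => k _; case: (WP k).
- by move=> x [k _]; have [_ + _] := WP k => /[apply] -[].
move=> x r r0; pose B := euclidean_ball x r.
have [k Bk] : exists k : nat, B `<=` euclidean_ball 0 k.+1%:R.
  have [k ek] : exists k : nat, euclidean_norm x + r < k.+1%:R.
    exists (Num.truncn (euclidean_norm x + r)); exact: truncnS_gt.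
  exists k => y; rewrite /B /euclidean_ball/= subr0 => yx.
  by have := enormD (y - x) x; rewrite subrK; lra.
have [mW Wo oW] := WP k.
pose D := euclidean_ball (0 : 'rV[R]_n) k.+1%:R.
have mWL : lebesgue_measurable (W k) by exact: borel_lebesgue_measurable.
have mBL : lebesgue_measurable B by exact: borel_lebesgue_measurable (mball x r).
have mDL : lebesgue_measurable D by exact: borel_lebesgue_measurable (mball _ _).
have Wfin : (lebesgue (W k) < +oo)%E.
  apply: (@le_lt_trans _ _ (borel_lebesgue D)).
    rewrite lebesgueE// le_measure ?inE//; first exact: mball.
    by move=> y /Wo[].
  by rewrite eball_affine// vE -EFinM ltry.
have moD : lebesgue_measurable (omega `&` D) by exact: measurableI.
have oE : lebesgue (omega `&` D) = lebesgue (W k).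
  apply/eqP; rewrite eq_le; apply/andP; split; first by rewrite (lebesgueE mW).
  by rewrite le_measure ?inE.
have null : lebesgue ((omega `&` D) `\` W k) = 0%E.
  transitivity (lebesgue (omega `&` D) - lebesgue (W k))%E; last first.
    by rewrite oE subee// ge0_fin_numE.
  rewrite [LHS](measureD moD mWL); last by rewrite [X in (X < _)%E]oE.
  by rewrite (setIidr Wo).
have -> : omega `&` B = (W k `&` B) `|` ((omega `\` W k) `&` B).
  apply/seteqP; split => y /=.
    by move=> [oy By]; have [Wy|nWy] := pselect (W k y); [left|right].
  by move=> [[Wy By]|[[oy _] By]]; split=> //; case: (Wo y Wy).
have mdiff : lebesgue_measurable ((omega `\` W k) `&` B).
  by apply: measurableI => //; exact: measurableD.
have mWB : lebesgue_measurable (W k `&` B) by exact: measurableI.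
apply: (@le_trans _ _ (lebesgue (W k `&` B) + lebesgue ((omega `\` W k) `&` B))%E).
  exact: measureU2.
have -> : lebesgue ((omega `\` W k) `&` B) = 0%E.
  apply/eqP; rewrite eq_le measure_ge0 andbT -null le_measure ?inE//; first exact: measurableD.
  by move=> y [[oy nWy] By]; split=> //; split=> //; exact: Bk.
have mB : measurable B by exact: mball.
have mWB' : measurable (W k `&` B) by exact: measurableI.
rewrite adde0 lebesgueE// le_measure ?inE//.
  by apply: measurableI => //; apply: bigcup_measurable => j _; case: (WP j).
by move=> y [Wy By]; split=> //; exists k.
Qed.

(** * Averaging over balls of slowly varying radius *)

Lemma contX (R : realType) (T : topologicalType) (f : T -> R) (n : nat) :
  continuous f -> continuous (fun x => f x ^+ n).
Proof.
move=> cf; elim: n => [|n IH].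
  by rewrite (_ : (fun x => _) = fun=> 1)//; exact: cst_continuous.
rewrite (_ : (fun x => _) = fun x => f x * f x ^+ n); first exact: contM.
by apply/funext => x; rewrite exprS.
Qed.

Section averaging.
Variables (R : realType) (d : nat) (rho : 'rV[R]_d -> R) (L lam : R).
Hypothesis rho0 : forall x, 0 < rho x.
Hypothesis L0 : 0 <= L.
Hypothesis rhoL : forall x y, `|rho x - rho y| <= L * euclidean_norm (x - y).
Hypothesis lam0 : 0 < lam.
Hypothesis Llam : L * lam < 1.

Lemma enorm_sub_continuous x : continuous (fun y : 'rV[R]_d => euclidean_norm (y - x)).
Proof.
move=> y; apply: continuous_comp; last exact: enorm_continuous.
by apply: continuousB; [exact: cvg_id|exact: cst_continuous].
Qed.

Lemma rho_continuous : continuous rho.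
Proof.
move=> x; apply/(@cvgrPdist_lt _ _ _ (nbhs x)) => e e0.
have L1 : 0 < L + 1 by rewrite ltr_wpDl.
have e1 : 0 < e / (L + 1) by rewrite divr_gt0.
have := proj1 (@cvgrPdist_lt _ _ _ (nbhs x) _ _ _) (@enorm_sub_continuous x x) _ e1.
move=> /(_ _)/filterS; apply=> y; rewrite subrr /=.
have -> : euclidean_norm (0 : 'rV[R]_d) = 0.
  by rewrite -(scale0r (0 : 'rV[R]_d)) enormZ normr0 mul0r.
rewrite sub0r normrN ger0_norm ?enorm_ge0// ltr_pdivlMr// => ye.
apply: le_lt_trans ye; apply: (le_trans (rhoL _ _)).
by rewrite -opprB enormN mulrC ler_wpM2l ?enorm_ge0// lerDl.
Qed.

Lemma rho_near x y : euclidean_norm (y - x) < lam * rho x ->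
  (1 - L * lam) * rho x <= rho y <= 2 * rho x.
Proof.
move=> xy; have := rhoL x y; rewrite -[x - y]opprB enormN => H.
have : L * euclidean_norm (y - x) <= L * lam * rho x by rewrite -mulrA ler_wpM2l// ltW.
have : L * lam * rho x <= rho x by rewrite ler_piMl// ltW.
move: H; rewrite ler_norml => /andP[]; lra.
Qed.

(** Integrating F against kernel (x, y) in y gives, up to a constant, the mean of F
over the ball of center x and radius lam * rho x. *)
Definition kernel (p : 'rV[R]_d * 'rV[R]_d) : R :=
  if euclidean_norm (p.2 - p.1) < lam * rho p.1 then (rho p.1 ^+ d)^-1 else 0.

Lemma kernel_ge0 p : 0 <= kernel p.
Proof. by rewrite /kernel; case: ifP => // _; rewrite invr_ge0 exprn_ge0// ltW. Qed.

Lemma measurable_kernel : measurable_fun setT (kernel : _ -> measurableTypeR R).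
Proof.
have mrho : measurable_fun setT (fun p : 'rV[R]_d * 'rV[R]_d => rho p.1 : measurableTypeR R).
  by apply: measurableT_comp => //; apply: continuous_measurable_row; exact: rho_continuous.
have msub : measurable_fun setT (fun p : 'rV[R]_d * 'rV[R]_d => p.2 - p.1).
  apply: measurable_fun_row => i.
  rewrite (_ : _ \o _ = (fun p : 'rV[R]_d * 'rV[R]_d => p.2 0 i - p.1 0 i)).
    have m1 := measurableT_comp (measurable_coor i) (@measurable_fst _ _ 'rV[R]_d 'rV[R]_d).
    have m2 := measurableT_comp (measurable_coor i) (@measurable_snd _ _ 'rV[R]_d 'rV[R]_d).
    exact: measurable_funB m2 m1.
  by apply/funext => p /=; rewrite !mxE.
have mnorm : measurable_fun setT (fun p : 'rV[R]_d * 'rV[R]_d => euclidean_norm (p.2 - p.1) : measurableTypeR R).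
  by apply: measurableT_comp => //; apply: continuous_measurable_row; exact: enorm_continuous.
apply: measurable_fun_ifT => //.
  by apply: measurable_fun_ltr => //; apply: measurable_funM.
apply: (@measurableT_comp _ _ _ _ _ _ (fun x : 'rV[R]_d => (rho x ^+ d)^-1 : measurableTypeR R)) => //.
apply: continuous_measurable_row => x; apply: (@cvgV _ _ (nbhs x) _ (fun y => rho y ^+ d) (rho x ^+ d)).
  by rewrite expf_neq0// gt_eqF.
by apply: contX; exact: rho_continuous.
Qed.

Lemma kernel_column (v : R) (y : 'rV[R]_d) : 0 < v ->
  borel_lebesgue (euclidean_ball (0 : 'rV[R]_d) 1) = v%:E ->
  (\int[@borel_lebesgue R d]_x (kernel (x, y))%:E <=
    ((2 * lam / (1 - L * lam)) ^+ d * v)%:E)%E.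
Proof.
move=> v0 vE; pose c := 1 - L * lam; have c0 : 0 < c by rewrite subr_gt0.
pose r := lam * rho y / c.
have r0 : 0 < r by rewrite !mulr_gt0// invr_gt0.
have mB : measurable (euclidean_ball y r) by exact: measurable_eball.
have K0 : 0 <= (2 / rho y) ^+ d by rewrite exprn_ge0// divr_ge0// ltW.
have kle x : kernel (x, y) <= (2 / rho y) ^+ d * \1_(euclidean_ball y r) x.
  rewrite /kernel/=; case: ifP => [xy|_]; last by rewrite mulr_ge0.
  have /andP[r1 r2] := rho_near xy.
  rewrite indicE mem_set ?mulr1.
    rewrite -exprVn lerXn2r ?nnegrE ?invr_ge0 ?divr_ge0 ?(ltW (rho0 _))//.
    by rewrite -[leRHS]invf_div lef_pV2 ?posrE ?divr_gt0// ler_pdivrMr// mulrC.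
  rewrite /euclidean_ball/= -opprB enormN; apply: (lt_le_trans xy).
  by rewrite /r -mulrA ler_pM2l// ler_pdivlMr// mulrC.
apply: (@le_trans _ _ (\int[@borel_lebesgue R d]_x ((2 / rho y) ^+ d * \1_(euclidean_ball y r) x)%:E)%E).
  apply: ge0_le_integral => //.
  - by move=> x _; rewrite lee_fin kernel_ge0.
  - apply/measurable_EFinP; apply: (measurableT_comp measurable_kernel); exact: measurable_fun_pair.
  - by apply/measurable_EFinP; apply: measurable_funM => //; exact: measurable_indic.
  - by move=> x _; rewrite lee_fin.
under eq_integral do rewrite EFinM.
rewrite ge0_integralZl//; last by apply/measurable_EFinP; exact: measurable_indic.
rewrite integral_indic// setIT [X in (_ * X)%E](_ : _ = (r ^+ d * v)%:E); last first.
  by rewrite EFinM -vE; exact: eball_affine.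
rewrite -EFinM lee_fin mulrA -exprMn ler_pM2r// (_ : _ / _ * r = 2 * lam / c)//.
by rewrite /r; field; rewrite !gt_eqF.
Qed.

Lemma measurable_kernel_mul (F : 'rV[R]_d -> \bar R) : measurable_fun setT F ->
  measurable_fun setT (fun p => (kernel p)%:E * F p.2)%E.
Proof.
move=> mF; apply: emeasurable_funM; first by apply/measurable_EFinP; exact: measurable_kernel.
exact: measurableT_comp.
Qed.

(** By Tonelli's theorem it is enough to integrate the kernel in x for fixed y. If
the ball of x contains y, then rho x and rho y are comparable, so that x is in a
ball of radius comparable to rho y, where the kernel is comparable to the
inverse of its volume. *)
Lemma averaging (v : R) (F : 'rV[R]_d -> \bar R) : 0 < v ->
  borel_lebesgue (euclidean_ball (0 : 'rV[R]_d) 1) = v%:E ->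
  measurable_fun setT F -> (forall y, 0 <= F y)%E ->
  (\int[@borel_lebesgue R d]_x \int[@borel_lebesgue R d]_y ((kernel (x, y))%:E * F y) <=
    ((2 * lam / (1 - L * lam)) ^+ d * v)%:E * \int[@borel_lebesgue R d]_y F y)%E.
Proof.
move=> v0 vE mF F0.
have mk := measurable_kernel_mul mF.
rewrite (fubini_tonelli (fun p => (kernel p)%:E * F p.2)%E)//=; last first.
  by move=> p; rewrite mule_ge0// lee_fin kernel_ge0.
have C0 : 0 <= (2 * lam / (1 - L * lam)) ^+ d * v.
  by rewrite mulr_ge0 ?ltW// exprn_gt0// divr_gt0 ?mulr_gt0// subr_gt0.
rewrite -ge0_integralZl//.
apply: ge0_le_integral => //.
- by move=> y _; apply: integral_ge0 => x _; rewrite mule_ge0// lee_fin kernel_ge0.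
- apply: (measurable_fun_fubini_tonelli_G (fun p => (kernel p)%:E * F p.2)%E) => //.
  by move=> p; rewrite mule_ge0// lee_fin kernel_ge0.
- exact: measurable_funeM.
move=> y _; under eq_integral do rewrite muleC.
rewrite ge0_integralZl//; last 2 first.
- apply/measurable_EFinP; apply: (measurableT_comp measurable_kernel); exact: measurable_fun_pair.
- by move=> x _; rewrite lee_fin kernel_ge0.
by rewrite muleC lee_wpmul2r//; exact: kernel_column.
Qed.

End averaging.

(** * The local estimate *)

Lemma sumsq_integral_le (R : realType) (d n : nat) (w : seq bool -> 'rV[R]_d -> R)
    (D : set 'rV[R]_d) (A : R) :
  measurable D -> (forall l, continuous (w l)) ->
  (forall l, (\int[@borel_lebesgue R d]_(y in D) (w l y ^+ 2)%:E <= A%:E)%E) ->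
  (\int[@borel_lebesgue R d]_(y in D) (sumsq n w y)%:E <= (2 ^+ n * A)%:E)%E.
Proof.
move=> mD; elim: n w => [|n IH] w cw wA /=; first by rewrite expr0 mul1r; exact: wA.
under eq_integral do rewrite EFinD.
have ms b : measurable_fun D (fun y => (sumsq n (fun l => w (b :: l)) y)%:E).
  apply/measurable_EFinP; apply: measurable_funTS; apply: continuous_measurable_row.
  by apply: sumsq_continuous => l; exact: cw.
rewrite ge0_integralD//; last 2 first.
- by move=> y _; rewrite lee_fin sumsq_ge0.
- by move=> y _; rewrite lee_fin sumsq_ge0.
rewrite exprS -mulrA mulr_natl mulr2n EFinD leeD// IH//; by move=> l; exact: cw.
Qed.

Section words_of_bits.
Variable d : nat.

(** A word of bits selects a set of coordinates; it is turned into the word of the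
partial derivatives with respect to these. *)
Definition bits_word (l : seq bool) : seq 'I_d := [seq i : 'I_d <- enum 'I_d | nth false l i].

Lemma size_bits_word l : (size (bits_word l) <= d)%N.
Proof. by rewrite size_filter (leq_trans (count_size _ _))// size_enum_ord. Qed.

Lemma bits_word_set l (i : 'I_d) : nth false l i = false ->
  perm_eq (i :: bits_word l) (bits_word (set_nth false l i true)).
Proof.
move=> li; apply: uniq_perm.
- by rewrite /= mem_filter li/= filter_uniq ?enum_uniq.
- by rewrite filter_uniq ?enum_uniq.
have E l' j : (j \in bits_word l') = nth false l' j.
  by rewrite mem_filter mem_enum andbT.
move=> j; rewrite in_cons !E nth_set_nth/=.
by rewrite (inj_eq val_inj) ; case: eqP.
Qed.

Lemma bits_word0 : bits_word (nseq d false) = [::].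
Proof.
apply/eqP; rewrite -size_eq0 size_filter -leqn0 leqNgt -has_count.
by apply/hasPn => i _; rewrite nth_nseq ltn_ord.
Qed.

End words_of_bits.

(** Sobolev's inequality on the cube of corner y and side eta * rho x, which stays
inside the ball of radius lam * rho x. There rho is at least c * rho x; the
powers of c enter the geometric factor. The price is d more derivatives. *)
Lemma word_sup (R : realType) (d : nat) (u rho : 'rV[R]_d -> R) (L : R) (M : nat -> R)
    (x y : 'rV[R]_d) (s : seq 'I_d) (kap Q : R) :
  (1 <= d)%N -> real_smooth setT u ->
  (forall z, 0 < rho z) -> 0 <= L < 1 ->
  (forall z z', `|rho z - rho z'| <= L * euclidean_norm (z - z')) ->
  (forall i, 0 < M i) -> (forall i j, (i <= j)%N -> M i <= M j) ->
  1 <= kap -> 0 <= Q ->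
  let lam := 1 + (1 - L) / 2 in let c := 1 - L * lam in
  let eta := (1 - L) / (2 * d%:R) in
  (forall s' : seq 'I_d, (\int[@borel_lebesgue R d]_(z in euclidean_ball x (lam * rho x))
     ((rho z ^+ size s' * foldr partial u s' z) ^+ 2)%:E <=
     (kap ^+ size s' * M (size s') ^+ 2 * Q)%:E)%E) ->
  euclidean_norm (y - x) < rho x ->
  (rho x ^+ size s * foldr partial u s y) ^+ 2 <=
    (4 / (eta * rho x)) ^+ d * (kap / c ^+ 2) ^+ (size s + d) * M (size s + d)%N ^+ 2 * Q.
Proof.
move=> d1 su rho0 /andP[L0 L1] rhoL M0 Mmon kap1 Q0 lam c eta HQ xy.
have dR : 0 < d%:R :> R by rewrite ltr0n.
have dR1 : 1 <= d%:R :> R by rewrite ler1n.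
have lam0 : 0 < lam by rewrite /lam; lra.
have c0 : 0 < c by rewrite /c /lam; nra.
have c1 : c <= 1 by rewrite /c gerBl mulr_ge0// ltW.
have Llam : L * lam < 1 by rewrite -subr_gt0.
have eta0 : 0 < eta by rewrite divr_gt0 ?mulr_gt0// subr_gt0.
have eta1 : eta <= 1 by rewrite ler_pdivrMr ?mulr_gt0// mul1r; lra.
have deta : d%:R * eta = (1 - L) / 2.
  by rewrite /eta; field; rewrite gt_eqF.
set r := rho x; have r0 : 0 < r by exact: rho0.
pose h := eta * r; have h0 : 0 < h by rewrite mulr_gt0.
set k := size s.
pose D (s' : seq 'I_d) := foldr partial u s'.
pose w (l : seq bool) (z : 'rV[R]_d) := h ^+ size (bits_word d l) * D (bits_word d l ++ s) z.
have cw l : continuous (w l).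
  by apply: contM; [exact: cst_continuous|exact: smooth_continuous].
have dw l (i : 'I_d) : size l = d -> nth false l i = false ->
    line_deriv (w l) (basis_vec i) (fun z => h^-1 * w (set_nth false l i true) z).
  move=> _ li z t.
  have := is_deriveZ (h ^+ size (bits_word d l)) (smooth_line_deriv su (bits_word d l ++ s) i z t).
  move=> H; apply: is_derive_ext H _ _ => [//|].
  have P := bits_word_set li.
  have ED : D (bits_word d (set_nth false l i true) ++ s) = D (i :: bits_word d l ++ s).
    by apply: (smooth_perm su); rewrite perm_sym -cat_cons perm_cat2r.
  by rewrite /w ED -(perm_size P) /= exprS -[h * _ * _]mulrA mulKf ?gt_eqF.
have cubeB : cube y h `<=` euclidean_ball x (lam * r).
  move=> z yz; rewrite /euclidean_ball/= (_ : z - x = (z - y) + (y - x)); last by rewrite addrA subrK.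
  apply: (le_lt_trans (enormD _ _)).
  have : euclidean_norm (z - y) <= d%:R * h.
    apply: enorm_le_sum; first exact: ltW.
    move=> i; have := yz i; rewrite !mxE => /andP[? ?].
    by rewrite ger0_norm; lra.
  rewrite /h mulrA deta /lam mulrDl mul1r; move: xy; rewrite -/r; lra.
have mcube := measurable_cube y h.
have mB : measurable (euclidean_ball x (lam * r)) by exact: measurable_eball.
pose A := (r ^+ k)^-1 ^+ 2 * ((kap / c ^+ 2) ^+ (k + d) * M (k + d)%N ^+ 2 * Q).
have kc1 : 1 <= kap / c ^+ 2.
  by rewrite ler_pdivlMr ?exprn_gt0// mul1r; apply: le_trans kap1; rewrite exprn_ile1// ltW.
have wA l : (\int[@borel_lebesgue R d]_(z in cube y h) (w l z ^+ 2)%:E <= A%:E)%E.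
  set m := size (bits_word d l); have md : (m <= d)%N by exact: size_bits_word.
  set s' := bits_word d l ++ s.
  have ss' : size s' = (m + k)%N by rewrite size_cat.
  pose Z := h ^+ m * (c * r) ^- (m + k).
  have Z0 : 0 <= Z by rewrite mulr_ge0 ?invr_ge0 ?exprn_ge0// ltW// mulr_gt0.
  have msq : measurable_fun setT (fun z : 'rV[R]_d => ((rho z ^+ size s' * D s' z) ^+ 2)%:E).
    apply/measurable_EFinP; apply: continuous_measurable_row.
    apply: contX; apply: contM; last exact: smooth_continuous.
    by apply: contX; exact: (rho_continuous L0 rhoL).
  apply: (@le_trans _ _ (\int[@borel_lebesgue R d]_(z in euclidean_ball x (lam * r))
      ((Z ^+ 2)%:E * ((rho z ^+ size s' * D s' z) ^+ 2)%:E))%E).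
    apply: (@le_trans _ _ (\int[@borel_lebesgue R d]_(z in cube y h)
      ((Z ^+ 2)%:E * ((rho z ^+ size s' * D s' z) ^+ 2)%:E))%E).
      apply: ge0_le_integral => //.
      - by move=> z _; rewrite lee_fin sqr_ge0.
      - apply/measurable_EFinP; apply: measurable_funTS; apply: continuous_measurable_row.
        by apply: contX; exact: cw.
      - by apply: measurable_funeM; exact: measurable_funTS.
      move=> z yz; rewrite -EFinM lee_fin -exprMn.
      rewrite -[w l z ^+ 2]real_normK ?num_real// -[leRHS]real_normK ?num_real//.
      rewrite lerXn2r ?nnegrE//.
      have /andP[rz _] := rho_near rho0 L0 rhoL Llam (cubeB z yz).
      rewrite /w -/m -/s' /Z -mulrA !normrM ler_pM2l ?normr_gt0 ?expf_neq0 ?gt_eqF//.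
      rewrite mulrA -[leLHS]mul1r ler_wpM2r//.
      rewrite (ger0_norm (ltW _)) ?invr_gt0 ?exprn_gt0 ?mulr_gt0// ger0_norm ?exprn_ge0 ?(ltW (rho0 _))//.
      rewrite ss' mulrC ler_pdivlMr ?exprn_gt0 ?mulr_gt0// mul1r.
      by rewrite lerXn2r ?nnegrE ?(ltW (rho0 _))// ltW// mulr_gt0.
    apply: ge0_subset_integral => //; first by apply: measurable_funeM; exact: measurable_funTS.
    by move=> z _; rewrite mule_ge0// lee_fin sqr_ge0.
  rewrite ge0_integralZl//; last 3 first.
  - exact: measurable_funTS.
  - by move=> z _; rewrite lee_fin sqr_ge0.
  - by rewrite lee_fin sqr_ge0.
  apply: (@le_trans _ _ ((Z ^+ 2)%:E * (kap ^+ size s' * M (size s') ^+ 2 * Q)%:E)%E).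
    by rewrite lee_wpmul2l ?lee_fin ?sqr_ge0//; exact: HQ.
  rewrite -EFinM lee_fin ss' /A.
  have kap0 : 0 <= kap by exact: le_trans kap1.
  have -> : Z ^+ 2 * (kap ^+ (m + k) * M (m + k)%N ^+ 2 * Q) =
     (r ^+ k)^-1 ^+ 2 * ((eta ^+ m) ^+ 2 * ((kap / c ^+ 2) ^+ (m + k) * M (m + k)%N ^+ 2) * Q).
    rewrite /Z /h !exprD ![(kap / c ^+ 2) ^+ _]expr_div_n [(eta * r) ^+ m]exprMn [(c * r) ^+ m]exprMn [(c * r) ^+ k]exprMn.
    rewrite ![(c ^+ 2) ^+ _]exprAC.
    have := exprn_gt0 m r0; have := exprn_gt0 k r0.
    have := exprn_gt0 m c0; have := exprn_gt0 k c0.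
    move: (r ^+ m) (r ^+ k) (c ^+ m) (c ^+ k) (kap ^+ m) (kap ^+ k) (eta ^+ m).
    move=> rm rk cm ck km kk em ck0 cm0 rk0 rm0; field.
    by rewrite !gt_eqF.
  rewrite ler_wpM2l ?sqr_ge0// ler_wpM2r//.
  apply: (@le_trans _ _ ((kap / c ^+ 2) ^+ (m + k) * M (m + k)%N ^+ 2)).
    rewrite ler_piMl//.
      by rewrite mulr_ge0 ?sqr_ge0// exprn_ge0// (le_trans _ kc1).
    by rewrite exprn_ile1 ?exprn_ge0 ?(ltW eta0)// exprn_ile1// ltW.
  have mkd : (m + k <= k + d)%N by rewrite addnC leq_add2l.
  apply: ler_pM; [by rewrite exprn_ge0// (le_trans _ kc1)|exact: sqr_ge0|exact: ler_weXn2l|].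
  by rewrite lerXn2r ?nnegrE ?(ltW (M0 _))// Mmon.
have := sobolev_cube y h0 cw dw.
have -> : w (nseq d false) y = D s y by rewrite /w bits_word0 expr0 mul1r.
have K0 : (0 <= ((2 / h) ^+ d)%:E)%E by rewrite lee_fin exprn_ge0// divr_ge0// ltW.
move=> /le_trans/(_ (lee_wpmul2l K0 (sumsq_integral_le d mcube cw wA))).
rewrite -EFinM lee_fin mulrA -exprMn => Dle.
rewrite exprMn; have rk : 0 <= (r ^+ k) ^+ 2 by rewrite sqr_ge0.
apply: (le_trans (ler_wpM2l rk Dle)).
rewrite /A mulrCA [X in _ * X](_ : _ = (kap / c ^+ 2) ^+ (k + d) * M (k + d)%N ^+ 2 * Q); last first.
  by rewrite exprVn mulVKf// expf_neq0// expf_neq0// gt_eqF.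
rewrite (_ : 2 / h * 2 = 4 / (eta * r)); last by rewrite /h; field; rewrite !gt_eqF.
by rewrite !mulrA.
Qed.

(** The constants lam, c, eta, kap, q, P and A keep the same meaning in the
statements below: lam dilates the balls, c bounds the decrease of rho on them,
eta is the relative size of the cubes, kap the number of coordinates doubled for
the summation over words, q the growth of the derivatives, P the constant of
Sobolev's inequality and A that of averaging. *)
Lemma constants_ge1 (R : realType) (d : nat) (L v : R) :
  (1 <= d)%N -> 0 <= L < 1 -> 0 < v ->
  let lam := 1 + (1 - L) / 2 in let c := 1 - L * lam in
  let eta := (1 - L) / (2 * d%:R) in let kap : R := 2 * d%:R in
  let q := kap / c ^+ 2 in let P := (4 * kap / (eta * c ^+ 2)) ^+ d in
  let A := 1 + (2 * lam / c) ^+ d * v in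
  [/\ 1 <= q, 1 <= P & 1 <= A].
Proof.
move=> d1 /andP[L0 L1] v0 lam c eta kap q P A.
have dR : 0 < d%:R :> R by rewrite ltr0n.
have dR1 : 1 <= d%:R :> R by rewrite ler1n.
have L1' : 0 < 1 - L by rewrite subr_gt0.
have lam0 : 0 < lam by rewrite /lam; lra.
have c0 : 0 < c by rewrite /c /lam; nra.
have c1 : c <= 1 by rewrite /c /lam; nra.
have c20 : 0 < c ^+ 2 by rewrite exprn_gt0.
have c21 : c ^+ 2 <= 1 by rewrite expr_le1// ltW.
have eta0 : 0 < eta by rewrite divr_gt0// mulr_gt0.
have eta1 : eta <= 1 by rewrite /eta ler_pdivrMr ?mulr_gt0//; lra.
split.
- by rewrite /q ler_pdivlMr// mul1r /kap; lra.
- apply: exprn_ege1; rewrite ler_pdivlMr ?mul1r; last exact: mulr_gt0.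
  apply: (@le_trans _ _ 1); last by rewrite /kap; lra.
  by apply: mulr_ile1 => //; exact: ltW.
by rewrite /A lerDl; apply: mulr_ge0; rewrite ?ltW// exprn_gt0// divr_gt0// mulr_gt0.
Qed.

(** If the conclusion failed, then u ^+ 2 would be at most a ^+ 2, with a a small
multiple of |u x|, on at least half of the given part of the ball. A segment from
x that meets this set often is provided by pigeonhole_scales; on it the
derivatives of u are bounded through word_sup by a logarithmically convex
sequence, and remez_segment bounds |u x| by half of itself. *)
Lemma local_bound (R : realType) (d : nat) (u rho : 'rV[R]_d -> R) (L : R) (M : nat -> R)
    (v gam e1 : R) (W : set 'rV[R]_d) (x : 'rV[R]_d) (n k1 : nat) :
  (1 <= d)%N -> real_smooth setT u ->
  (forall z, 0 < rho z) -> 0 <= L < 1 ->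
  (forall z z', `|rho z - rho z'| <= L * euclidean_norm (z - z')) ->
  (forall i, 0 < M i) -> (forall i j, (i <= j)%N -> M i <= M j) -> log_convex M ->
  0 < v -> borel_lebesgue (euclidean_ball (0 : 'rV[R]_d) 1) = v%:E ->
  0 < gam <= 1 -> measurable W ->
  ((gam * (rho x ^+ d * v))%:E <= borel_lebesgue (W `&` euclidean_ball x (rho x)))%E ->
  0 < e1 ->
  let lam := 1 + (1 - L) / 2 in let c := 1 - L * lam in
  let eta := (1 - L) / (2 * d%:R) in let kap : R := 2 * d%:R in
  let q := kap / c ^+ 2 in let P := (4 * kap / (eta * c ^+ 2)) ^+ d in
  (forall s' : seq 'I_d, (\int[@borel_lebesgue R d]_(z in euclidean_ball x (lam * rho x))
     ((rho z ^+ size s' * foldr partial u s' z) ^+ 2)%:E <=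
     (kap ^+ size s' * M (size s') ^+ 2 * (rho x ^+ d * u x ^+ 2 / e1 ^+ 2))%:E)%E) ->
  expR (- k1%:R) * (P * M d) < e1 ->
  (0 < n)%N -> (k1 <= n.+1)%N ->
  expR 1 * (d%:R * q) <= \sum_(k1 <= i < n.+1) M (i + d)%N / M (i + d).+1 ->
  ((rho x ^+ d * u x ^+ 2)%:E <=
    (32 * expR 1 ^+ 2 * (4 * expR 2 / (gam ^+ 2 / (20 * d%:R))) ^+ n ^+ 2 / (gam * v))%:E *
    \int[@borel_lebesgue R d]_(z in W `&` euclidean_ball x (rho x)) (u z ^+ 2)%:E)%E.
Proof.
move=> d1 su rho0 L01 rhoL M0 Mmon lc v0 vE /andP[gam0 gam1] mW thickx e10 lam c eta kap q P HQ ke1 n0 k1n sumge.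
have [L0 L1] : 0 <= L /\ L < 1 by case/andP: L01.
have dR : 0 < d%:R :> R by rewrite ltr0n.
have dR1 : 1 <= d%:R :> R by rewrite ler1n.
have nR : 0 < n%:R :> R by rewrite ltr0n.
have nR1 : 1 <= n%:R :> R by rewrite ler1n.
set r := rho x; have r0 : 0 < r by exact: rho0.
set theta := gam ^+ 2 / (20 * d%:R).
have [Z ZE] : exists Z, Z = (4 * expR 2 / theta) ^+ n by eexists.
rewrite -ZE.
have th0 : 0 < theta by rewrite divr_gt0 ?exprn_gt0// mulr_gt0.
have Z0 : 0 < Z by rewrite ZE exprn_gt0// divr_gt0// mulr_gt0// expR_gt0.
have E10 : 0 < expR 1 :> R by exact: expR_gt0.
set B := euclidean_ball x r; set I := (\int[_]_(z in _) _)%E.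
have mB : measurable B by exact: measurable_eball.
have mWB : measurable (W `&` B) by exact: measurableI.
have cu : continuous u := @smooth_continuous R d u su [::].
have mu2 : measurable_fun setT (fun z : 'rV[R]_d => u z ^+ 2 : measurableTypeR R).
  by apply: continuous_measurable_row; exact: contX.
have I0 : (0 <= I)%E by apply: integral_ge0 => z _; rewrite lee_fin sqr_ge0.
have [ux0|ux0] := eqVneq (u x) 0.
  rewrite ux0 expr0n/= mulr0; apply: mule_ge0 => //.
  by rewrite lee_fin divr_ge0 ?mulr_ge0 ?sqr_ge0 ?ltW.
pose tau := `|u x|; have tau0 : 0 < tau by rewrite normr_gt0.
(* with this value remez_segment gives tau <= tau / 2 *)
pose a := tau / (4 * expR 1 * Z).
have a0 : 0 < a by rewrite divr_gt0// !mulr_gt0.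
have V0 : 0 < r ^+ d * v by rewrite mulr_gt0// exprn_gt0.
rewrite leNgt; apply/negP => Ilt.
have Ilt2 : (I < (a ^+ 2 * (gam / 2 * (r ^+ d * v)))%:E)%E.
  rewrite -(@lte_pmul2l _ (32 * expR 1 ^+ 2 * Z ^+ 2 / (gam * v))%:E)//; last first.
    rewrite lte_fin; apply: divr_gt0; last exact: mulr_gt0.
    by rewrite !mulr_gt0 ?exprn_gt0.
  apply: (lt_le_trans Ilt); rewrite -EFinM lee_fin -[u x ^+ 2]real_normK ?num_real// -/tau.
  rewrite le_eqVlt; apply/orP; left; apply/eqP; rewrite /a; field.
  by rewrite !gt_eqF.
pose E := (W `&` B) `&` [set z | u z ^+ 2 <= a ^+ 2].
have mS : measurable [set z : 'rV[R]_d | u z ^+ 2 <= a ^+ 2].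
  have := mu2 measurableT _ (measurable_itv `]-oo, a ^+ 2]); rewrite setTI.
  by congr measurable; apply/seteqP; split => z /=; rewrite in_itv.
have mE : measurable E by exact: measurableI.
have mD : measurable ((W `&` B) `\` E) by exact: measurableD.
have EB : E `<=` B by move=> z [[]].
have muE : ((gam / 2 * (r ^+ d * v))%:E <= borel_lebesgue E)%E.
  have DI : ((a ^+ 2)%:E * borel_lebesgue ((W `&` B) `\` E) <= I)%E.
    apply: (@le_trans _ _ (\int[@borel_lebesgue R d]_(z in (W `&` B) `\` E) (u z ^+ 2)%:E)%E).
      have <- := integral_cst (@borel_lebesgue R d) mD (a ^+ 2)%:E.
      apply: ge0_le_integral => //.
      - by move=> z _; rewrite lee_fin sqr_ge0.
      - by apply/measurable_EFinP; exact: measurable_funTS.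
      by move=> z [WBz nE]; rewrite lee_fin leNgt; apply/negP => ua; apply: nE; split=> //=; exact: ltW.
    apply: ge0_subset_integral => //.
    - by apply/measurable_EFinP; exact: measurable_funTS.
    - by move=> z _; rewrite lee_fin sqr_ge0.
  have Dlt : (borel_lebesgue ((W `&` B) `\` E) < (gam / 2 * (r ^+ d * v))%:E)%E.
    rewrite -(@lte_pmul2l _ (a ^+ 2)%:E)// ?lte_fin ?exprn_gt0//.
    by apply: (le_lt_trans DI); rewrite -EFinM.
  have WBE : borel_lebesgue (W `&` B) = (borel_lebesgue ((W `&` B) `\` E) + borel_lebesgue E)%E.
    rewrite (measureDI (@borel_lebesgue R d) mWB mE); congr (_ + _)%E.
    by congr borel_lebesgue; apply/setIidPr => z [].
  have fD : borel_lebesgue ((W `&` B) `\` E) \is a fin_num.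
    by rewrite ge0_fin_numE//; apply: lt_trans Dlt (ltry _).
  move: thickx; rewrite -/r -/B WBE; move: Dlt; rewrite -(fineK fD) lte_fin.
  case: (borel_lebesgue E) => [m| |] //=; rewrite ?leey// -EFinD !lee_fin.
  by move: (gam) (r ^+ d * v) => g V; nra.
(* more than 4 n / gam scales are used, which by the choice of theta cost only
   half of the fraction gam / 2 of the ball filled by E *)
pose sig := theta / n%:R; have sig0 : 0 < sig by rewrite divr_gt0.
pose Ln := (Num.truncn (4 * n%:R / gam)).+1.
have Lgt : 4 * n%:R / gam < Ln%:R by exact: truncnS_gt.
have q0 : 0 <= 4 * n%:R / gam by rewrite divr_ge0 ?mulr_ge0// ltW.
have Lle : Ln%:R <= 5 * n%:R / gam.
  have : (Num.truncn (4 * n%:R / gam))%:R <= 4 * n%:R / gam by rewrite truncn_le.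
  have : 1 <= n%:R / gam by rewrite ler_pdivlMr// mul1r (le_trans gam1).
  by rewrite /Ln -natr1 -!mulrA; lra.
have Lsig : d%:R * (Ln%:R * sig) <= gam / 2 / 2.
  apply: (@le_trans _ _ (d%:R * (5 * n%:R / gam * sig))).
    by rewrite ler_wpM2l// ler_wpM2r// ltW.
  rewrite le_eqVlt; apply/orP; left; apply/eqP; rewrite /sig /theta; field.
  by rewrite !gt_eqF.
have Lsig1 : Ln%:R * sig < 1.
  apply: (@le_lt_trans _ _ (d%:R * (Ln%:R * sig))); last lra.
  by rewrite ler_peMl// mulr_ge0// ltW.
have nL : n%:R < Ln%:R * (gam / 2 / 2).
  by move: Lgt; rewrite ltr_pdivrMr//; lra.
have gam20 : 0 < gam / 2 by rewrite divr_gt0.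
have [y [p [By p01 psep pE]]] := pigeonhole_scales r0 v0 vE mE EB gam20 muE sig0 Lsig Lsig1 nL.
pose w := y - x.
pose g k (t : R) := line_word u w k [::] (x + t *: w).
have dg k (t : R) : is_derive t 1 (g k) (g k.+1 t) by exact: (line_word_deriv su w k [::] x t).
(* the bounds given by word_sup for the derivatives along w: the factor d ^+ k
   counts words, and tau / e1 comes from the square root of the energy *)
pose M' k := P * (d%:R * q) ^+ k * M (k + d)%N * (tau / e1).
have lam0 : 0 < lam by rewrite /lam; lra.
have c0 : 0 < c by rewrite /c /lam; nra.
have c1 : c <= 1 by rewrite /c gerBl mulr_ge0// ltW.
have eta0 : 0 < eta by rewrite divr_gt0 ?mulr_gt0// subr_gt0.
have eta1 : eta <= 1 by rewrite ler_pdivrMr ?mulr_gt0// mul1r; lra.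
have kap1 : 1 <= kap by rewrite /kap; lra.
have kap0 : 0 < kap by rewrite (lt_le_trans ltr01).
have [q1 P1] : 1 <= q /\ 1 <= P by have [] := constants_ge1 d1 L01 v0.
have qp : 0 < q by exact: lt_le_trans q1.
have P0 : 0 < P by exact: lt_le_trans P1.
have dq0 : 0 < d%:R * q by exact: mulr_gt0.
have te0 : 0 < tau / e1 by exact: divr_gt0.
have pos (z : R) k : 0 < z -> 0 < P * z ^+ k * M (k + d)%N * (tau / e1).
  move=> z0; apply: mulr_gt0 te0; apply: mulr_gt0 (M0 _); apply: mulr_gt0 P0 _.
  exact: exprn_gt0.
have M'0 k : 0 < M' k by exact: pos.
have lc' : log_convex M'.
  move=> k k0; have := lc (k + d)%N (leq_trans k0 (leq_addr _ _)).
  have -> : (k + d).-1 = (k.-1 + d)%N by rewrite -{1}(prednK k0).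
  move=> lck; rewrite /M' addSn.
  have -> : P * (d%:R * q) ^+ k.+1 * M (k + d).+1 * (tau / e1) *
    (P * (d%:R * q) ^+ k.-1 * M (k.-1 + d)%N * (tau / e1)) =
    (P * (d%:R * q) ^+ k * (tau / e1)) ^+ 2 * (M (k + d).+1 * M (k.-1 + d)%N).
    by rewrite -[in (_ * _) ^+ k.+1](prednK k0) -[in (_ * _) ^+ k](prednK k0) !exprS; ring.
  rewrite (_ : (P * _ * _ * _) ^+ 2 = (P * (d%:R * q) ^+ k * (tau / e1)) ^+ 2 * M (k + d)%N ^+ 2); last by ring.
  by rewrite ler_wpM2l// sqr_ge0.
have wr i : `|w 0 i| <= r by apply: (le_trans (enorm_coor _ _)); exact: ltW.
have gM k (t : R) : 0 <= t <= 1 -> `|g k t| <= M' k.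
  move=> /andP[t0 t1].
  have xt : euclidean_norm (x + t *: w - x) < r.
    rewrite addrAC subrr add0r enormZ ger0_norm//; apply: le_lt_trans By.
    by rewrite ler_piMl// enorm_ge0.
  pose C := (r ^+ k)^-1 * (P * q ^+ k * M (k + d)%N * (tau / e1)).
  have C0 : 0 <= P * q ^+ k * M (k + d)%N * (tau / e1).
    by apply: ltW; exact: pos.
  have -> : M' k = (d%:R * r) ^+ k * C.
    rewrite /C /M' !exprMn; have : r ^+ k != 0 by rewrite expf_neq0// gt_eqF.
    by move: (r ^+ k) => rk rk0; field; rewrite rk0 gt_eqF.
  apply: line_word_bound => // s' ss'.
  have {}ss' : size s' = k by rewrite ss' addn0.
  rewrite -(ler_pM2l (exprn_gt0 k r0)) /C mulVKf ?expf_neq0 ?gt_eqF//.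
  rewrite -[r ^+ k]gtr0_norm ?exprn_gt0// -normrM.
  rewrite -(ger0_norm C0) -ler_sqr ?nnegrE// !real_normK ?num_real//.
  have Q0 : 0 <= r ^+ d * u x ^+ 2 / e1 ^+ 2.
    by rewrite divr_ge0 ?sqr_ge0// mulr_ge0 ?sqr_ge0// exprn_ge0// ltW.
  have := @word_sup R d u rho L M x (x + t *: w) s' kap _ d1 su rho0 L01 rhoL M0 Mmon kap1 Q0 HQ xt.
  rewrite ss' -/r -/c -/eta -/q => /le_trans; apply.
  have -> : (4 / (eta * r)) ^+ d * q ^+ (k + d) * M (k + d)%N ^+ 2 * (r ^+ d * u x ^+ 2 / e1 ^+ 2) =
     P * q ^+ k * (M (k + d)%N * (tau / e1)) ^+ 2.
    have -> : P = (4 / (eta * r)) ^+ d * q ^+ d * r ^+ d.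
      rewrite /P -!exprMn; congr (_ ^+ _); rewrite /q; field.
      by rewrite !gt_eqF.
    rewrite exprD [(M _ * _) ^+ 2]exprMn [(tau / e1) ^+ 2]expr_div_n /tau real_normK ?num_real//.
    by ring.
  rewrite -[in leRHS]mulrA [leRHS]exprMn ler_wpM2r ?sqr_ge0//.
  have Pq1 : 1 <= P * q ^+ k by apply: mulr_ege1 => //; exact: exprn_ege1.
  by rewrite expr2 ler_peMl// (le_trans _ Pq1).
have g00 : `|g 0%N 0| = tau by rewrite /g /= scale0r addr0.
have sumM' : expR 1 <= \sum_(k1 <= i < n.+1) M' i / M' i.+1.
  rewrite (eq_bigr (fun i => (M (i + d)%N / M (i + d).+1) / (d%:R * q))).
    by rewrite -mulr_suml ler_pdivlMr.
  move=> i _; rewrite /M' addSn exprS; have : (d%:R * q) ^+ i != 0 by rewrite expf_neq0// gt_eqF.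
  move: ((d%:R * q) ^+ i) => z z0; field.
  by rewrite z0 !gt_eqF.
have start : expR (- k1%:R) * M' 0%N < `|g 0%N 0|.
  rewrite g00 /M' expr0 mulr1 add0n [ltLHS](_ : _ = (expR (- k1%:R) * (P * M d)) / e1 * tau); last by ring.
  by rewrite gtr_pMl// ltr_pdivrMr// mul1r.
have pth i k : (i <= k <= n)%N -> theta / n%:R * (k - i)%:R <= p k - p i by exact: psep.
have th01 : 0 < theta <= 1.
  rewrite th0/= ler_pdivrMr ?mulr_gt0// mul1r.
  by apply: (@le_trans _ _ 1); [rewrite exprn_ile1// ltW|rewrite (le_trans dR1)// ler_peMl// ler1n].
have p0 : 0 < p 0%N by have /andP[] := p01 0%N isT.
have p1 i : (i <= n)%N -> p i <= 1 by move=> /p01/andP[].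
have ga i : (i <= n)%N -> `|g 0%N (p i)| <= a.
  move=> /pE[_ /=]; rewrite -[u _ ^+ 2]real_normK ?num_real// ler_sqr ?nnegrE//.
  exact: ltW.
have := remez_segment dg M'0 lc' gM n0 k1n sumM' start th01 p0 p1 pth ga.
rewrite g00 -ZE leNgt => /negP; apply.
rewrite /a (_ : 2 * expR 1 * Z * _ = tau / 2); last by field; rewrite !gt_eqF.
lra.
Qed.

(** * Summable ratios contradict quasi-analyticity *)

Lemma exists_antiderivative (R : realType) (g : R -> R) :
  continuous g -> (forall x, x <= 0 -> g x = 0) ->
  exists G : R -> R, forall x : R, is_derive x 1 G (g x).
Proof.
move=> cg g0.
(* any base point works at which g vanishes on both sides *)
pose G (x : R) : R := (\int[lebesgue_measure]_(t in `[(-1)%R, x]) g t)%R.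
exists G => x.
have Gz y : y <= 0 -> G y = 0.
  move=> y0; rewrite /G /Rintegral.
  rewrite (eq_integral (fun=> 0%E)) ?integral0//.
  move=> t; rewrite inE/= in_itv/= => /andP[_ ty].
  by rewrite g0// (le_trans ty).
have [x1|x1] := ltP (-1) x.
  have xx1 : x < x + 1 by rewrite ltrDl.
  have [dG GE] : derivable G x 1 /\ derive1 G x = g x.
    apply: (@continuous_FTC1_closed R g (-1) x (x + 1)) => //; last exact: cg.
    apply: continuous_compact_integrable; first exact: segment_compact.
    exact: continuous_subspaceT.
  by have := derivableP dG; rewrite -derive1E GE.
rewrite g0; last by apply: le_trans x1 _; rewrite lerN10.
apply: (near_eq_is_derive _ (is_derive_cst (0 : R) x 1)).
have x0 : x < 0 by apply: le_lt_trans x1 _; rewrite ltrN10.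
near=> y; rewrite Gz//; apply: ltW; near: y; exact: lt_nbhsl.
Unshelve. all: by end_near. Qed.

(** The mean of g over [x - a, x]. It is written with an antiderivative, chosen
among all functions, so that the mean value theorem gives its properties. *)
Definition backward_average (R : realType) (a : R) (g : R -> R) (x : R) : R :=
  let G := xget (fun=> 0) [set G : R -> R | forall x : R, is_derive x 1 G (g x)] in
  (G x - G (x - a)) / a.

(** These are the properties of the ramp x |-> min (max x 0) 1 that averages
inherit. *)
Definition ramp_like (R : realType) (g : R -> R) : Prop :=
  [/\ forall x, x <= 0 -> g x = 0, forall x, g x <= 1 &
      forall x y, x <= y -> 0 <= g y - g x <= y - x].

Section backward.
Context (R : realType).
Implicit Types g : R -> R.

Lemma ramp_like_continuous g : ramp_like g -> continuous g.
Proof.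
move=> [_ _ gl] x; apply/cvgrPdist_lt => e e0.
apply: filterS (nbhsx_ballx x e e0) => y; rewrite -ball_normE/=; apply: le_lt_trans.
have [xy|yx] := leP x y.
  by have /andP[? ?] := gl _ _ xy; rewrite distrC [leRHS]distrC !ger0_norm ?subr_ge0//; lra.
by have /andP[? ?] := gl _ _ (ltW yx); rewrite !ger0_norm ?subr_ge0//; lra.
Qed.

Lemma ramp_like_ge0 g x : ramp_like g -> 0 <= g x.
Proof.
move=> [g0 _ gl]; have [x0|x0] := leP x 0; first by rewrite g0.
by have /andP[+ _] := gl _ _ (ltW x0); rewrite (g0 0)// subr0.
Qed.

Lemma backward_averageP g : ramp_like g -> exists G : R -> R,
  (forall x : R, is_derive x 1 G (g x)) /\
  forall a x, backward_average a g x = (G x - G (x - a)) / a.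
Proof.
move=> rg; have [g0 _ _] := rg.
have [G dG] := exists_antiderivative (ramp_like_continuous rg) g0.
exists (xget (fun=> 0) [set G : R -> R | forall x : R, is_derive x 1 G (g x)]); split => //.
exact: (@xgetI _ (fun=> 0) [set G : R -> R | forall x : R, is_derive x 1 G (g x)] G dG).
Qed.

Lemma is_derive_shift_arg (f : R -> R) (df a x : R) :
  is_derive (x - a) 1 f df -> is_derive x 1 (fun y => f (y - a)) df.
Proof.
move=> h.
have hs : is_derive x 1 (fun y : R => y - a) 1.
  apply: is_derive_ext (is_deriveB (is_derive_id x 1) (is_derive_cst a x 1)) _ _ => //.
  by rewrite subr0.
apply: is_derive_ext (is_derive1_comp (g := fun y => y - a) h hs) _ _ => //.
by rewrite mulr1.
Qed.

Lemma mean_value (f df : R -> R) (a x : R) : 0 < a -> (forall y : R, is_derive y 1 f (df y)) ->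
  exists2 c, x - a <= c <= x & (f x - f (x - a)) / a = df c.
Proof.
move=> a0 h; have xa : x - a < x by rewrite ltrBlDr ltrDl.
have [|c] := MVT xa (fun y _ => h y).
  by apply: continuous_subspaceT => y; exact: is_derive_continuous (h y).
rewrite in_itv/= => /andP[c1 c2] E; exists c; first by rewrite !ltW.
by rewrite E opprB addrCA subrr addr0 mulfK ?gt_eqF.
Qed.

Lemma backward_average_diff a g1 g2 x : 0 < a -> ramp_like g1 -> ramp_like g2 ->
  exists2 c, x - a <= c <= x &
    backward_average a g1 x - backward_average a g2 x = g1 c - g2 c.
Proof.
move=> a0 /backward_averageP[G1 [d1 E1]] /backward_averageP[G2 [d2 E2]].
have [c cx E] := mean_value x a0 (fun y => is_deriveB (d1 y) (d2 y)).
exists c => //; rewrite -E E1 E2 -[(G1 - G2) x]/(G1 x - G2 x) -[(G1 - G2) (x - a)]/(G1 (x - a) - G2 (x - a)).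
by rewrite -mulrBl; congr (_ / _); ring.
Qed.

Lemma backward_average_value a g x : 0 < a -> ramp_like g ->
  exists2 c, x - a <= c <= x & backward_average a g x = g c.
Proof.
by move=> a0 /backward_averageP[G [dG E]]; have [c cx Ec] := mean_value x a0 dG; exists c => //; rewrite E.
Qed.

Lemma backward_average_ramp a g : 0 < a -> ramp_like g -> ramp_like (backward_average a g).
Proof.
move=> a0 rg; have [g0 g1 gl] := rg; split.
- move=> x x0; have [c /andP[_ cx] ->] := backward_average_value x a0 rg.
  by rewrite g0// (le_trans cx).
- by move=> x; have [c _ ->] := backward_average_value x a0 rg.
move=> x y xy; have [G [dG E]] := backward_averageP rg.
have dH (z : R) : is_derive z 1 (fun z => G (z - (x - y)) - G z) (g (z - (x - y)) - g z).
  apply: is_derive_ext (is_deriveB (is_derive_shift_arg (dG (z - (x - y)))) (dG z)) _ _ => //.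
have [c _ Ec] := mean_value x a0 dH.
have -> : backward_average a g y - backward_average a g x = g (c - (x - y)) - g c.
  rewrite -Ec !E -mulrBl; congr (_ / _).
  have -> : x - (x - y) = y by ring.
  have -> : x - a - (x - y) = y - a by ring.
  by ring.
have ccy : c <= c - (x - y) by lra.
have /andP[-> /=] := gl _ _ ccy; lra.
Qed.

Lemma backward_average_derive a g (x : R) : ramp_like g ->
  is_derive x 1 (backward_average a g) (a^-1 * (g x - g (x - a))).
Proof.
move=> /backward_averageP[G [dG E]].
apply: is_derive_ext (is_deriveZ a^-1 (is_deriveB (dG x) (is_derive_shift_arg (dG (x - a))))) _ _ => [y|//].
by rewrite E mulrC.
Qed.

End backward.

Definition ramp (R : realType) (x : R) : R := Num.min (Num.max x 0) 1.

(** The ramp averaged over windows of lengths a n, a n.+1, ..., m of them. *)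
Fixpoint iter_average (R : realType) (a : nat -> R) (n m : nat) : R -> R :=
  if m is m'.+1 then backward_average (a n) (iter_average a n.+1 m') else @ramp R.

(** The infimum is the limit, as averages to the left of a nondecreasing function
decrease it. *)
Definition limit_average (R : realType) (a : nat -> R) (n : nat) (x : R) : R :=
  inf (range (fun m => iter_average a n m x)).

Section limit.
Context (R : realType) (a : nat -> R) (r : R).
Hypothesis a0 : forall i, 0 < a i.
Hypothesis ar : forall n, \sum_(0 <= i < n) a i <= r.
Implicit Types (n m k : nat) (x y z e : R).

Lemma rampP : ramp_like (@ramp R).
Proof.
split => [x x0|x|x y xy]; rewrite /ramp.
- by rewrite max_r// min_l.
- by rewrite ge_min lexx orbT.
- rewrite !minEle !maxEle; repeat case: ifP; lra.
Qed.

Lemma iter_average_ramp n m : ramp_like (iter_average a n m).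
Proof.
elim: m n => [|m IH] n /=; first exact: rampP.
exact: backward_average_ramp.
Qed.

Lemma iter_average_step n m x :
  0 <= iter_average a n m x - iter_average a n m.+1 x <= a (n + m)%N.
Proof.
elim: m n x => [|m IH] n x.
  have [c /andP[c1 c2] E] := backward_average_value x (a0 n) rampP.
  rewrite addn0 /= E; have [_ _ /(_ _ _ c2)] := rampP; lra.
have [c _ E] := backward_average_diff x (a0 n) (iter_average_ramp n.+1 m) (iter_average_ramp n.+1 m.+1).
by rewrite -[iter_average a n m.+1 x]/(backward_average (a n) (iter_average a n.+1 m) x)
  -[iter_average a n m.+2 x]/(backward_average (a n) (iter_average a n.+1 m.+1) x) E addnS -addSn.
Qed.

Lemma iter_average_tail n m k x :
  0 <= iter_average a n m x - iter_average a n (m + k)%N x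
    <= \sum_(0 <= i < n + m + k) a i - \sum_(0 <= i < n + m) a i.
Proof.
elim: k => [|k IH]; first by rewrite !addn0 !subrr lexx.
have := iter_average_step n (m + k) x.
have E : \sum_(0 <= i < (n + m + k).+1) a i = \sum_(0 <= i < n + m + k) a i + a (n + m + k)%N.
  by rewrite big_nat_recr.
rewrite !addnS E addnA; move: IH; lra.
Qed.

Lemma iter_average_lower n m x :
  ramp (x - \sum_(0 <= i < m) a (n + i)%N) <= iter_average a n m x.
Proof.
elim: m n x => [|m IH] n x; first by rewrite big_geq// subr0.
have [c /andP[c1 _] E] := backward_average_value x (a0 n) (iter_average_ramp n.+1 m).
rewrite /= E; apply: le_trans (IH _ _).
have [_ _ rl] := rampP; rewrite -subr_ge0; apply: (proj1 (andP (rl _ _ _))).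
rewrite big_nat_recl//= addn0.
rewrite (eq_bigr (fun i => a (n.+1 + i)%N)); first by lra.
by move=> i _; rewrite addnS addSn.
Qed.

(** Averaging once more over a window of length a i lowers a ramp_like function by at
most a i, so the distance to the limit is at most a tail of the sum. *)
Lemma limit_average_approx n e : 0 < e -> exists m, forall k x, (m <= k)%N ->
  0 <= iter_average a n k x - limit_average a n x <= e.
Proof.
move=> e0.
pose S := [set \sum_(0 <= i < k) a i | k in [set: nat]].
have Ss : has_sup S by split; [exists 0, 0%N => //; rewrite big_geq|exists r => _ [k _ <-]].
have [_ [m _ <-] mS] := sup_adherent e0 Ss.
exists m => k x mk.
have lb : has_lbound (range (fun m => iter_average a n m x)).
  by exists 0 => _ [i _ <-]; apply: ramp_like_ge0; exact: iter_average_ramp.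
apply/andP; split; first by rewrite subr_ge0; apply: ge_inf => //; exists k.
rewrite lerBlDr -lerBlDl; apply: lb_le_inf; first by exists (iter_average a n 0 x), 0%N.
move=> _ [j _ <-].
have [jk|/ltnW kj] := leqP j k.
  have := iter_average_tail n j (k - j) x; rewrite subnKC//; lra.
have := iter_average_tail n k (j - k) x; rewrite subnKC//.
have h1 : \sum_(0 <= i < n + k + (j - k)) a i <= sup S.
  by apply: ub_le_sup; [exact: Ss.2|exists (n + k + (j - k))%N].
have h2 : \sum_(0 <= i < m) a i <= \sum_(0 <= i < n + k) a i.
  rewrite (big_cat_nat (n := m) (p := (n + k)%N))//=; last exact: leq_trans mk (leq_addl _ _).
  by rewrite lerDl; apply: sumr_ge0 => i _; exact: ltW.
lra.
Qed.

Lemma limit_average_ramp n : ramp_like (limit_average a n).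
Proof.
split.
- move=> x x0; apply/eqP; rewrite -normr_le0; apply/ler_addgt0Pr => e e0.
  have [m /(_ m x (leqnn m))] := limit_average_approx n e0.
  have [h _ _] := iter_average_ramp n m; rewrite h// => H.
  by rewrite ler_norml add0r; lra.
- move=> x; apply/ler_addgt0Pr => e e0.
  have [m /(_ m x (leqnn m))] := limit_average_approx n e0.
  have [_ /(_ x) h _] := iter_average_ramp n m; lra.
move=> x y xy; apply/andP; split.
  apply/ler_addgt0Pr => e e0.
  have [m H] := limit_average_approx n e0.
  have := H m x (leqnn m); have := H m y (leqnn m).
  have [_ _ /(_ _ _ xy)] := iter_average_ramp n m; lra.
apply/ler_addgt0Pr => e e0.
have [m H] := limit_average_approx n e0.
have := H m x (leqnn m); have := H m y (leqnn m).
have [_ _ /(_ _ _ xy)] := iter_average_ramp n m; lra.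
Qed.

Lemma limit_averageE n : limit_average a n = backward_average (a n) (limit_average a n.+1).
Proof.
apply/funext => x; apply/eqP; rewrite -subr_eq0 -normr_le0; apply/ler_addgt0Pr => e e0.
have [m1 H1] := limit_average_approx n e0.
have [m2 H2] := limit_average_approx n.+1 e0.
pose m := maxn m1 m2.
have := H1 m.+1 x (leqW (leq_maxl _ _)).
have [c _ E] := backward_average_diff x (a0 n) (iter_average_ramp n.+1 m) (limit_average_ramp n.+1).
have := H2 m c (leq_maxr _ _); rewrite -E /= add0r ler_norml; lra.
Qed.

(** Averages look back by at most the sum of the lengths of the windows: to the right
of 1 + r every iterate still has the value 1 of the ramp. *)
Lemma limit_average_pos : 0 < limit_average a 0 (1 + r).
Proof.
have h0 : (0 : R) < 1 / 2 by lra.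
have [m /(_ m (1 + r) (leqnn m))] := limit_average_approx 0 h0.
have := iter_average_lower 0 m (1 + r).
have -> : \sum_(0 <= i < m) a (0 + i)%N = \sum_(0 <= i < m) a i by [].
have h1 : 1 <= 1 + r - \sum_(0 <= i < m) a i by have := ar m; lra.
rewrite {1}/ramp min_r ?le_max ?h1//; lra.
Qed.

Lemma limit_average_derive n x :
  is_derive x 1 (limit_average a n)
    ((a n)^-1 * (limit_average a n.+1 x - limit_average a n.+1 (x - a n))).
Proof. by rewrite limit_averageE; apply: backward_average_derive; exact: limit_average_ramp. Qed.

End limit.

(** Differentiating the average over a window of length a i produces the difference
quotient of step a i: the derivative of order k of limit_average a 0 is
diff_quot a k applied to limit_average a k. *)
Fixpoint diff_quot (R : realType) (a : nat -> R) (k : nat) (g : R -> R) : R -> R :=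
  if k is k'.+1 then diff_quot a k' (fun x => (a k')^-1 * (g x - g (x - a k'))) else g.

Lemma diff_quot_derive (R : realType) (a : nat -> R) k (g g' : R -> R) :
  (forall x : R, is_derive x 1 g (g' x)) ->
  forall x : R, is_derive x 1 (diff_quot a k g) (diff_quot a k g' x).
Proof.
elim: k g g' => [//|k IH] g g' h; apply: IH => x.
by apply: is_derive_ext (is_deriveZ (a k)^-1 (is_deriveB (h x) (is_derive_shift_arg (h (x - a k))))) _ _ => [y|].
Qed.

Lemma diff_quot_bound (R : realType) (a : nat -> R) k (g : R -> R) C :
  (forall i, 0 < a i) -> (forall x, `|g x| <= C) ->
  forall x, `|diff_quot a k g x| <= C * \prod_(0 <= i < k) (2 / a i).
Proof.
move=> a0; elim: k g C => [|k IH] g C h; first by move=> x; rewrite big_geq// mulr1.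
move=> x; apply: le_trans (IH _ (C * (2 / a k)) _ x) _ => [y|].
  rewrite normrM gtr0_norm ?invr_gt0// mulrA mulrC (@ler_pM2r _ (a k)^-1) ?invr_gt0//.
  by apply: le_trans (ler_normB _ _) _; rewrite mulr_natr mulr2n lerD.
by rewrite big_nat_recr//= -mulrA [2 / _ * _]mulrC.
Qed.

Lemma is_derive_row1 (R : realType) (g : R -> R) (dg c : R) (x : 'rV[R]_1) (i : 'I_1) :
  is_derive (c + x 0 0) 1 g dg ->
  is_derive x (basis_vec i) (fun y : 'rV[R]_1 => g (c + y 0 0)) dg.
Proof.
move=> [d e].
have E : (fun h : R => h^-1 *: (((fun y : 'rV[R]_1 => g (c + y 0 0)) \o shift x) (h *: basis_vec i) - g (c + x 0 0)))
  = (fun h : R => h^-1 *: ((g \o shift (c + x 0 0)) (h *: (1 : R)) - g (c + x 0 0))).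
  apply/funext => h /=; congr (_ *: (g _ - _)).
  by rewrite !mxE !ord1 eqxx mulr1 [h *: _]mulr1; ring.
by apply: DeriveDef; rewrite ?/derivable ?/derive E.
Qed.

Lemma Lp_norm_oo_le (R : realType) (n : nat) (U : set 'rV[R]_n) (g : 'rV[R]_n -> R[i]) (B : R) :
  0 <= B -> (forall x, U x -> Normc.normc (g x) <= B) -> (Lp_norm +oo%E U g <= B%:E)%E.
Proof.
move=> B0 h; rewrite /Lp_norm unlock /Lnorm; case: ifP => _; last by rewrite lee_fin.
apply/ess_sup_inf.ess_supP; apply: aeW => x /=; rewrite patchE; case: ifPn => [|_].
  by rewrite inE => /h; rewrite lee_fin ger0_norm//; case: (g x) => p q; exact: sqrtr_ge0.
by rewrite abse0 lee_fin.
Qed.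

(** By the mean value theorem h k.+1 vanishes at points arbitrarily close to x on its
left, hence at x by continuity. *)
Lemma flat_derivatives (R : realType) (h : nat -> R -> R) (z : R) :
  (forall k (x : R), is_derive x 1 (h k) (h k.+1 x)) ->
  (forall x, x <= z -> h 0%N x = 0) -> forall k x, x <= z -> h k x = 0.
Proof.
move=> dh h0; elim=> [//|k IH] x xz.
apply/eqP; rewrite -normr_le0; apply/ler_addgt0Pr => e e0; rewrite add0r.
have /cvgrPdist_le/(_ e e0) := is_derive_continuous (dh k.+1 x).
case/nbhs_ballP => b /= b0 H.
have b20 : 0 < b / 2 by rewrite divr_gt0.
have [c /andP[c1 c2] E] := mean_value x b20 (dh k).
have := H c; rewrite -E !IH//; last by rewrite lerBlDr (le_trans xz)// lerDl ltW.
rewrite subrr mul0r subr0; apply.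
by rewrite /ball/= ltr_norml; lra.
Qed.

(** The functions h k are moved to the interval (0, 1), the point z going to 1 / 2.
A function on R becomes a complex function of a row of length 1. *)
Lemma quasi_analytic_flat (R : realType) (M : nat -> R) (h : nat -> R -> R) (z : R) :
  quasi_analytic M ->
  (forall k (x : R), is_derive x 1 (h k) (h k.+1 x)) ->
  (forall k x, `|h k x| <= M k) ->
  (forall x, x <= z -> h 0%N x = 0) ->
  h 0%N (z + 1 / 4) = 0.
Proof.
move=> qa dh hM h0.
pose u k := fun x : 'rV[R]_1 => h k (z - 1 / 2 + x 0 0).
have du k x i : is_derive x (basis_vec i) (u k) (u k.+1 x) by exact: is_derive_row1.
have pu k i : partial i (u k) = u k.+1.
  by apply/funext => x; rewrite /partial; have [_ ->] := du k x i.
have p0 i : partial i (fun=> 0 : R) = (fun=> 0) :> ('rV[R]_1 -> R).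
  by apply/funext => x; rewrite /partial derive_cst.
have wu (s : seq 'I_1) : foldr (@partial R 1) (u 0%N) s = u (size s).
  by elim: s => [//|i s /= ->].
have w0 (s : seq 'I_1) : foldr (@partial R 1) (fun=> 0) s = (fun=> 0).
  by elim: s => [//|i s /= ->].
have su : real_smooth (@unit_interval R) (u 0%N).
  move=> s x _; rewrite wu; split=> [|i]; last by have [] := du (size s) x i.
  apply: (@continuous_comp _ _ _ (fun x : 'rV[R]_1 => z - 1 / 2 + x 0 0) (h (size s))).
    by apply: continuousD; [exact: cst_continuous|exact: coord_continuous].
  exact: is_derive_continuous (dh _ _).
have s0 : real_smooth (@unit_interval R) (fun=> 0).
  by move=> s x _; rewrite w0; split=> [|i]; [exact: cst_continuous|exact: derivable_cst].
have mu (beta : 'I_1 -> nat) : real_partial_multi beta (u 0%N) = u (mlength beta).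
  rewrite /real_partial_multi /mlength big_ord1 enum_ordSl.
  rewrite (_ : enum 'I_0 = [::]); last by apply: size0nil; rewrite size_enum_ord.
  by rewrite /=; elim: (beta ord0) => [//|k IH] /=; rewrite IH.
have m0 (beta : 'I_1 -> nat) : real_partial_multi beta (fun=> 0) = (fun=> 0) :> ('rV[R]_1 -> R).
  rewrite /real_partial_multi; elim: (enum _) => [//|i s /= ->].
  by elim: (beta i) => [//|k /= ->].
pose f := fun x => Complex (u 0%N x) 0.
have fM : class_CM M (@unit_interval R) f.
  split=> [|beta]; first exact: (conj su s0).
  apply: Lp_norm_oo_le => [|x _]; first exact: le_trans (hM _ 0).
  by rewrite /partial_multi /= mu m0 /= expr0n addr0 sqrtr_sqr; exact: hM.
have f0 : exists2 x0, @unit_interval R x0 & forall beta : 'I_1 -> nat, partial_multi beta f x0 = 0.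
  exists (const_mx (1 / 2)); first by rewrite /unit_interval /= mxE; lra.
  move=> beta; rewrite /partial_multi /= mu m0 /u mxE.
  by rewrite (flat_derivatives dh h0)//; lra.
have : f (const_mx (3 / 4)) = 0 by apply: qa fM f0 _ _; rewrite /unit_interval /= mxE; lra.
by rewrite /f /u mxE => -[<-]; congr (h _ _); lra.
Qed.

(** If the sums stay below r, take a k = 2 * M k / M k.+1, whose sum converges. The
derivative of order k of limit_average a 0 is bounded by the product of the
2 / a i for i < k, that is by M k / M 0. At the supremum of its zero set this
function is flat, and it is nonzero to the right of that point. *)
Lemma denjoy_carleman (R : realType) (M : nat -> R) (r : R) :
  (forall p, 0 < M p) -> quasi_analytic M ->
  exists n, r <= \sum_(1 <= k < n.+1) M k.-1 / M k.
Proof.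
move=> M0 qa; apply: contrapT => /forallNP nr.
pose a k := 2 * M k / M k.+1.
have a0 k : 0 < a k by rewrite divr_gt0// mulr_gt0.
have ar n : \sum_(0 <= i < n) a i <= 2 * r.
  have /negP := nr n; rewrite -ltNge => /ltW; rewrite big_add1 /=.
  rewrite -(@ler_pM2l _ 2)// => /(le_trans _); apply.
  by rewrite mulr_sumr; apply: ler_sum => i _; rewrite /a mulrA.
pose F := limit_average a.
pose h k x := M 0%N * diff_quot a k (F k) x.
have rF k : ramp_like (F k) by exact: limit_average_ramp ar k.
have dh k (x : R) : is_derive x 1 (h k) (h k.+1 x).
  have H := diff_quot_derive a k (limit_average_derive a0 ar k) x.
  exact: is_derive_ext (is_deriveZ (M 0%N) H) _ _.
have hM k x : `|h k x| <= M k.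
  rewrite normrM gtr0_norm//.
  have B y : `|F k y| <= 1.
    by rewrite ger0_norm ?ramp_like_ge0//; have [_ ->] := rF k.
  apply: le_trans (_ : M 0%N * (1 * \prod_(0 <= i < k) (2 / a i)) <= _).
    by rewrite ler_pM2l//; exact: diff_quot_bound.
  rewrite mul1r; elim: k {B x} => [|k IH]; first by rewrite big_geq// mulr1.
  rewrite big_nat_recr//= (mulrA (M 0%N)).
  have a20 : 0 < 2 / a k by rewrite divr_gt0.
  apply: le_trans (_ : M k * (2 / a k) <= _); first by rewrite ler_pM2r.
  rewrite le_eqVlt; apply/orP; left; apply/eqP; rewrite /a.
  by field; rewrite !gt_eqF.
pose Z := [set x | F 0%N x = 0].
have [F0 F1 Fl] := rF 0%N.
have Fpos : 0 < F 0%N (1 + 2 * r) by exact: limit_average_pos.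
have Zs : has_sup Z.
  split; first by exists 0; rewrite /Z/= F0.
  exists (1 + 2 * r) => x /= Zx; rewrite leNgt; apply/negP => /ltW /Fl.
  rewrite Zx; lra.
have Fz x : x <= sup Z -> F 0%N x = 0.
  move=> xz; apply/eqP; rewrite eq_le ramp_like_ge0// andbT.
  apply/ler_addgt0Pr => e e0; rewrite add0r.
  have [y Zy yz] := sup_adherent e0 Zs.
  have [xy|yx] := leP x y.
    have := Fl _ _ xy; rewrite Zy; lra.
  have := Fl _ _ (ltW yx); rewrite Zy; lra.
have : F 0%N (sup Z + 1 / 4) = 0.
  have := quasi_analytic_flat qa dh hM (z := sup Z).
  rewrite /h /= => /(_ _)/eqP; rewrite mulf_eq0 gt_eqF//= => H; apply/eqP/H.
  by move=> x xz; rewrite Fz// mulr0.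
move=> /(ub_le_sup Zs.2); lra.
Qed.

(** By divergence the set that defines the Bang degree is bounded, so that the degree
is its maximum and the next integer violates the defining inequality. *)
Lemma bang_degree_succ (R : realType) (M : nat -> R) (t r : R) :
  (forall p, 0 < M p) -> quasi_analytic M -> 0 < r ->
  r <= \sum_(1 <= k < (bang_degree t M r).+2 | - ln t < k%:R) M k.-1 / M k.
Proof.
move=> M0 qa r0.
pose b k := M k.-1 / M k.
have b0 k : 0 <= b k by rewrite divr_ge0// ltW.
pose S n := \sum_(1 <= k < n.+1 | - ln t < k%:R) b k.
have Smono m n : (m <= n)%N -> S m <= S n.
  move=> mn; rewrite /S [leRHS](big_cat_nat (n := m.+1))//=.
  by rewrite lerDl sumr_ge0.
have [B rB] : exists B, r <= S B.
  have [k0 k00 k0t] : exists2 k0 : nat, (0 < k0)%N & - ln t < k0%:R.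
    by exists (Num.trunc (- ln t)).+1 => //; exact: truncnS_gt.
  have [n rn] := denjoy_carleman (r + \sum_(1 <= k < k0) b k) M0 qa.
  exists (maxn n k0); have nk := leq_maxl n k0; have kk := leq_maxr n k0.
  have h1 : \sum_(1 <= k < n.+1) b k <= \sum_(1 <= k < (maxn n k0).+1) b k.
    rewrite [leRHS](big_cat_nat (n := n.+1))//=.
    by rewrite lerDl sumr_ge0.
  have h2 : \sum_(1 <= k < (maxn n k0).+1 | ~~ (- ln t < k%:R)) b k <= \sum_(1 <= k < k0) b k.
    rewrite (big_cat_nat (n := k0))//=; last exact: leqW.
    rewrite [X in _ + X]big_nat_cond [X in _ + X]big1 ?addr0; last first.
      by move=> k /andP[/andP[kk0 _] /negP[]]; rewrite (lt_le_trans k0t)// ler_nat.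
    by rewrite big_mkcond; apply: ler_sum => k _; case: ifP.
  move: (le_trans rn h1); rewrite [leRHS](bigID (fun k : nat => - ln t < k%:R))/=.
  by rewrite -/(S _); lra.
have bdd m : bang_set t M r m -> (m <= B)%N.
  move=> mr; rewrite leqNgt; apply/negP => /ltnW/Smono /(le_trans rB).
  by rewrite leNgt => /negP; apply.
pose P := fun n => `[< bang_set t M r n >].
have exP : exists n, P n by exists 0%N; apply/asboolP; rewrite /bang_set/= big_geq.
have bP n : P n -> (n <= B)%N by move=> /asboolP/bdd.
have [N /asboolP PN maxN] := ex_maxnP exP bP.
have [_ max] : bang_set t M r (bang_degree t M r) /\
    forall m, bang_set t M r m -> (m <= bang_degree t M r)%N.
  apply: (@xgetI _ 0%N [set n | bang_set t M r n /\
                    forall m, bang_set t M r m -> (m <= n)%N] N).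
  by split => // m /asboolP; exact: maxN.
by rewrite leNgt; apply/negP => /max; rewrite ltnn.
Qed.

(** * The global estimate for real functions *)

(** There are d ^ j words of length j, so that the weights (2 * d) ^- j leave a
geometric series of ratio 1 / 2. *)
Lemma word_energy (R : realType) (d : nat) (dT : measure_display) (T : measurableType dT)
    (mu : {measure set T -> \bar R}) (h : seq 'I_d -> T -> \bar R) (G : R) :
  (1 <= d)%N -> 0 <= G ->
  (forall s, measurable_fun setT (h s)) -> (forall s y, 0 <= h s y)%E ->
  (forall s, \int[mu]_y h s y <= G%:E)%E ->
  exists F : T -> \bar R, [/\ measurable_fun setT F, forall y, (0 <= F y)%E,
    forall s y, (h s y <= ((2 * d%:R) ^+ size s)%:E * F y)%E &
    (\int[mu]_y F y <= (2 * G)%:E)%E].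
Proof.
move=> d1 G0 mh h0 hG.
have dR : 0 < d%:R :> R by rewrite ltr0n.
pose kap : R := 2 * d%:R; have kap0 : 0 < kap by rewrite mulr_gt0.
pose f j y := (\sum_(s : j.-tuple 'I_d) (kap ^- j)%:E * h s y)%E.
have t0 j (s : seq 'I_d) y : (0 <= (kap ^- j)%:E * h s y)%E.
  by rewrite mule_ge0// lee_fin invr_ge0 exprn_ge0// ltW.
have f0 j y : (0 <= f j y)%E by apply: sume_ge0 => s _.
have mt j (s : seq 'I_d) : measurable_fun setT (fun y => (kap ^- j)%:E * h s y)%E.
  by apply: emeasurable_funM => //; exact: measurable_cst.
have mf j : measurable_fun setT (f j) by apply: emeasurable_sum.
exists (fun y => \sum_(0 <= j <oo) f j y)%E; split.
- apply: ge0_emeasurable_sum => [j y _ _|j _]; [exact: f0|exact: mf].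
- by move=> y; apply: nneseries_ge0.
- move=> s y; have kk : 0 < kap ^+ size s by rewrite exprn_gt0.
  rewrite -(@lee_pmul2l _ (kap ^- size s)%:E) ?lte_fin ?invr_gt0//.
  rewrite muleA -EFinM mulVf ?gt_eqF// mul1e.
  apply: le_trans (nneseries_lim_ge (size s).+1 _); last by move=> j _ _; exact: f0.
  rewrite big_nat_recr//=; apply: le_trans (leeDr _ _); last by apply: sume_ge0.
  by rewrite /f (bigD1 (in_tuple s))//= leeDl// sume_ge0.
rewrite integral_nneseries//.
apply: le_trans (epsilon_trick0 xpredT _); last by rewrite mulr_ge0.
apply: lee_nneseries => [j _ _|j _]; first by apply: integral_ge0.
rewrite ge0_integral_sum//.
apply: le_trans (_ : \sum_(s : j.-tuple 'I_d) (kap ^- j * G)%:E <= _)%E.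
  apply: lee_sum => s _; rewrite ge0_integralZl//; last by rewrite lee_fin invr_ge0 exprn_ge0// ltW.
  by rewrite EFinM lee_wpmul2l// lee_fin invr_ge0 exprn_ge0// ltW.
rewrite sumEFin lee_fin sumr_const card_tuple card_ord -[_ *+ _]mulr_natr natrX.
rewrite le_eqVlt; apply/orP; left; apply/eqP; rewrite /kap exprMn natrX exprS; field.
by rewrite !expf_neq0// gt_eqF.
Qed.

Lemma kernel_integral (R : realType) (d : nat) (rho : 'rV[R]_d -> R) (lam : R) (F : 'rV[R]_d -> \bar R) x :
  (forall x, 0 < rho x) -> measurable_fun setT F -> (forall y, 0 <= F y)%E ->
  (\int[@borel_lebesgue R d]_y ((kernel rho lam (x, y))%:E * F y) =
   (rho x ^- d)%:E * \int[@borel_lebesgue R d]_(y in euclidean_ball x (lam * rho x)) F y)%E.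
Proof.
move=> rho0 mF F0.
rewrite [in RHS]integral_mkcond -ge0_integralZl//=.
- apply: eq_integral => y _; rewrite /kernel patchE/=; case: ifPn => h.
    by rewrite mem_set.
  by rewrite memNset ?mul0e ?mule0//; exact/negP.
- apply/measurable_restrict => //; first exact: measurable_eball.
  exact: measurable_funTS.
- by move=> y _; apply: erestrict_ge0 => z _.
- by rewrite lee_fin invr_ge0 exprn_ge0// ltW.
Qed.

(** At each x, either the hypothesis of local_bound on the derivatives holds, or it
fails for some word and then the mean of F on the ball dominates u x ^+ 2. So
u x ^+ 2 is at most the sum of both bounds, which are integrated by averaging,
with the radii rho x and lam * rho x respectively. *)
Lemma global_bound (R : realType) (d : nat) (u rho : 'rV[R]_d -> R) (L : R) (M : nat -> R)
    (v gam e1 G : R) (W : set 'rV[R]_d) (n k1 : nat) :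
  (1 <= d)%N -> real_smooth setT u ->
  (forall z, 0 < rho z) -> 0 <= L < 1 ->
  (forall z z', `|rho z - rho z'| <= L * euclidean_norm (z - z')) ->
  (forall i, 0 < M i) -> (forall i j, (i <= j)%N -> M i <= M j) -> log_convex M ->
  0 < v -> borel_lebesgue (euclidean_ball (0 : 'rV[R]_d) 1) = v%:E ->
  0 < gam <= 1 -> measurable W ->
  (forall x, (gam * (rho x ^+ d * v))%:E <= borel_lebesgue (W `&` euclidean_ball x (rho x)))%E ->
  0 < e1 -> 0 <= G ->
  let lam := 1 + (1 - L) / 2 in let c := 1 - L * lam in
  let eta := (1 - L) / (2 * d%:R) in let kap : R := 2 * d%:R in
  let q := kap / c ^+ 2 in let P := (4 * kap / (eta * c ^+ 2)) ^+ d in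
  (forall s : seq 'I_d, (\int[@borel_lebesgue R d]_z
     ((rho z ^+ size s * foldr partial u s z) ^+ 2)%:E <= (M (size s) ^+ 2 * G)%:E)%E) ->
  expR (- k1%:R) * (P * M d) < e1 ->
  (0 < n)%N -> (k1 <= n.+1)%N ->
  expR 1 * (d%:R * q) <= \sum_(k1 <= i < n.+1) M (i + d)%N / M (i + d).+1 ->
  (\int[@borel_lebesgue R d]_z (u z ^+ 2)%:E <=
    ((2 / (1 - L)) ^+ d * v * (32 * expR 1 ^+ 2 * (4 * expR 2 / (gam ^+ 2 / (20 * d%:R))) ^+ n ^+ 2 / (gam * v)))%:E *
      \int[@borel_lebesgue R d]_(z in W) (u z ^+ 2)%:E
    + (2 * ((2 * lam / c) ^+ d * v) * (e1 ^+ 2 * G))%:E)%E.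
Proof.
move=> d1 su rho0 L01 rhoL M0 Mmon lc v0 vE gam01 mW thickW e10 G0 lam c eta kap q P HG ke1 n0 k1n sumge.
have [L0 L1] : 0 <= L /\ L < 1 by case/andP: L01.
have [gam0 _] := andP gam01.
have lam0 : 0 < lam by rewrite /lam; lra.
have Llam : L * lam < 1 by rewrite /lam; nra.
have kap0 : 0 < kap by rewrite /kap mulr_gt0// ltr0n.
have [D DE] : exists D, D = 32 * expR 1 ^+ 2 * (4 * expR 2 / (gam ^+ 2 / (20 * d%:R))) ^+ n ^+ 2 / (gam * v).
  by eexists.
rewrite -DE.
have D0 : 0 <= D.
  rewrite DE; apply: divr_ge0; last by rewrite mulr_ge0 ?ltW.
  by rewrite mulr_ge0 ?sqr_ge0// mulr_ge0 ?sqr_ge0.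
have cu s : continuous (foldr partial u s) by exact: smooth_continuous.
have crho : continuous rho := rho_continuous L0 rhoL.
pose h s z := ((M (size s) ^- 2)%:E * ((rho z ^+ size s * foldr partial u s z) ^+ 2)%:E)%E.
have mw s : measurable_fun setT (fun z => ((rho z ^+ size s * foldr partial u s z) ^+ 2)%:E).
  by apply/measurable_EFinP; apply: continuous_measurable_row; apply/contX/contM => //; exact: contX.
have M2 j : 0 < M j ^+ 2 by rewrite exprn_gt0.
have [] := @word_energy R d _ _ (@borel_lebesgue R d) h G d1 G0.
- by move=> s; apply: emeasurable_funM; [exact: measurable_cst|exact: mw].
- by move=> s y; rewrite mule_ge0// lee_fin ?sqr_ge0// invr_ge0 ltW.
- move=> s; rewrite ge0_integralZl//=; first last.
  + by rewrite lee_fin invr_ge0 ltW.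
  + by move=> z _; rewrite lee_fin sqr_ge0.
  rewrite -(@lee_pmul2l _ (M (size s) ^+ 2)%:E) ?lte_fin//.
  rewrite muleA -!EFinM divff ?gt_eqF// mul1e; exact: HG.
move=> F [mF F0 hF FG].
pose g := (fun z => (u z ^+ 2)%:E) \_ W.
have mu2 : measurable_fun setT (fun z : 'rV[R]_d => (u z ^+ 2)%:E).
  by apply/measurable_EFinP; apply: continuous_measurable_row; apply: contX; exact: (cu [::]).
have mg : measurable_fun setT g.
  by apply/(measurable_restrictT _ mW); exact: measurable_funTS.
have g0 z : (0 <= g z)%E by apply: erestrict_ge0 => y _; rewrite lee_fin sqr_ge0.
have gB B : measurable B -> (\int[@borel_lebesgue R d]_(z in B) g z = \int[@borel_lebesgue R d]_(z in W `&` B) (u z ^+ 2)%:E)%E.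
  by move=> mB; rewrite setIC integral_mkcondr.
have rd x : 0 < rho x ^+ d by rewrite exprn_gt0.
have pointwise x : ((u x ^+ 2)%:E <=
    D%:E * \int[@borel_lebesgue R d]_y ((kernel rho 1 (x, y))%:E * g y)
    + (e1 ^+ 2)%:E * \int[@borel_lebesgue R d]_y ((kernel rho lam (x, y))%:E * F y))%E.
  rewrite !kernel_integral// mul1r gB; last exact: measurable_eball.
  set I := integral _ _ _; set J := integral _ _ _.
  have I0 : (0 <= I)%E by apply: integral_ge0 => z _; rewrite lee_fin sqr_ge0.
  have J0 : (0 <= J)%E by exact: integral_ge0.
  have -> : (u x ^+ 2)%:E = ((rho x ^- d)%:E * (rho x ^+ d * u x ^+ 2)%:E)%E.
    by rewrite -EFinM mulrA mulVf ?gt_eqF// mul1r.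
  rewrite muleCA [X in (_ + X)%E]muleCA -ge0_muleDr ?mule_ge0 ?lee_fin ?sqr_ge0//.
  rewrite lee_pmul2l ?lte_fin ?invr_gt0//.
  have [HQ|] := pselect (forall s' : seq 'I_d, (\int[@borel_lebesgue R d]_(z in euclidean_ball x (lam * rho x))
     ((rho z ^+ size s' * foldr partial u s' z) ^+ 2)%:E <=
     (kap ^+ size s' * M (size s') ^+ 2 * (rho x ^+ d * u x ^+ 2 / e1 ^+ 2))%:E)%E).
    have := local_bound d1 su rho0 L01 rhoL M0 Mmon lc v0 vE gam01 mW (thickW x) e10 HQ ke1 n0 k1n sumge.
    by rewrite -DE => /le_trans; apply; rewrite leeDl// mule_ge0// lee_fin sqr_ge0.
  move=> /existsNP[s /negP]; rewrite -ltNge.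
  have jJ : (\int[@borel_lebesgue R d]_(z in euclidean_ball x (lam * rho x))
      ((rho z ^+ size s * foldr partial u s z) ^+ 2)%:E <= (kap ^+ size s * M (size s) ^+ 2)%:E * J)%E.
    rewrite -ge0_integralZl//; first last.
    + by rewrite lee_fin mulr_ge0 ?exprn_ge0// ltW.
    + exact: measurable_funTS.
    + exact: measurable_eball.
    apply: ge0_le_integral => //.
    + exact: measurable_eball.
    + by move=> z _; rewrite lee_fin sqr_ge0.
    + by apply: measurable_funTS; exact: mw.
    + by apply: measurable_funTS; apply: emeasurable_funM; [exact: measurable_cst|].
    move=> z _.
    have -> : ((rho z ^+ size s * foldr partial u s z) ^+ 2)%:E = ((M (size s) ^+ 2)%:E * h s z)%E.
      by rewrite /h -!EFinM mulrA divff ?gt_eqF// mul1r.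
    have -> : (kap ^+ size s * M (size s) ^+ 2)%:E = ((M (size s) ^+ 2)%:E * (kap ^+ size s)%:E)%E.
      by rewrite -EFinM mulrC.
    by rewrite -muleA; apply: lee_wpmul2l; [rewrite lee_fin ltW|exact: hF].
  have km : 0 < kap ^+ size s * M (size s) ^+ 2 by rewrite mulr_gt0// exprn_gt0.
  move=> /lt_le_trans/(_ jJ); rewrite EFinM lte_pmul2l ?lte_fin// => uJ.
  apply: (@le_trans _ _ ((e1 ^+ 2)%:E * J)%E); last by rewrite leeDr// mule_ge0.
  rewrite -(@lee_pmul2l _ (e1 ^- 2)%:E) ?lte_fin ?invr_gt0 ?exprn_gt0// muleA -[X in (_ <= X * _)%E]EFinM mulVf ?gt_eqF ?exprn_gt0//.
  by rewrite mul1e -EFinM mulrC ltW.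
have ave1 := averaging rho0 L0 rhoL ltr01 _ v0 vE mg g0.
have aveF := averaging rho0 L0 rhoL lam0 Llam v0 vE mF F0.
have mA lam' H : measurable_fun setT H -> (forall z, 0 <= H z)%E ->
    measurable_fun setT (fun x => \int[@borel_lebesgue R d]_y ((kernel rho lam' (x, y))%:E * H y))%E.
  move=> mH H0.
  apply: (measurable_fun_fubini_tonelli_F (fun p => (kernel rho lam' p)%:E * H p.2)%E).
    exact: (measurable_kernel_mul lam' rho0 L0 rhoL).
  by move=> p; rewrite mule_ge0// lee_fin kernel_ge0.
have A0 lam' H x : (forall z, 0 <= H z)%E ->
    (0 <= \int[@borel_lebesgue R d]_y ((kernel rho lam' (x, y))%:E * H y))%E.
  by move=> H0; apply: integral_ge0 => y _; rewrite mule_ge0// lee_fin kernel_ge0.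
apply: (@le_trans _ _ (\int[@borel_lebesgue R d]_x
    (D%:E * \int[@borel_lebesgue R d]_y ((kernel rho 1 (x, y))%:E * g y)
    + (e1 ^+ 2)%:E * \int[@borel_lebesgue R d]_y ((kernel rho lam (x, y))%:E * F y))))%E.
  apply: ge0_le_integral => //.
  - by move=> z _; rewrite lee_fin sqr_ge0.
  - by apply: emeasurable_funD; apply: emeasurable_funM; [exact: measurable_cst|exact: mA|exact: measurable_cst|exact: mA].
have e12 : 0 <= e1 ^+ 2 by exact: sqr_ge0.
rewrite ge0_integralD//; first last.
- by apply: emeasurable_funM; [exact: measurable_cst|exact: mA].
- by move=> x _; rewrite mule_ge0// A0.
- by apply: emeasurable_funM; [exact: measurable_cst|exact: mA].
- by move=> x _; rewrite mule_ge0// A0.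
rewrite !ge0_integralZl//; first last.
- by move=> x _; exact: A0.
- exact: mA.
- by move=> x _; exact: A0.
- exact: mA.
apply: leeD.
  have {}ave1 := ave1 _; rewrite !mulr1 in ave1.
  rewrite [in leRHS]mulrC EFinM -muleA lee_wpmul2l//.
  by apply: le_trans (ave1 L1) _; rewrite gB// setIT.
rewrite (_ : 2 * _ * _ = e1 ^+ 2 * ((2 * lam / c) ^+ d * v * (2 * G))); last by ring.
have C0 : 0 <= (2 * lam / c) ^+ d * v.
  apply: mulr_ge0; last exact: ltW.
  by apply/exprn_ge0/ltW; rewrite divr_gt0 ?mulr_gt0 ?subr_gt0.
rewrite [leRHS]EFinM; apply: lee_wpmul2l; first by rewrite lee_fin.
apply: le_trans aveF _; rewrite [leRHS]EFinM.
by apply: lee_wpmul2l; first rewrite lee_fin.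
Qed.

(** As Ga >= 4 * expR 4, the base 80 * expR 2 * dR / gam ^+ 2 of the left-hand side
is at most the square of 2 * dR / gam * Ga. *)
Lemma concentration_power (R : realType) (dR gam Ga : R) (n n0 : nat) :
  1 <= dR -> 0 < gam <= 1 -> 4 * expR 4 <= Ga -> (n <= n0)%N ->
  (4 * expR 2 / (gam ^+ 2 / (20 * dR))) ^+ n ^+ 2 <= (2 * dR / gam * Ga) ^+ (4 * n0).
Proof.
move=> d1 /andP[gam0 gam1] Ga4 nn.
have nn4 : (2 * n * 2 <= 4 * n0)%N by lia.
have d0 : 0 < dR by lra.
have E2 : 2 <= expR 1 :> R by have := expR_ge1Dx (1 : R); lra.
have E2E : expR 2 = expR 1 ^+ 2 :> R by rewrite -expRM_natl mulr1.
have E4E : expR 4 = expR 1 ^+ 4 :> R by rewrite -expRM_natl mulr1.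
rewrite E2E; move: Ga4; rewrite E4E; move: (expR 1) E2 => E E2 Ga4 {E2E E4E}.
have [X XE] : exists X, X = 2 * dR / gam * Ga by eexists.
rewrite -XE.
have X0 : 8 * dR * E ^+ 4 / gam <= X.
  rewrite XE (_ : _ / gam = 2 * dR / gam * (4 * E ^+ 4)); last by field; rewrite gt_eqF.
  by rewrite ler_pM2l// divr_gt0// mulr_gt0.
have E1 k : 1 <= E ^+ k by apply: exprn_ege1; lra.
have E0 k : 0 <= E ^+ k by exact: le_trans ler01 (E1 k).
have X1 : 1 <= X.
  apply: le_trans X0; rewrite ler_pdivlMr// mul1r.
  have := E1 4%N; move: (E ^+ 4) => T T1.
  have : 8 <= 8 * dR * T by rewrite -mulrA ler_peMr// mulr_ege1.
  lra.
have Z1 : 4 * E ^+ 2 / (gam ^+ 2 / (20 * dR)) <= X ^+ 2.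
  have Y0 : 0 <= 8 * dR * E ^+ 4 / gam.
    by rewrite divr_ge0 ?(ltW gam0)// mulr_ge0 ?E0// mulr_ge0// ltW.
  apply: (@le_trans _ _ ((8 * dR * E ^+ 4 / gam) ^+ 2)); last first.
    by rewrite ler_sqr ?nnegrE// (le_trans Y0).
  rewrite (_ : 4 * E ^+ 2 / _ = (80 * dR * E ^+ 2) / gam ^+ 2); last by field; rewrite !gt_eqF.
  rewrite expr_div_n ler_pM2r ?invr_gt0 ?exprn_gt0//.
  have h1 : 80 <= 64 * dR * E ^+ 6.
    have h2 : 4 <= E ^+ 6 * 1.
      rewrite mulr1 (exprD E 2 4); have := E1 4%N.
      have : 4 <= E ^+ 2 by nra.
      nra.
    have : E ^+ 6 <= dR * E ^+ 6 by rewrite ler_peMl// E0.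
    lra.
  rewrite (_ : (8 * dR * E ^+ 4) ^+ 2 = (dR * E ^+ 2) * (64 * dR * E ^+ 6)); last by ring.
  rewrite (_ : 80 * dR * E ^+ 2 = (dR * E ^+ 2) * 80); last by ring.
  by apply: ler_wpM2l => //; apply: mulr_ge0 => //; exact: ltW.
have Z0 : 0 <= 4 * E ^+ 2 / (gam ^+ 2 / (20 * dR)).
  apply: divr_ge0; first exact: mulr_ge0.
  by apply: divr_ge0; [exact: sqr_ge0|apply: mulr_ge0 => //; exact: ltW].
apply: (@le_trans _ _ ((X ^+ 2) ^+ n ^+ 2)).
  rewrite ler_sqr ?nnegrE; first by rewrite lerXn2r ?nnegrE// sqr_ge0.
    by apply: exprn_ge0.
  by apply/exprn_ge0/sqr_ge0.
by rewrite -!exprM; apply: ler_weXn2l => //; move: nn4; clear; lia.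
Qed.

Lemma sup_ge0 (R : realType) (S : set R) : (forall x, S x -> 0 <= x) -> 0 <= sup S.
Proof.
move=> S0; have [hS|/sup_out ->//] := pselect (has_sup S).
by have [[x Sx] ubS] := hS; apply: le_trans (S0 _ Sx) _; exact: ub_le_sup.
Qed.

Lemma Gamma_seq_ge (R : realType) (M : nat -> R) p :
  (forall i, 0 < M i) -> log_convex M -> 4 * expR 4 <= Gamma_seq M p.
Proof.
move=> M0 lc; rewrite /Gamma_seq ler_pM2l// ler_expR lerDl mulr_ge0//.
apply: sup_ge0 => _ [j /andP[j1 _] <-]; rewrite mulr_ge0// subr_ge0.
by rewrite ler_pdivlMr ?exprn_gt0// mul1r lc.
Qed.

(** The Bang degree concerns the ratios M k.-1 / M k with k > - ln t, the local
estimate the ratios M (i + d) / M (i + d).+1 with i >= k1. The summand d.+1 in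
the hypothesis on t makes room for the shift k = i + d + 1. *)
Lemma bang_degree_tail (R : realType) (M : nat -> R) (d : nat) (y t r : R) :
  (forall p, 0 < M p) -> quasi_analytic M -> 0 < r -> 0 <= y ->
  y + d.+1%:R <= - ln t ->
  exists k1 : nat, [/\ y < k1%:R, (0 < bang_degree t M r - d)%N,
      (k1 <= (bang_degree t M r - d).+1)%N &
    r <= \sum_(k1 <= i < (bang_degree t M r - d).+1) M (i + d)%N / M (i + d).+1].
Proof.
move=> M0 qa r0 y0 yt; set n := bang_degree _ _ _.
exists (Num.trunc y).+1; set k1 := (Num.trunc y).+1.
have ky : k1%:R <= y + 1 by rewrite /k1 -natr1 lerD2r truncn_le.
have rs := bang_degree_succ t M0 qa r0; rewrite -/n in rs.
have b0 k : 0 <= M k.-1 / M k by rewrite divr_ge0// ltW.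
have kP k : - ln t < k%:R -> (k1 + d < k)%N.
  by move=> tk; rewrite -(ltr_nat R) natrD; move: yt; rewrite -natr1; lra.
have [kn|nk] := leqP (k1 + d) n; last first.
  move: rs; rewrite big_nat_cond big1; first by rewrite leNgt r0.
  by move=> k /andP[/andP[_ kn] /kP kk]; lia.
have k10 : (0 < k1)%N by [].
split; [exact: truncnS_gt|lia|lia|].
apply: le_trans rs _.
rewrite big_mkcond (@big_cat_nat _ _ _ (k1 + d).+1)//=; last lia.
rewrite [X in X + _]big_nat_cond [X in X + _]big1 ?add0r; last first.
  by move=> k /andP[/andP[_ kk] _]; case: ifP => // /kP; lia.
rewrite -addnS big_addn (_ : (n.+2 - d.+1)%N = (n - d).+1); last lia.
apply: ler_sum => i _; case: ifP => _; first by rewrite addnS.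
by rewrite divr_ge0// ltW.
Qed.

(** The choice e1 = sigma / (2 * A) makes the error of global_bound at most
sigma ^+ 2 / 2 * G, since the constant of averaging is at most A ^+ 2. The
corresponding k1 is just above y = ln (P * M d / e1), and the constant in t0 is
made so that - ln t0 = y + d.+1. *)
Lemma real_bound (R : realType) (d : nat) (u rho : 'rV[R]_d -> R) (L : R) (M : nat -> R)
    (v gam sigma G : R) (W : set 'rV[R]_d) :
  (1 <= d)%N -> real_smooth setT u ->
  (forall z, 0 < rho z) -> 0 <= L < 1 ->
  (forall z z', `|rho z - rho z'| <= L * euclidean_norm (z - z')) ->
  (forall i, 0 < M i) -> (forall i j, (i <= j)%N -> M i <= M j) -> log_convex M ->
  quasi_analytic M ->
  0 < v -> borel_lebesgue (euclidean_ball (0 : 'rV[R]_d) 1) = v%:E ->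
  0 < gam <= 1 -> measurable W ->
  (forall x, (gam * (rho x ^+ d * v))%:E <= borel_lebesgue (W `&` euclidean_ball x (rho x)))%E ->
  0 < sigma <= M d -> 0 <= G ->
  (forall s : seq 'I_d, (\int[@borel_lebesgue R d]_z
     ((rho z ^+ size s * foldr partial u s z) ^+ 2)%:E <= (M (size s) ^+ 2 * G)%:E)%E) ->
  let lam := 1 + (1 - L) / 2 in let c := 1 - L * lam in
  let eta := (1 - L) / (2 * d%:R) in let kap : R := 2 * d%:R in
  let q := kap / c ^+ 2 in let P := (4 * kap / (eta * c ^+ 2)) ^+ d in
  let A := 1 + (2 * lam / c) ^+ d * v in
  let t0 := sigma / (2 * A * P * expR d.+1%:R * M d) in
  let n0 := bang_degree t0 M (expR 1 * (d%:R * q)) in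
  forall K', (2 / (1 - L)) ^+ d * v * (32 * expR 1 ^+ 2 / (gam * v)) <= K' ->
  (\int[@borel_lebesgue R d]_z (u z ^+ 2)%:E <=
    (C_const d gam K' M n0)%:E * \int[@borel_lebesgue R d]_(z in W) (u z ^+ 2)%:E
    + (sigma ^+ 2 / 2 * G)%:E)%E.
Proof.
move=> d1 su rho0 L01 rhoL M0 Mmon lc qa v0 vE gam01 mW thickW /andP[s0 sM] G0 HG.
move=> lam c eta kap q P A t0 n0 K' K'ge.
have [L0 L1] : 0 <= L /\ L < 1 by case/andP: L01.
have [gam0 gam1] := andP gam01.
have dR : 0 < d%:R :> R by rewrite ltr0n.
have dR1 : 1 <= d%:R :> R by rewrite ler1n.
have L1' : 0 < 1 - L by rewrite subr_gt0.
have [q1 P1 A1] : [/\ 1 <= q, 1 <= P & 1 <= A] by exact: constants_ge1.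
have q0 : 0 < q by exact: lt_le_trans q1.
pose Cov := (2 * lam / c) ^+ d * v.
have Cov0 : 0 <= Cov by rewrite -(lerD2l 1) addr0.
pose e1 := sigma / (2 * A).
have A0 : 0 < A by exact: lt_le_trans A1.
have e10 : 0 < e1 by rewrite divr_gt0// mulr_gt0.
have P0 : 0 < P by apply: lt_le_trans P1.
pose y := ln (P * M d / e1).
have PMe : 0 < P * M d / e1 by rewrite divr_gt0// mulr_gt0.
have e1s : e1 <= sigma.
  by rewrite /e1 ler_pdivrMr ?mulr_gt0// ler_peMr ?ltW//; lra.
have y0 : 0 <= y.
  apply: ln_ge0; rewrite ler_pdivlMr// mul1r.
  by apply: le_trans e1s (le_trans sM _); rewrite ler_peMl// ltW.
have yt : y + d.+1%:R <= - ln t0.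
  rewrite -(expRK d.+1%:R) -lnM ?posrE ?expR_gt0// -lnV ?posrE; last first.
    by apply: divr_gt0 => //; do 3! apply: mulr_gt0 => //; rewrite ?expR_gt0// mulr_gt0.
  rewrite /t0 invfM invrK /e1 invfM invrK le_eqVlt; apply/orP; left; apply/eqP; congr ln.
  by rewrite mulrC; ring.
have r0 : 0 < expR 1 * (d%:R * q) := mulr_gt0 (expR_gt0 1) (mulr_gt0 dR q0).
have [k1 [yk nd0 k1n sumge]] := bang_degree_tail M0 qa r0 y0 yt.
rewrite -/n0 in nd0 k1n sumge.
have ke1 : expR (- k1%:R) * (P * M d) < e1.
  have : P * M d / e1 < expR k1%:R by rewrite -(lnK (x := P * M d / e1)) ?posrE// ltr_expR.
  by rewrite ltr_pdivrMr// => H; rewrite expRN mulrC ltr_pdivrMr ?expR_gt0// [ltRHS]mulrC.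
have := global_bound d1 su rho0 L01 rhoL M0 Mmon lc v0 vE gam01 mW thickW e10 G0 HG ke1 nd0 k1n sumge.
move=> /le_trans; apply; apply: leeD.
  apply: lee_wpmul2r; first by apply: integral_ge0 => z _; rewrite lee_fin sqr_ge0.
  rewrite lee_fin /C_const.
  have := Gamma_seq_ge (2 * n0) M0 lc; set Ga := Gamma_seq _ _ => Ga4.
  have Z := concentration_power dR1 gam01 Ga4 (leq_subr d n0).
  have C0 : 0 <= (2 / (1 - L)) ^+ d * v * (32 * expR 1 ^+ 2 / (gam * v)).
    apply: mulr_ge0; first by apply: mulr_ge0; [apply/exprn_ge0/divr_ge0; rewrite ?ltW|exact: ltW].
    by apply: divr_ge0; apply: mulr_ge0; rewrite ?sqr_ge0 ?ltW.
  apply: le_trans (ler_pM C0 (sqr_ge0 _) K'ge Z).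
  have sw (a b z w : R) : a * (b * z / w) = a * (b / w) * z.
    by rewrite -[RHS]mulrA [b / w * z]mulrAC.
  by rewrite sw.
rewrite lee_fin -/lam -/c -/Cov mulrA ler_wpM2r//.
rewrite /e1 expr_div_n exprMn mulrA ler_pdivrMr; last by rewrite mulr_gt0 ?exprn_gt0.
have AC : Cov <= A ^+ 2 by rewrite /A -/Cov; nra.
have := sqr_ge0 sigma; move: (sigma ^+ 2) (A ^+ 2) AC => S T AC S0; nra.
Qed.

(** * Complex functions *)

Lemma poweR_sqr (R : realType) (x : \bar R) : (0 <= x)%E -> (x `^ 2 = x ^+ 2)%E.
Proof.
case: x => [r| |]// r0; last by rewrite poweRyr// expe2 mulyy.
by rewrite poweR_EFin powR_mulrn// EFin_expe.
Qed.

Lemma Lp_norm2_sqr (R : realType) (n : nat) (A : set 'rV[R]_n) (f : 'rV[R]_n -> R[i]) :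
  lebesgue_measurable A ->
  (Lp_norm 2%:E A f ^+ 2 =
    \int[@lebesgue R n]_(x in A) (complex.Re (f x) ^+ 2 + complex.Im (f x) ^+ 2)%:E)%E.
Proof.
move=> mA; rewrite -poweR_sqr ?Lnorm_ge0// /Lp_norm poweR_Lnorm//.
rewrite [RHS]integral_mkcond; apply: eq_integral => x _.
rewrite !patchE; case: ifPn => _; last by rewrite abse0 poweR0r.
case: (f x) => a b /=; rewrite ger0_norm ?sqrtr_ge0// powR_mulrn ?sqrtr_ge0//.
by rewrite sqr_sqrtr// addr_ge0 ?sqr_ge0.
Qed.

(** Only the terms of the norm with k = |beta| enter; they contribute
N k k, the diagonal sequence. *)
Lemma GS_word_bound (R : realType) (d : nat) (N : nat -> nat -> R) (rho : 'rV[R]_d -> R)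
    (f : 'rV[R]_d -> R[i]) (w : 'rV[R]_d -> R) :
  (forall p q, 0 < N p q) -> continuous rho -> GS N rho f ->
  real_smooth setT w ->
  (forall s x, foldr partial w s x ^+ 2 <= foldr partial (fun x => complex.Re (f x)) s x ^+ 2
     + foldr partial (fun x => complex.Im (f x)) s x ^+ 2) ->
  forall s : seq 'I_d, (\int[@borel_lebesgue R d]_z
     ((rho z ^+ size s * foldr partial w s z) ^+ 2)%:E <=
     (N (size s) (size s) ^+ 2 * fine (GS_norm N rho f) ^+ 2)%:E)%E.
Proof.
move=> N0 crho [[su sv] Goo] sw wf s.
pose beta := fun i : 'I_d => count_mem i s.
set k := size s; set g := weighted_partial rho k beta f.
have nG : (Lp_norm 2%:E setT g <= (N k k)%:E * GS_norm N rho f)%E.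
  rewrite -lee_pdivrMl ?N0//.
  apply: ereal_sup_ubound; exists (k, beta) => //=.
  by rewrite mlength_count muleC.
have Gge0 : (0 <= GS_norm N rho f)%E.
  rewrite -(@lee_pmul2l _ (N k k)%:E) ?lte_fin// mule0.
  by apply: le_trans nG; exact: Lnorm_ge0.
have GE : GS_norm N rho f = (fine (GS_norm N rho f))%:E by rewrite fineK// ge0_fin_numE.
have gE z : complex.Re (g z) ^+ 2 + complex.Im (g z) ^+ 2 =
    (rho z ^+ k * foldr partial (fun x => complex.Re (f x)) s z) ^+ 2 +
    (rho z ^+ k * foldr partial (fun x => complex.Im (f x)) s z) ^+ 2.
  rewrite /g /weighted_partial /partial_multi !smooth_multi//=.
  by rewrite !mul0r subr0 addr0.
have mg : measurable_fun setT (fun z => (complex.Re (g z) ^+ 2 + complex.Im (g z) ^+ 2)%:E).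
  apply/measurable_EFinP; apply: continuous_measurable_row.
  under eq_fun => z do rewrite gE.
  by apply: contD; apply/contX/contM;
    [exact: contX|exact: smooth_continuous|exact: contX|exact: smooth_continuous].
apply: (@le_trans _ _ (Lp_norm 2%:E setT g ^+ 2)%E).
  rewrite Lp_norm2_sqr; last exact: measurableT.
  rewrite integral_lebesgueE//; last by move=> z; rewrite lee_fin addr_ge0 ?sqr_ge0.
  apply: ge0_le_integral => //.
  - by move=> z _; rewrite lee_fin sqr_ge0.
  - apply/measurable_EFinP; apply: continuous_measurable_row; apply/contX/contM; first exact: contX.
    exact: smooth_continuous.
  move=> z _; rewrite lee_fin gE !exprMn -mulrDr ler_wpM2l ?sqr_ge0//; exact: wf.
rewrite -exprMn EFin_expe lee_sqr ?Lnorm_ge0//; last first.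
  by rewrite lee_fin mulr_ge0 ?fine_ge0// ltW.
by rewrite EFinM -GE.
Qed.

Lemma smooth_sqr_measurable (R : realType) (d : nat) (w : 'rV[R]_d -> R) :
  real_smooth setT w -> measurable_fun setT (fun z => (w z ^+ 2)%:E).
Proof.
move=> sw; apply/measurable_EFinP; apply: continuous_measurable_row; apply: contX.
exact: (@smooth_continuous R d w sw [::]).
Qed.

Lemma smooth_normc_measurable (R : realType) (d : nat) (f : 'rV[R]_d -> R[i]) :
  smooth setT f ->
  measurable_fun setT (fun z => (complex.Re (f z) ^+ 2 + complex.Im (f z) ^+ 2)%:E).
Proof.
move=> [su sv]; under eq_fun => z do rewrite EFinD.
apply: emeasurable_funD; [exact: (smooth_sqr_measurable su)|exact: (smooth_sqr_measurable sv)].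
Qed.

Lemma Lp_norm2_split (R : realType) (d : nat) (D : set 'rV[R]_d) (f : 'rV[R]_d -> R[i]) :
  measurable D -> smooth setT f ->
  (Lp_norm 2%:E D f ^+ 2 = \int[@borel_lebesgue R d]_(x in D) (complex.Re (f x) ^+ 2)%:E
      + \int[@borel_lebesgue R d]_(x in D) (complex.Im (f x) ^+ 2)%:E)%E.
Proof.
move=> mD sf; have [su sv] := sf.
rewrite Lp_norm2_sqr; last exact: borel_lebesgue_measurable.
rewrite (integral_lebesgueE mD (smooth_normc_measurable sf)); last first.
  by move=> z; rewrite lee_fin addr_ge0 ?sqr_ge0.
under eq_integral => z _ do rewrite EFinD.
apply: ge0_integralD => //.
- by move=> z _; rewrite lee_fin sqr_ge0.
- exact: measurable_funTS (smooth_sqr_measurable su).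
- by move=> z _; rewrite lee_fin sqr_ge0.
- exact: measurable_funTS (smooth_sqr_measurable sv).
Qed.

Lemma Lp_norm2_subset (R : realType) (d : nat) (W omega : set 'rV[R]_d) (f : 'rV[R]_d -> R[i]) :
  measurable W -> lebesgue_measurable omega -> W `<=` omega -> smooth setT f ->
  (Lp_norm 2%:E W f ^+ 2 <= Lp_norm 2%:E omega f ^+ 2)%E.
Proof.
move=> mW mo Wo sf; have mWL := borel_lebesgue_measurable mW.
rewrite (Lp_norm2_sqr _ mWL) (Lp_norm2_sqr _ mo).
apply: (ge0_subset_integral _ mWL mo) Wo.
  exact: measurable_funTS (measurable_fun_borel (smooth_normc_measurable sf)).
by move=> z _; rewrite lee_fin addr_ge0 ?sqr_ge0.
Qed.

Lemma GS_norm_fin (R : realType) (d : nat) (N : nat -> nat -> R) (rho : 'rV[R]_d -> R)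
    (f : 'rV[R]_d -> R[i]) :
  (forall p q, 0 < N p q) -> GS N rho f -> GS_norm N rho f = (fine (GS_norm N rho f))%:E.
Proof.
move=> N0 [_ Goo]; rewrite fineK// ge0_fin_numE//.
apply: le_trans (ereal_sup_ubound _); last by exists (0%N, fun=> 0%N).
by rewrite mule_ge0 ?Lnorm_ge0// lee_fin invr_ge0 ltW.
Qed.

Theorem theorem2p2 (R : realType) (d : nat) (rho : 'rV[R]_d -> R) :
  (1 <= d)%N ->
  (forall x, 0 < rho x) ->
  contraction_map rho ->
  (exists m R0 : R, [/\ 0 < m, 0 < R0 &
     forall x, m <= rho x <= R0 * japanese_bracket x]) ->
  exists K r : R, [/\ 1 <= K, 1 <= r &
    forall gamma0 : R, 0 < gamma0 <= 1 ->
    exists2 K' : R, 1 <= K' &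
    forall (N : nat -> nat -> R) (omega : set 'rV[R]_d),
      (forall p q, 0 < N p q) ->
      nondecreasing2 N ->
      log_convex (fun p => N p p) ->
      quasi_analytic (fun p => N p p) ->
      lebesgue_measurable omega ->
      thick gamma0 rho omega ->
      forall eps : R, 0 < eps <= N 0%N 0%N ^+ 2 ->
      forall f : 'rV[R]_d -> R[i], GS N rho f ->
      let M := fun p => N p p in
      let t0 := Num.sqrt eps / (K * N d d) in
      let C_eps := C_const d gamma0 K' M (bang_degree t0 M r) in
      (Lp_norm 2%:E setT f ^+ 2 <=
         C_eps%:E * Lp_norm 2%:E omega f ^+ 2
         + eps%:E * GS_norm N rho f ^+ 2)%E].
Proof.
move=> d1 rho0 [L [L01 rhoL]] _.
have [v [v0 vE]] := eball_volume R d.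
have /= [q1 P1 A1] := constants_ge1 d1 L01 v0.
pose lam := 1 + (1 - L) / 2; pose c := 1 - L * lam.
pose eta := (1 - L) / (2 * d%:R); pose kap : R := 2 * d%:R.
pose q := kap / c ^+ 2; pose P := (4 * kap / (eta * c ^+ 2)) ^+ d.
pose A := 1 + (2 * lam / c) ^+ d * v.
exists (2 * A * P * expR d.+1%:R), (expR 1 * (d%:R * q)).
have E1 n : 1 <= expR n%:R :> R by rewrite -expR0 ler_expR.
split.
- rewrite mulr_ege1// mulr_ege1// mulr_ege1// ler1n//.
- by rewrite mulr_ege1 ?(E1 1%N)// mulr_ege1// ler1n.
move=> gam gam01.
exists (Num.max 1 ((2 / (1 - L)) ^+ d * v * (32 * expR 1 ^+ 2 / (gam * v)))).
  by rewrite le_max lexx.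
set K' := Num.max _ _.
move=> N omega N0 Nmon lc qa mo thick_omega eps /andP[eps0 epsN] f fGS.
pose M p := N p p.
have [W [mW Womega oW]] := borel_kernel mo.
have thickW x : ((gam * (rho x ^+ d * v))%:E <= borel_lebesgue (W `&` euclidean_ball x (rho x)))%E.
  apply: le_trans (oW x _ (rho0 x)); apply: le_trans (thick_omega x).
  rewrite (lebesgueE (measurable_eball x (rho x))) (eball_affine x (rho0 x)) vE.
  by rewrite -!EFinM.
have M0 i : 0 < M i by exact: N0.
have Mmon i j : (i <= j)%N -> M i <= M j by move=> ij; exact: Nmon.
pose sigma := Num.sqrt eps.
have sigma01 : 0 < sigma <= M d.
  rewrite sqrtr_gt0 eps0/= (le_trans _ (Mmon 0%N d _))//.
  by rewrite -(ger0_norm (ltW (M0 0%N))) -sqrtr_sqr ler_sqrt// sqr_ge0.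
pose G := fine (GS_norm N rho f) ^+ 2.
have G0 : 0 <= G by exact: sqr_ge0.
have L0 : 0 <= L by case/andP: L01.
have crho : continuous rho := rho_continuous L0 rhoL.
have [[su sv] Goo] := fGS.
have K'ge : (2 / (1 - L)) ^+ d * v * (32 * expR 1 ^+ 2 / (gam * v)) <= K'.
  by rewrite le_max lexx orbT.
have Hu := GS_word_bound N0 crho fGS su
  (fun s x => ler_wpDr (sqr_ge0 (foldr partial (fun y => complex.Im (f y)) s x)) (lexx _)).
have Hv := GS_word_bound N0 crho fGS sv
  (fun s x => ler_wpDl (sqr_ge0 (foldr partial (fun y => complex.Re (f y)) s x)) (lexx _)).
(* each of the two parts of f is allowed half of eps *)
have Bu := real_bound d1 su rho0 L01 rhoL M0 Mmon lc qa v0 vE gam01 mW thickW sigma01 G0 Hu K'ge.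
have Bv := real_bound d1 sv rho0 L01 rhoL M0 Mmon lc qa v0 vE gam01 mW thickW sigma01 G0 Hv K'ge.
have E := Lp_norm2_split measurableT (conj su sv).
apply: (@le_trans _ _ (Lp_norm 2%:E setT f ^+ 2)%E); first exact: lexx.
rewrite [leLHS]E.
apply: le_trans (leeD Bu Bv) _; rewrite addeACA; apply: leeD.
  rewrite -ge0_muleDr; last 2 first.
  - by apply: integral_ge0 => z _; rewrite lee_fin sqr_ge0.
  - by apply: integral_ge0 => z _; rewrite lee_fin sqr_ge0.
  rewrite -(Lp_norm2_split mW (conj su sv)).
  apply: lee_wpmul2l (Lp_norm2_subset mW mo Womega (conj su sv)).
  rewrite lee_fin /C_const mulr_ge0//; first by rewrite le_max ler01.
  apply: exprn_ge0; apply: mulr_ge0; last by apply: mulr_ge0; rewrite ?expR_ge0.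
  by apply: divr_ge0; [exact: mulr_ge0|case/andP: gam01 => /ltW].
rewrite (GS_norm_fin N0 fGS) -!EFinM -EFinD -[fine _ * _]/G lee_fin -mulrDl -splitr.
by rewrite /sigma sqr_sqrtr// ltW.
Qed.
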